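(* Let $\mathcal{G}$ and $\mathcal{G}'$ be totally disconnected étale groupoids and let $\pi:\mathcal{G}\to\mathcal{G}'$ be a continuous, surjective, proper homomorphism such that for every $x\in\mathcal{G}^{(0)}$, $\pi$ induces a bijection from $r^{-1}(x)$ to $r^{-1}(\pi(x))$. Suppose that $\pi$ is regular. Let $A$ be a discrete abelian group. Then there is a diagram consisting of two long exact sequences $$\cdots\to H_n(\mathcal{G}',A)\xrightarrow{H_n^*(\pi)}H_n(\mathcal{G},A)\to H_n(\mathcal{G}/\mathcal{G}',A)\to H_{n-1}(\mathcal{G}',A)\to\cdots$$ $$\cdots\to H_n(\mathcal{G}'_\pi,A)\xrightarrow{H_n^*(\pi)}H_n(\mathcal{G}_\pi,A)\to H_n(\mathcal{G}_\pi/\mathcal{G}'_\pi,A)\to H_{n-1}(\mathcal{G}'_\pi,A)\to\cdots$$ (where $H_n^*(\pi)$ is induced by pull-back along $\pi$ and the other maps are induced by the quotient maps of complexes and the connecting homomorphisms) together with an identification $H_n(\mathcal{G}/\mathcal{G}',A)=H_n(\mathcal{G}_\pi/\mathcal{G}'_\pi,A)$ for every $n\ge0$, induced by the isomorphism of quotient complexes $\mathcal{C}(\mathcal{G},A)/\mathcal{C}(\mathcal{G}',A)\cong\mathcal{C}(\mathcal{G}_\pi,A)/\mathcal{C}(\mathcal{G}'_\pi,A)$ given in degree $n$ by the reduction map $\Pi_n$ of $\pi^{(n)}$.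
   Context: An étale groupoid means a second countable locally compact Hausdorff topological groupoid whose range map is a local homeomorphism. $\mathcal{G}^{(0)}$ is the unit space, $s(g)=g^{-1}g$, $r(g)=gg^{-1}$. Totally disconnected: connected components are singletons. For $n\ge1$, $\mathcal{G}^{(n)}$ is the space of $(g_1,\dots,g_n)\in\mathcal{G}^n$ with $s(g_i)=r(g_{i+1})$. Put $\pi^{(n)}(g_1,\dots,g_n)=(\pi(g_1),\dots,\pi(g_n))$ for $n\geq1$ and $\pi^{(0)}=\pi|_{\mathcal{G}^{(0)}}$. Homology. $C_c(X,A)$: continuous compactly supported functions $X\to A$. For a local homeomorphism $\phi:X\to Y$, $\phi_*(f)(y)=\sum_{\phi(x)=y}f(x)$. For $n\ge2$, $d_0(g_1,\dots,g_n)=(g_2,\dots,g_n)$, $d_i(g_1,\dots,g_n)=(g_1,\dots,g_ig_{i+1},\dots,g_n)$ for $1\le i\le n-1$, $d_n(g_1,\dots,g_n)=(g_1,\dots,g_{n-1})$; for $n=1$, $d_0=s$, $d_1=r$. $\partial_n=\sum_{i=0}^n(-1)^id_{i*}$; $\mathcal{C}(\mathcal{G},A)=(C_c(\mathcal{G}^{(n)},A),\partial_n)_{n\ge0}$ has homology $H_n(\mathcal{G},A)$. A continuous proper surjective homomorphism $\pi$ with the fibre-bijection property above induces by $f\mapsto f\circ\pi^{(n)}$ an injective chain map $\pi^*:\mathcal{C}(\mathcal{G}',A)\to\mathcal{C}(\mathcal{G},A)$, inducing $H_n^*(\pi)$ on homology; $H_*(\mathcal{G}/\mathcal{G}',A)$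 denotes the homology of the quotient complex $\mathcal{C}(\mathcal{G},A)/\mathcal{C}(\mathcal{G}',A)$, with $\mathcal{C}(\mathcal{G}',A)$ regarded as a subcomplex via $\pi^*$. Likewise for $\mathcal{G}_\pi,\mathcal{G}'_\pi$ and $\pi|_{\mathcal{G}_\pi}:\mathcal{G}_\pi\to\mathcal{G}'_\pi$. Regular maps. Let $(X,d),(X',d')$ be locally compact metric spaces and $\pi:X\to X'$ a continuous proper surjection. Write $\operatorname{diam}(K)$ for diameter and $d_{\mathrm H}$ for the Hausdorff metric on non-empty compact subsets of $X$. $\pi$ is regular if for every $x'\in X'$ and $\varepsilon>0$ there is an open neighborhood $U'$ of $x'$ such that for every $y'\in U'$ either $d_{\mathrm H}(\pi^{-1}(x'),\pi^{-1}(y'))<\varepsilon$ or $\operatorname{diam}\pi^{-1}(y')<\varepsilon$. Put $X'_\pi=\{x'\in X':\#\pi^{-1}(x')>1\}$ and $X_\pi=\pi^{-1}(X'_\pi)$, with metrics $d'_\pi(x',y')=d_{\mathrm H}(\pi^{-1}(x'),\pi^{-1}(y'))$ on $X'_\pi$ and $d_\pi(x,y)=d(x,y)+d'_\pi(\pi(x),\pi(y))$ on $X_\pi$. If $\pi$ is regular these are locally compact and $\pi:X_\pi\to X'_\pi$ is continuous, proper and open. Regularity and the resulting topologies depend only on the topologies of $X,X'$. Groupoid case. Fix metrics compatible with the topologies of $\mathcal{G}$ and $\mathcal{G}'$, and use restrictions of the $\ell^1$-product metrics on $\mathcal{G}^{(n)},\mathcal{G}'^{(n)}$ and restricted metrics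 on unit spaces. If $\pi:\mathcal{G}\to\mathcal{G}'$ is regular, then so is each $\pi^{(n)}$; $\mathcal{G}_\pi$ and $\mathcal{G}'_\pi$ (subgroupoids of $\mathcal{G},\mathcal{G}'$ with the topologies of $d_\pi,d'_\pi$) are étale groupoids, and $(\mathcal{G}_\pi)^{(n)}=(\mathcal{G}^{(n)})_{\pi^{(n)}}$, $(\mathcal{G}'_\pi)^{(n)}=(\mathcal{G}'^{(n)})_{\pi^{(n)}}$ as topological spaces. Reduction map. For $\pi:X\to X'$ regular with $X,X'$ totally disconnected, view $C_c(X',A)\subset C_c(X,A)$ and $C_c(X'_\pi,A)\subset C_c(X_\pi,A)$ via composition with $\pi$. For $f\in C_c(X,A)$ and compact open $K'\subset X'_\pi$ let $f_{K'}\in C_c(X_\pi,A)$ equal $f$ on $\pi^{-1}(K')$ and $0$ elsewhere. For all sufficiently large compact open $K'$ the class of $f_{K'}$ in $C_c(X_\pi,A)/C_c(X'_\pi,A)$ is independent of $K'$; it is denoted $\Pi(f)$. The homomorphism $\Pi:C_c(X,A)\to C_c(X_\pi,A)/C_c(X'_\pi,A)$ vanishes on $C_c(X',A)$ and is also regarded as a map on $C_c(X,A)/C_c(X',A)$. $\Pi_n$ is the reduction map of $\pi^{(n)}:\mathcal{G}^{(n)}\to\mathcal{G}'^{(n)}$. *)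

(* Defs.v *)
From HB Require Import structures.
From mathcomp Require Import all_boot all_order all_algebra.
From mathcomp Require Import generic_quotient ring_quotient.
From mathcomp Require Import all_classical all_reals all_analysis.

Set Implicit Arguments.
Unset Strict Implicit.
Unset Printing Implicit Defensive.

Import Order.TTheory GRing.Theory Num.Theory.
Local Open Scope classical_set_scope.
Local Open Scope ring_scope.
Local Open Scope quotient_scope.

Section QuotientMap.
Variables (V W : zmodType) (S : zmodClosed V) (T : zmodClosed W).
Variables (f : {additive V -> W}) (fST : forall x, x \in S -> f x \in T).

Definition quot_map_fun (c : Quotient.quot S) : Quotient.quot T :=
  \pi_(Quotient.quot T) (f (repr c)).

Lemma quot_map_funE (x : V) :
  quot_map_fun (\pi_(Quotient.quot S) x) = \pi_(Quotient.quot T) (f x).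
Proof.
apply/eqP; rewrite -Quotient.idealrBE -raddfB; apply: fST.
by rewrite Quotient.idealrBE reprK.
Qed.

Lemma quot_map_is_zmod_morphism : zmod_morphism quot_map_fun.
Proof.
move=> x y; rewrite -[x]reprK -[y]reprK -raddfB /= !quot_map_funE.
by rewrite !raddfB.
Qed.

Definition quot_map : {additive Quotient.quot S -> Quotient.quot T} :=
  HB.pack quot_map_fun
    (GRing.isZmodMorphism.Build _ _ quot_map_fun quot_map_is_zmod_morphism).

Lemma quot_mapE (x : V) :
  quot_map (\pi_(Quotient.quot S) x) = \pi_(Quotient.quot T) (f x).
Proof. exact: quot_map_funE. Qed.

End QuotientMap.
Arguments quot_map {V W} S T {f} fST.

Section Image.
Variables (V W : zmodType) (f : {additive V -> W}).

Definition img_pred : {pred W} := fun w => `[< exists v, f v = w >].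

Lemma img_zmod_closed : zmod_closed img_pred.
Proof.
split; first by apply/asboolP; exists 0; rewrite raddf0.
move=> _ _ /asboolP[x <-] /asboolP[y <-]; apply/asboolP.
by exists (x - y); rewrite raddfB.
Qed.

HB.instance Definition _ := GRing.isZmodClosed.Build W img_pred img_zmod_closed.

End Image.

Record chainComplex := ChainComplex {
  chain :> nat -> zmodType;
  bd : forall n, {additive chain n.+1 -> chain n};
  bd_bd : forall n (x : chain n.+2), bd n (bd n.+1 x) = 0
}.

Section Homology.
Variable C : chainComplex.

Definition cycle_pred n : {pred C n} :=
  match n return {pred C n} with
  | 0 => fun _ => true
  | m.+1 => fun x => bd C m x == 0
  end.
Arguments cycle_pred : clear implicits.

Lemma cycle_zmod_closed n : zmod_closed (cycle_pred n).
Proof.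
case: n => [|n]; split=> //; first by rewrite unfold_in /= raddf0.
by move=> x y /eqP x0 /eqP y0; rewrite unfold_in /= raddfB x0 y0 subrr.
Qed.

HB.instance Definition _ n :=
  GRing.isZmodClosed.Build (C n) (cycle_pred n) (@cycle_zmod_closed n).

Record cycles n := Cycle { cyval : C n ; cyvalP : cyval \in cycle_pred n }.

HB.instance Definition _ n := [isSub for @cyval n].
HB.instance Definition _ n := [Choice of cycles n by <:].
HB.instance Definition _ n := [SubChoice_isSubZmodule of cycles n by <:].

Definition boundary_pred n : {pred cycles n} :=
  fun z => `[< exists y, bd C n y = cyval z >].

Lemma boundary_zmod_closed n : zmod_closed (@boundary_pred n).
Proof.
split; first by apply/asboolP; exists 0; rewrite raddf0.
move=> x y /asboolP[u ux] /asboolP[v vy]; apply/asboolP.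
by exists (u - v); rewrite raddfB ux vy.
Qed.

HB.instance Definition _ n :=
  GRing.isZmodClosed.Build (cycles n) (@boundary_pred n)
    (@boundary_zmod_closed n).

Definition homology n : zmodType := Quotient.quot (@boundary_pred n).

Definition hclass n (z : cycles n) : homology n :=
  \pi_(Quotient.quot (@boundary_pred n)) z.

End Homology.

Record chainMap (C D : chainComplex) := ChainMap {
  cmap :> forall n, {additive C n -> D n};
  cmap_bd : forall n (x : C n.+1), cmap n (bd C n x) = bd D n (cmap n.+1 x)
}.

Section HomologyMap.
Variables (C D : chainComplex) (f : chainMap C D) (n : nat).

Lemma cmap_cycle (z : cycles C n) : f n (cyval z) \in @cycle_pred D n.
Proof.
case: n z => [//|m] [z /= zP]; move: zP; rewrite !unfold_in /= => /eqP z0.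
by rewrite -cmap_bd z0 raddf0.
Qed.

Definition cycles_map (z : cycles C n) : cycles D n := Cycle (cmap_cycle z).

Lemma cycles_map_is_zmod_morphism : zmod_morphism cycles_map.
Proof. by move=> x y; apply: val_inj; rewrite /= raddfB. Qed.

HB.instance Definition _ :=
  GRing.isZmodMorphism.Build _ _ cycles_map cycles_map_is_zmod_morphism.

Lemma cycles_map_boundary (z : cycles C n) :
  z \in @boundary_pred C n -> cycles_map z \in @boundary_pred D n.
Proof.
by move=> /asboolP[y yz]; apply/asboolP; exists (f n.+1 y); rewrite -cmap_bd yz.
Qed.

Definition hmap : {additive homology C n -> homology D n} :=
  quot_map (@boundary_pred C n) (@boundary_pred D n) cycles_map_boundary.

End HomologyMap.

Section QuotientComplex.
Variables (C' C : chainComplex) (i : chainMap C' C).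

Lemma bd_img n (x : C n.+1) :
  x \in img_pred (i n.+1) -> bd C n x \in img_pred (i n).
Proof.
by move=> /asboolP[y <-]; apply/asboolP; exists (bd C' n y); rewrite cmap_bd.
Qed.

Definition quot_chain n : zmodType := Quotient.quot (img_pred (i n)).

Definition quot_bd n : {additive quot_chain n.+1 -> quot_chain n} :=
  quot_map (img_pred (i n.+1)) (img_pred (i n)) (@bd_img n).

Lemma quot_bd_bd n (x : quot_chain n.+2) : quot_bd n (quot_bd n.+1 x) = 0.
Proof. by rewrite -[x]reprK /quot_bd !quot_mapE bd_bd raddf0. Qed.

Definition quotComplex : chainComplex := ChainComplex quot_bd_bd.

Definition quot_proj_fun n : {additive C n -> quotComplex n} :=
  \pi_(Quotient.quot (img_pred (i n))).

Lemma quot_proj_bd n (x : C n.+1) :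
  quot_proj_fun n (bd C n x) = bd quotComplex n (quot_proj_fun n.+1 x).
Proof. by rewrite /bd /quot_bd quot_mapE. Qed.

Definition quot_proj : chainMap C quotComplex := ChainMap quot_proj_bd.

(* the connecting homomorphism sends [c + i(C')] to [c'] when i(c') = bd c *)
Definition connecting n
    (delta : homology quotComplex n.+1 -> homology C' n) : Prop :=
  forall (z : cycles quotComplex n.+1) (c : C n.+1) (c' : cycles C' n),
    cyval z = quot_proj n.+1 c -> i n (cyval c') = bd C n c ->
    delta (hclass z) = hclass c'.

Definition exact_at (U V W : zmodType) (f : U -> V) (g : V -> W) : Prop :=
  range f = [set v | g v = 0].

Definition long_exact_sequence
    (delta : forall n, {additive homology quotComplex n.+1 -> homology C' n})
    : Prop :=
  [/\ forall n, exact_at (hmap i n) (hmap quot_proj n),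
      forall n, exact_at (hmap quot_proj n.+1) (delta n),
      forall n, exact_at (delta n) (hmap i n)
    & forall c, exists b, hmap quot_proj 0 b = c].

End QuotientComplex.

Section CompactlySupported.
Variables (X : topologicalType) (A : zmodType).

Definition is_Cc : {pred X -> A} := fun f =>
  `[< continuous (f : X -> discrete_topology A) /\
      compact (closure [set x | f x != 0]) >].

Lemma continuous_discreteP (f : X -> A) :
  continuous (f : X -> discrete_topology A) <->
  forall x, \forall y \near x, f y = f x.
Proof.
split=> [cf x|cf x U].
  apply: (cf x [set f x]); rewrite /nbhs /=.
  by apply/principal_filterP.
rewrite {1}/nbhs /= => /principal_filterP Ufx.
by apply: filterS (cf x) => y /= ->.
Qed.

Lemma is_Cc_zmod_closed : zmod_closed is_Cc.
Proof.
split.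
  apply/asboolP; split.
    by apply: (@cst_continuous _ (discrete_topology A)).
  rewrite (_ : [set x | _] = set0) ?closure0; first exact: compact0.
  by apply/seteqP; split=> x //=; rewrite eqxx.
move=> f g /asboolP[cf kf] /asboolP[cg kg]; apply/asboolP; split.
  apply/continuous_discreteP => x.
  move/continuous_discreteP/(_ x) : cf => cf.
  move/continuous_discreteP/(_ x) : cg => cg.
  by apply: filterS2 cf cg => y fy gy; rewrite !fctE fy gy.
apply: (subclosed_compact _ (compactU kf kg)); first exact: closed_closure.
rewrite -closureU; apply: closureS => x /=; rewrite !fctE => fg0.
have [f0|] := eqVneq (f x) 0; last by left.
by right; apply: contra_neq fg0 => ->; rewrite f0 subrr.
Qed.

HB.instance Definition _ :=
  GRing.isZmodClosed.Build (X -> A) is_Cc is_Cc_zmod_closed.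

Record Cc := MkCc { Cc_fun :> X -> A ; CcP : Cc_fun \in is_Cc }.

HB.instance Definition _ := [isSub for Cc_fun].
HB.instance Definition _ := [Choice of Cc by <:].
HB.instance Definition _ := [SubChoice_isSubZmodule of Cc by <:].

End CompactlySupported.

(* The sum is 0 by convention when infinitely many terms are nonzero; this does
   not happen for f in Cc X A and phi a local homeomorphism. *)
Definition pushforward (X Y : topologicalType) (A : zmodType)
    (phi : X -> Y) (f : X -> A) : Y -> A :=
  fun y => \sum_(x \in phi @^-1` [set y]) f x.

(* Cc X' A viewed inside Cc X A via composition with p : X -> X' *)
Section Pullback.
Variables (X X' : topologicalType) (p : X -> X') (A : zmodType).

Definition pullback_pred : {pred Cc X A} :=
  fun f => `[< exists f' : Cc X' A, forall x, f x = f' (p x) >].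

Lemma pullback_zmod_closed : zmod_closed pullback_pred.
Proof.
split; first by apply/asboolP; exists 0.
move=> f g /asboolP[f' ff'] /asboolP[g' gg']; apply/asboolP.
by exists (f' - g') => x; rewrite /= !fctE ff' gg'.
Qed.

HB.instance Definition _ :=
  GRing.isZmodClosed.Build (Cc X A) pullback_pred pullback_zmod_closed.

End Pullback.
Arguments pullback_pred {X X'} p A _.

Definition local_homeo (X Y : topologicalType) (f : X -> Y) : Prop :=
  forall x, exists U : set X,
    [/\ open U, U x, set_inj U f, {within U, continuous f}
      & forall V, open V -> V `<=` U -> open (f @` V)].

Definition homeo (X Y : topologicalType) (f : X -> Y) : Prop :=
  exists g : Y -> X, [/\ cancel f g, cancel g f, continuous f & continuous g].

Definition proper_map (X Y : topologicalType) (f : X -> Y) : Prop :=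
  forall K : set Y, compact K -> compact (f @^-1` K).

(* [gmul] is total, but [gmul g h] is meaningful only when g and h are
   composable, that is s(g) = r(h) with s(g) = g^-1 g and r(h) = h h^-1. *)
Record groupoid (T : Type) := Groupoid {
  gmul : T -> T -> T;
  ginv : T -> T;
  gs := fun g => gmul (ginv g) g;
  gr := fun g => gmul g (ginv g);
  gcomp := fun g h => gs g = gr h;
  ginvK : involutive ginv;
  gmulA : forall g h k, gcomp g h -> gcomp h k ->
    [/\ gcomp (gmul g h) k, gcomp g (gmul h k)
      & gmul (gmul g h) k = gmul g (gmul h k)];
  gmulKV : forall g h, gcomp g h -> gmul (ginv g) (gmul g h) = h;
  gmulVK : forall g h, gcomp g h -> gmul (gmul g h) (ginv h) = g
}.

Section GroupoidTheory.
Variables (T : Type) (G : groupoid T).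
Implicit Types g h : T.

Definition gunits : set T := range (gr G).

Lemma gs_inv g : gs G (ginv G g) = gr G g.
Proof. by rewrite /gs /gr ginvK. Qed.

Lemma gr_inv g : gr G (ginv G g) = gs G g.
Proof. by rewrite /gs /gr ginvK. Qed.

Lemma gcompV g : gcomp G g (ginv G g).
Proof. by rewrite /gcomp -/(gs G g) -/(gr G _) gr_inv. Qed.

Lemma gcompVl g : gcomp G (ginv G g) g.
Proof. by rewrite /gcomp -/(gs G _) -/(gr G _) gs_inv. Qed.

Lemma gr_mul g h : gcomp G g h -> gr G (gmul G g h) = gr G g.
Proof.
move=> gh; have [_ + _] := gmulA (gcompVl g) gh.
by rewrite /gcomp -/(gs G _) -/(gr G _) gs_inv => ->.
Qed.

Lemma gs_mul g h : gcomp G g h -> gs G (gmul G g h) = gs G h.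
Proof.
move=> gh; have [+ _ _] := gmulA gh (gcompV h).
by rewrite /gcomp -/(gs G _) -/(gr G _) gr_inv => ->.
Qed.

Lemma gr_gr g : gr G (gr G g) = gr G g.
Proof. exact: gr_mul (gcompV g). Qed.

Lemma gs_gr g : gs G (gr G g) = gr G g.
Proof. by rewrite {2}/gr gs_mul ?gs_inv //; exact: gcompV. Qed.

Lemma gunits_r g : gr G g \in gunits.
Proof. by apply: mem_set; exists g. Qed.

Lemma gunits_s g : gs G g \in gunits.
Proof. by rewrite -gr_inv gunits_r. Qed.

Definition gr_unit g : gunits := exist _ (gr G g) (gunits_r g).
Definition gs_unit g : gunits := exist _ (gs G g) (gunits_s g).

End GroupoidTheory.


Lemma gr_gs (T : Type) (G : groupoid T) g : gr G (gs G g) = gs G g.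
Proof. by rewrite -gr_inv gr_gr. Qed.

Section Homomorphism.
Variables (T T' : Type) (G : groupoid T) (G' : groupoid T') (p : T -> T').

Definition is_hom : Prop := forall g h, gcomp G g h ->
  gcomp G' (p g) (p h) /\ p (gmul G g h) = gmul G' (p g) (p h).

Definition fibre_bijective : Prop := forall x, gunits G x ->
  set_bij (gr G @^-1` [set x]) (gr G' @^-1` [set p x]) p.

Hypothesis hp : is_hom.

Lemma hom_gr g : p (gr G g) = gr G' (p g).
Proof.
have gu : gcomp G (ginv G g) (gr G g).
  by rewrite /gcomp -/(gs G _) -/(gr G (gr G g)) gs_inv gr_gr.
have uu : gcomp G (gr G g) (gr G g).
  by rewrite /gcomp -/(gs G (gr G g)) -/(gr G (gr G g)) gs_gr gr_gr.
have rr : gmul G (gr G g) (gr G g) = gr G g.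
  have [_ _ e] := gmulA (gcompV G g) gu.
  by rewrite {1}/gr e gmulKV //; exact: gcompV.
have [puu pE] := hp uu.
have [pgV pgE] := hp (gcompV G g).
have su : gs G' (p (gr G g)) = p (gr G g).
  by rewrite {1}/gs -{2}rr pE gmulKV.
by rewrite -su -gr_gs su {1}/gr pgE -/(gr G' _) gr_mul.
Qed.

Lemma hom_inv g : p (ginv G g) = ginv G' (p g).
Proof.
have [pgV pgE] := hp (gcompV G g).
have := hom_gr g; rewrite {1}/gr pgE => e.
rewrite -[LHS](gmulKV pgV) e /gr gmulKV //; exact: gcompV.
Qed.

Lemma hom_gs g : p (gs G g) = gs G' (p g).
Proof. by rewrite -gr_inv hom_gr hom_inv gr_inv. Qed.

End Homomorphism.

Section Nerve.
Variables (T : topologicalType) (G : groupoid T).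

Definition composable n : set (prod_topology (fun _ : 'I_n => T)) :=
  [set g | forall i j : 'I_n, j = i.+1 :> nat -> gcomp G (g i) (g j)].

Arguments composable : clear implicits.

(* [nerve n] is the space of n composable elements, for n = 0 the unit space *)
Definition nerve n : topologicalType :=
  match n with
  | 0 => gunits G
  | m.+1 => composable m.+1
  end.

(* (g_1, ..., g_(m+2)) is stored as g 0, ..., g m.+1 *)
Definition face_fun m (i : 'I_m.+3) (g : 'I_m.+2 -> T) (j : 'I_m.+1) : T :=
  let a := g (widen_ord (leqnSn m.+1) j) in
  let b := g (lift ord0 j) in
  if (j.+1 < i)%N then a else if j.+1 == i :> nat then gmul G a b else b.

Lemma face_composable m (i : 'I_m.+3) (g : composable m.+2) :
  face_fun i (val g) \in composable m.+1.
Proof.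
have /set_mem cg := valP g.
apply: mem_set => j k jk; rewrite /face_fun /=.
have jj : gcomp G (val g (widen_ord (leqnSn m.+1) j)) (val g (lift ord0 j)).
  exact: cg.
have kk : gcomp G (val g (widen_ord (leqnSn m.+1) k)) (val g (lift ord0 k)).
  exact: cg.
have e : widen_ord (leqnSn m.+1) k = lift ord0 j.
  exact: val_inj.
rewrite -{}e in jj *; rewrite jk.
have [ji|ij|ji] := ltngtP j.+1 i.
- have [ki|ki|ki] := ltngtP j.+2 i => //.
  + by rewrite ltnNge ji in ki.
  + by rewrite /gcomp -/(gs G _) -/(gr G (gmul _ _ _)) gr_mul.
- rewrite ltnNge (ltnW (ltnW _)) //= gtn_eqF //; exact: ltnW.
- rewrite -ji ltnNge leqnSn /= gtn_eqF //.
  by rewrite /gcomp -/(gs G (gmul _ _ _)) -/(gr G _) gs_mul.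
Qed.

Definition face n : 'I_n.+2 -> nerve n.+1 -> nerve n :=
  match n return 'I_n.+2 -> nerve n.+1 -> nerve n with
  | 0 => fun i g =>
      if i == ord0 then gs_unit G (val g ord0) else gr_unit G (val g ord0)
  | m.+1 => fun i g => exist _ (face_fun i (val g)) (face_composable i g)
  end.

(* l1 product distance on n composable elements, restriction to the units *)
Definition nerve_dist (R : realType) (d : T -> T -> R) n :
    nerve n -> nerve n -> R :=
  match n return nerve n -> nerve n -> R with
  | 0 => fun x y => d (val x) (val y)
  | m.+1 => fun g h => \sum_(i < m.+1) d (val g i) (val h i)
  end.

End Nerve.
Arguments composable {T} G n _.
Arguments face {T G n} i g.
Arguments nerve_dist {T G R} d n g h.

Section NerveMap.
Variables (T T' : topologicalType) (G : groupoid T) (G' : groupoid T').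
Variables (p : T -> T') (hp : is_hom G G' p).

Lemma hom_unit (x : gunits G) : p (val x) \in gunits G'.
Proof.
have /set_mem [g _ <-] := valP x.
by rewrite (hom_gr hp); exact: gunits_r.
Qed.

Lemma hom_composable n (g : composable G n) :
  (fun i => p (val g i)) \in composable G' n.
Proof.
have /set_mem cg := valP g.
by apply: mem_set => i j ij; case: (hp (cg _ _ ij)).
Qed.

Definition nerve_map n : nerve G n -> nerve G' n :=
  match n return nerve G n -> nerve G' n with
  | 0 => fun x => exist _ (p (val x)) (hom_unit x)
  | m.+1 => fun g => exist _ (fun i => p (val g i)) (hom_composable g)
  end.

End NerveMap.
Arguments nerve_map {T T' G G' p} hp n g.

Record topological_groupoid (T : topologicalType) (G : groupoid T) : Prop := {
  continuous_ginv : continuous (ginv G);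
  continuous_gmul : {within [set gh : T * T | gcomp G gh.1 gh.2],
    continuous (fun gh : T * T => gmul G gh.1 gh.2)}
}.

Record etale (T : topologicalType) (G : groupoid T) : Prop := {
  etale_topological : topological_groupoid G;
  etale_second_countable : @second_countable T;
  etale_locally_compact : locally_compact [set: T];
  etale_hausdorff : hausdorff_space T;
  etale_range : local_homeo (gr_unit G)
}.

(* The complex C(G, A); [gcx_bdE] determines [gcx_bd], so that this record has
   at most one inhabitant up to proofs. *)
Record groupoid_complex (T : topologicalType) (G : groupoid T) (A : zmodType)
    := GroupoidComplex {
  gcx_bd : forall n, {additive Cc (nerve G n.+1) A -> Cc (nerve G n) A};
  gcx_bdE : forall n (f : Cc (nerve G n.+1) A) (y : nerve G n),
    gcx_bd n f y =
      \sum_(i < n.+2) pushforward (@face _ G n i) f y *~ ((-1) ^+ i);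
  gcx_bd_bd : forall n (f : Cc (nerve G n.+2) A), gcx_bd n (gcx_bd n.+1 f) = 0
}.

Definition complex_of (T : topologicalType) (G : groupoid T) (A : zmodType)
  (C : groupoid_complex G A) : chainComplex := ChainComplex (gcx_bd_bd C).
Coercion complex_of : groupoid_complex >-> chainComplex.

Section PullbackChainMap.
Variables (T T' : topologicalType) (G : groupoid T) (G' : groupoid T').
Variables (p : T -> T') (hp : is_hom G G' p) (A : zmodType).
Variables (C : groupoid_complex G A) (C' : groupoid_complex G' A).

Definition is_pullback (i : chainMap C' C) : Prop :=
  forall n (f : Cc (nerve G' n) A) (x : nerve G n),
    (i n f : Cc (nerve G n) A) x = f (nerve_map hp n x).

End PullbackChainMap.

(* The topology whose open sets are those that contain a d-ball around each of
   their points; the definition does not require d to be a metric. *)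
Definition dist_space (R : realType) (T : choiceType)
  (d : T -> T -> R) : Type := T.

Section DistSpace.
Variables (R : realType) (T : choiceType) (d : T -> T -> R).

Definition dist_open : set (set T) :=
  [set U | forall x, U x -> exists2 e, 0 < e & [set y | d x y < e] `<=` U].

Let dist_openT : dist_open setT.
Proof. by move=> x _; exists 1. Qed.

Let dist_openI : setI_closed dist_open.
Proof.
move=> U V oU oV x [/oU[e e0 eU] /oV[e' e'0 e'V]].
exists (Num.min e e'); first by rewrite lt_min e0.
by move=> y /=; rewrite lt_min => /andP[/eU ? /e'V ?]; split.
Qed.

Let dist_open_bigU (I : Type) (f : I -> set T) :
  (forall i, dist_open (f i)) -> dist_open (\bigcup_i f i).
Proof.
move=> of_ x [i _ /of_ [e e0 ei]]; exists e => // y /ei fy.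
by exists i.
Qed.

HB.instance Definition _ := Choice.on (dist_space d).
HB.instance Definition _ := isOpenTopological.Build (dist_space d)
  dist_openT dist_openI dist_open_bigU.

End DistSpace.

Section Regular.
Variables (R : realType) (X : choiceType) (d : X -> X -> R).

(* [diam] and [hausdorff_dist] are used for nonempty compact sets only, where
   the suprema and infima below exist; elsewhere [sup] and [inf] may be the
   default value 0. *)
Definition diam (K : set X) : R := sup [set d u.1 u.2 | u in K `*` K].

Definition hausdorff_dist (K L : set X) : R :=
  Num.max (sup [set inf [set d x y | y in L] | x in K])
          (sup [set inf [set d x y | x in K] | y in L]).

(* only the topology of X' matters here, a metric on it is not needed *)
Definition regular_map (X' : topologicalType) (p : X -> X') : Prop :=
  forall (x' : X') (e : R), 0 < e -> exists U' : set X',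
    [/\ open U', U' x' & forall y', U' y' ->
      hausdorff_dist (p @^-1` [set x']) (p @^-1` [set y']) < e \/
      diam (p @^-1` [set y']) < e].

Variables (X' : choiceType) (p : X -> X').

Definition multiple_fibre : set X' :=
  [set x' | exists x y, [/\ x <> y, p x = x' & p y = x']].

Definition bpi_dist (x' y' : multiple_fibre) : R :=
  hausdorff_dist (p @^-1` [set val x']) (p @^-1` [set val y']).

Lemma restr_multiple (x : p @^-1` multiple_fibre) :
  p (val x) \in multiple_fibre.
Proof. by have /set_mem := valP x => ?; apply: mem_set. Qed.

Definition pi_restr_fun (x : p @^-1` multiple_fibre) : multiple_fibre :=
  exist _ (p (val x)) (restr_multiple x).

Definition tpi_dist (x y : p @^-1` multiple_fibre) : R :=
  d (val x) (val y) + bpi_dist (pi_restr_fun x) (pi_restr_fun y).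

(* X_pi and X'_pi *)
Definition tpi : topologicalType := dist_space tpi_dist.
Definition bpi : topologicalType := dist_space bpi_dist.

Definition pi_restr : tpi -> bpi := pi_restr_fun.
Definition tpi_val : tpi -> X := fun x => val x.
Definition bpi_val : bpi -> X' := fun x => val x.

End Regular.

Section Reduction.
Variables (R : realType) (X X' : topologicalType) (d : X -> X -> R).
Variables (p : X -> X') (A : zmodType).

Definition truncation (K' : set (bpi d p)) (f : X -> A) : tpi d p -> A :=
  fun x => if `[< K' (pi_restr x) >] then f (tpi_val x) else 0.

Definition Cc_quot : zmodType :=
  Quotient.quot (pullback_pred (@pi_restr _ _ d _ p) A).

(* c is the common class of f_K' for all sufficiently large compact open K' *)
Definition is_reduction (f : Cc X A) (c : Cc_quot) : Prop :=
  exists K0 : set (bpi d p), [/\ compact K0, open K0 &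
    forall K' : set (bpi d p), compact K' -> open K' -> K0 `<=` K' ->
      exists fK : Cc (tpi d p) A,
        (forall x, fK x = truncation K' f x) /\ c = \pi_Cc_quot fK].

End Reduction.

Section Subgroupoid.
Variables (T : Type) (G : groupoid T) (S : set T).
Hypothesis S_inv : forall g, S g -> S (ginv G g).
Hypothesis S_mul : forall g h, S g -> S h -> gcomp G g h -> S (gmul G g h).

Definition sub_inv (g : S) : S :=
  exist _ (ginv G (val g)) (mem_set (S_inv (set_mem (valP g)))).

Definition sub_mul (g h : S) : S :=
  match pselect (gcomp G (val g) (val h)) with
  | left gh => exist _ (gmul G (val g) (val h))
      (mem_set (S_mul (set_mem (valP g)) (set_mem (valP h)) gh))
  | right _ => g
  end.

Lemma sub_mulE (g h : S) : gcomp G (val g) (val h) ->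
  val (sub_mul g h) = gmul G (val g) (val h).
Proof. by rewrite /sub_mul; case: pselect. Qed.

Lemma sub_comp (g h : S) :
  sub_mul (sub_inv g) g = sub_mul h (sub_inv h) <-> gcomp G (val g) (val h).
Proof.
have sE := sub_mulE (gcompVl G (val g) : gcomp G (val (sub_inv g)) (val g)).
have rE := sub_mulE (gcompV G (val h) : gcomp G (val h) (val (sub_inv h))).
split=> [e|e]; first by have := congr1 val e; rewrite sE rE.
by apply: val_inj; rewrite sE rE.
Qed.

Lemma sub_invK : involutive sub_inv.
Proof. by move=> g; apply: val_inj; rewrite /= ginvK. Qed.

Lemma sub_mulA (g h k : S) :
  sub_mul (sub_inv g) g = sub_mul h (sub_inv h) ->
  sub_mul (sub_inv h) h = sub_mul k (sub_inv k) ->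
  [/\ sub_mul (sub_inv (sub_mul g h)) (sub_mul g h) = sub_mul k (sub_inv k),
      sub_mul (sub_inv g) g = sub_mul (sub_mul h k) (sub_inv (sub_mul h k))
    & sub_mul (sub_mul g h) k = sub_mul g (sub_mul h k)].
Proof.
move=> /sub_comp gh /sub_comp hk; have [ghk1 ghk2 e] := gmulA gh hk.
have c1 : gcomp G (val (sub_mul g h)) (val k) by rewrite sub_mulE.
have c2 : gcomp G (val g) (val (sub_mul h k)) by rewrite sub_mulE.
split; [exact/sub_comp|exact/sub_comp|].
by apply: val_inj; rewrite !sub_mulE.
Qed.

Lemma sub_mulKV (g h : S) : sub_mul (sub_inv g) g = sub_mul h (sub_inv h) ->
  sub_mul (sub_inv g) (sub_mul g h) = h.
Proof.
move=> /sub_comp gh; apply: val_inj; rewrite sub_mulE sub_mulE ?gmulKV //=.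
by rewrite /gcomp -/(gs G _) -/(gr G (gmul _ _ _)) gs_inv gr_mul.
Qed.

Lemma sub_mulVK (g h : S) : sub_mul (sub_inv g) g = sub_mul h (sub_inv h) ->
  sub_mul (sub_mul g h) (sub_inv h) = g.
Proof.
move=> /sub_comp gh; apply: val_inj; rewrite sub_mulE sub_mulE ?gmulVK //=.
by rewrite /gcomp -/(gs G (gmul _ _ _)) -/(gr G _) gr_inv gs_mul.
Qed.

Definition subgroupoid : groupoid S :=
  Groupoid sub_invK sub_mulA sub_mulKV sub_mulVK.

Lemma subgroupoid_val_hom : is_hom subgroupoid G val.
Proof.
move=> g h /sub_comp gh; split=> //; exact: sub_mulE.
Qed.

End Subgroupoid.

Section GroupoidPi.
Variables (R : realType) (T T' : topologicalType) (d : T -> T -> R).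
Variables (G : groupoid T) (G' : groupoid T') (p : T -> T').
Hypotheses (hp : is_hom G G' p) (hb : fibre_bijective G G' p).

Lemma multiple_inv g' : multiple_fibre p g' -> multiple_fibre p (ginv G' g').
Proof.
move=> [x [y [xy <- pyx]]]; exists (ginv G x), (ginv G y); split.
- by move/(can_inj (ginvK G)).
- exact: hom_inv.
- by rewrite (hom_inv hp) pyx.
Qed.

Lemma multiple_mul g' h' :
  multiple_fibre p g' -> multiple_fibre p h' -> gcomp G' g' h' ->
  multiple_fibre p (gmul G' g' h').
Proof.
move=> [x [y [xy px py]]] _ gh'.
have lift z : p z = g' -> exists2 h, gcomp G z h & p h = h'.
  move=> pz; have [|_ _ hsurj] := hb (x := gs G z).
    by rewrite -gr_inv; exists (ginv G z).
  have [|h hz ph] := hsurj h'.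
    by rewrite /preimage /= (hom_gs hp) pz; exact/esym/gh'.
  by exists h => //; exact/esym/hz.
have [h xh ph] := lift _ px; have [k yk pk] := lift _ py.
exists (gmul G x h), (gmul G y k); split.
- move=> e; apply: xy.
  have [|_ pinj _] := hb (x := gr G x); first by exists x.
  apply: pinj; rewrite ?inE /preimage /= ?px //.
  by rewrite -(gr_mul yk) -e gr_mul.
- by rewrite (hp xh).2 px ph.
- by rewrite (hp yk).2 py pk.
Qed.

Lemma multiple_preimage_inv g :
  (p @^-1` multiple_fibre p) g -> (p @^-1` multiple_fibre p) (ginv G g).
Proof. by rewrite /preimage /= (hom_inv hp); exact: multiple_inv. Qed.

Lemma multiple_preimage_mul g h :
  (p @^-1` multiple_fibre p) g -> (p @^-1` multiple_fibre p) h -> gcomp G g h ->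
  (p @^-1` multiple_fibre p) (gmul G g h).
Proof.
rewrite /preimage /= => mg mh gh; have [pgh ->] := hp gh.
exact: multiple_mul.
Qed.

(* G_pi and G'_pi *)
Definition tgpi : groupoid (tpi d p) :=
  subgroupoid multiple_preimage_inv multiple_preimage_mul.

Definition bgpi : groupoid (bpi d p) :=
  subgroupoid multiple_inv multiple_mul.

Lemma tpi_val_hom : is_hom tgpi G (@tpi_val R T d T' p).
Proof. exact: subgroupoid_val_hom. Qed.

Lemma bpi_val_hom : is_hom bgpi G' (@bpi_val R T d T' p).
Proof. exact: subgroupoid_val_hom. Qed.

Lemma pi_restr_hom : is_hom tgpi bgpi (@pi_restr R T d T' p).
Proof.
move=> g h gh; have [vgh vE] := tpi_val_hom gh.
have [pgh pE] := hp vgh; split; first exact/sub_comp.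
apply: val_inj; rewrite [RHS]sub_mulE // -pE -vE.
by [].
Qed.

End GroupoidPi.
Arguments tgpi {R T T'} d {G G' p} hp hb.
Arguments bgpi {R T T'} d {G G' p} hp hb.
Arguments tpi_val_hom {R T T'} d {G G' p} hp hb.
Arguments bpi_val_hom {R T T'} d {G G' p} hp hb.
Arguments pi_restr_hom {R T T'} d {G G' p} hp hb.

Section ReductionChainMap.
Variables (R : realType) (T T' : topologicalType) (d : T -> T -> R).
Variables (G : groupoid T) (G' : groupoid T') (p : T -> T').
Hypotheses (hp : is_hom G G' p) (hb : fibre_bijective G G' p).

(* (G^(n))_(pi^(n)) and (G'^(n))_(pi^(n)), for the l1 product metric *)
Definition nerve_tpi n : topologicalType :=
  tpi (nerve_dist d n) (nerve_map hp n).
Definition nerve_bpi n : topologicalType :=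
  bpi (nerve_dist d n) (nerve_map hp n).

(* the canonical identifications (G_pi)^(n) = (G^(n))_(pi^(n)) and
   (G'_pi)^(n) = (G'^(n))_(pi^(n)): the underlying tuples agree *)
Definition is_identification
    (k : forall n, nerve (tgpi d hp hb) n -> nerve_tpi n) : Prop :=
  forall n, homeo (k n) /\
    forall x, tpi_val (k n x) = nerve_map (tpi_val_hom d hp hb) n x.

Definition is_base_identification
    (k : forall n, nerve (bgpi d hp hb) n -> nerve_bpi n) : Prop :=
  forall n, homeo (k n) /\
    forall x, bpi_val (k n x) = nerve_map (bpi_val_hom d hp hb) n x.

Variables (A : zmodType).
Variables (C : groupoid_complex G A) (C' : groupoid_complex G' A).
Variables (D : groupoid_complex (tgpi d hp hb) A).
Variables (D' : groupoid_complex (bgpi d hp hb) A).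
Variables (i : chainMap C' C) (j : chainMap D' D).
Variable k : forall n, nerve (tgpi d hp hb) n -> nerve_tpi n.

(* In degree n, P maps the class of f to Pi_n(f), transported along k. *)
Definition given_by_reduction
    (P : chainMap (quotComplex i) (quotComplex j)) : Prop :=
  forall n (f : Cc (nerve G n) A),
    exists (h : Cc (nerve_tpi n) A) (hk : Cc (nerve (tgpi d hp hb) n) A),
      [/\ is_reduction f (\pi_(Cc_quot (nerve_dist d n) (nerve_map hp n) A) h),
          forall x, hk x = h (k x)
        & P n (quot_proj i n f) = quot_proj j n hk].

End ReductionChainMap.

(* Main.v *)
(* The topology of G'_pi is that of the Hausdorff distance between the fibres:
   a filter converges to y' if and only if every open set W of G that meets the
   fibre over y' meets the nearby fibres. In this form (fcvg) it no longer
   mentions the metric, and it is transported along squares of local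
   homeomorphisms that lift uniquely. Since the faces and the range map of the
   nerve form such squares with pi^(n), the fine topology on nerves is governed
   by the unit spaces; this gives the regularity of pi^(n), the etaleness of
   G_pi and G'_pi, and the identifications of nerves.

   For f in C_c(G^(n)), the fibres on which f is not constant form a compact open
   set of (G'^(n))_pi, by regularity. Hence f has a reduction, and the class of h
   is the reduction of f exactly when h - f is constant on the fibres of G_pi.
   This relation is compatible with the push-forward along the faces, so that it
   defines a chain map between the quotient complexes. It is injective because f
   descends to G' as soon as f is constant on all fibres, and surjective because a
   function on the compact preimage of a compact open set of fibres extends to
   G^(n) by total disconnectedness. The exact sequences are those of the short
   exact sequences of complexes given by the pull-backs. *)

Require Import Defs.
From HB Require Import structures.
From mathcomp Require Import all_boot all_order all_algebra.
From mathcomp Require Import all_classical all_reals all_analysis.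
From mathcomp Require Import lra.

Set Implicit Arguments.
Unset Strict Implicit.
Unset Printing Implicit Defensive.

Import Order.TTheory GRing.Theory Num.Theory.
Local Open Scope classical_set_scope.
Local Open Scope ring_scope.

(** * Topological preliminaries *)

(** The nerves of [G_pi] carry the product topology, whereas [nerve_tpi] carries a metric built from
    Hausdorff distances of fibres in the nerve of [G]. Comparing which filters converge replaces
    metric estimates between the two, and ultrafilters turn compactness and properness into the
    existence of limits. Regularity acts through one mechanism: two points chosen in each fibre,
    with distinct limits in a common fibre, force the fibres to converge finely ([reg_fcvg]). Points
    at which f takes two different values give the compactness of the set of non-constant fibres,
    and for an indicator function this is local compactness of the space of fibres. Truncations do
    not commute with push-forward along faces, as the truncating set would have to move with the
    face. That h - f is constant on fibres mentions no such set, and base change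
    ([face_pushforward]) preserves it. On classes it is additive and single-valued, hence determines
    a homomorphism. *)

Lemma ultra_fmap (T U : Type) (f : T -> U) (F : set_system T) :
  UltraFilter F -> UltraFilter (f @ F).
Proof.
move=> FU; split=> [|G PG FG]; first exact: fmap_proper_filter.
rewrite eqEsubset; split=> // A GA; rewrite /fmap /=.
have [//|FnA] := in_ultra_setVsetC (f @^-1` A) FU.
have /filter_ex [? []] // : G (A `&` ~` A) by apply: filterI => //; exact: FG.
Qed.

Lemma compact_ultraP (T : topologicalType) (A : set T) (F : set_system T) :
  compact A -> UltraFilter F -> F A -> exists2 x, A x & F --> x.
Proof. by rewrite compact_ultra => cA FU /(cA F FU)[x [Ax Fx]]; exists x. Qed.

Lemma ultraP_compact (T : topologicalType) (A : set T) :
  (forall F : set_system T, UltraFilter F -> F A -> exists2 x, A x & F --> x) ->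
  compact A.
Proof. by rewrite compact_ultra => cA F FU /(cA F FU)[x Ax Fx]; exists x. Qed.

Lemma near_fmap (I T : Type) (F : set_system I) {FF : Filter F} (f : I -> T)
    (A : set I) (U : set T) : F A -> (forall i, A i -> U (f i)) -> (f @ F) U.
Proof. by move=> FA AU; exact: (filterS AU FA). Qed.

Lemma cvg_openP (T : topologicalType) (F : set_system T) {FF : Filter F}
    (x : T) :
  (forall U, open U -> U x -> F U) -> F --> x.
Proof.
move=> FU A; rewrite /= nbhsE => -[U [oU Ux] UA].
by apply: filterS UA _; exact: FU.
Qed.

Lemma open_nearP (T : topologicalType) (U : set T) :
  (forall x, U x -> nbhs x U) -> open U.
Proof. by move=> h; rewrite openE => x /h. Qed.

Lemma cvg_valP (X : topologicalType) (A : set X) (I : Type)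
    (F : set_system I) {FF : Filter F} (f : I -> A) (x : A) :
  f @ F --> x <-> (fun i => val (f i)) @ F --> val x.
Proof.
split=> [fx|fx].
  by apply: cvg_comp fx _; exact: initial_continuous.
apply: cvg_openP => U [V oV <-] Vx; apply: fx; exact: open_nbhs_nbhs.
Qed.

Lemma val_continuous (X : topologicalType) (A : set X) :
  continuous (val : A -> X).
Proof. exact: initial_continuous. Qed.

Lemma cvg_projP (X : topologicalType) (J : Type) (I : Type) (F : set_system I)
    {FF : Filter F} (f : I -> prod_topology (fun _ : J => X))
    (g : prod_topology (fun _ : J => X)) :
  f @ F --> g <-> forall j, (fun i => f i j) @ F --> g j.
Proof.
split=> h.
  move=> j U; rewrite /= nbhsE => -[V [oV Vg] VU]; move/cvg_sup/(_ j) : h => h.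
  apply: (h ((fun k => k j) @^-1` U)); exists ((fun k => k j) @^-1` V).
  by split=> //; [exists V|move=> ? /VU].
apply/cvg_sup => j U; rewrite nbhsE => -[V [[W oW <-] Wg] VU].
apply: (@filterS _ (f @ F) _ _ _ VU); apply: (h j); exact: open_nbhs_nbhs.
Qed.

Lemma cvg_pairP (X Y : topologicalType) (I : Type) (F : set_system I)
    {FF : Filter F} (f : I -> X) (g : I -> Y) (x : X) (y : Y) :
  f @ F --> x -> g @ F --> y -> (fun i => (f i, g i)) @ F --> (x, y).
Proof. by move=> fx gy; exact: cvg_pair. Qed.

Lemma cvg_unique2 (T : topologicalType) (I : Type) (F : set_system I)
    {FF : ProperFilter F} (f : I -> T) (x y : T) : hausdorff_space T ->
  f @ F --> x -> f @ F --> y -> x = y.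
Proof.
move=> hT fx fy; apply: (cvg_unique hT fx fy).
Qed.

Lemma hausdorff_sep (T : topologicalType) (x y : T) :
  hausdorff_space T -> x <> y ->
  exists U V, [/\ open U, open V, U x, V y & U `&` V = set0].
Proof.
rewrite open_hausdorff => hT /eqP /hT [[U V] /= [xU yV] [oU oV /eqP UV]].
by exists U, V; split=> //; exact: set_mem.
Qed.

(** Otherwise every point of [A] has a neighbourhood whose complement lies in [G]; compactness
    yields one [W] in [G] that misses a neighbourhood of all of [A], so that [G] contains both [W]
    and its complement. *)
Lemma ultra_set_nbhs (T : topologicalType) (A : set T) (G : set_system T) :
  compact A -> UltraFilter G -> set_nbhs A `<=` G -> exists2 a, A a & G --> a.
Proof.
move=> /compact_near_coveringP cA UG AG; apply: contrapT => nA.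
have nU a : A a -> \forall x \near a & W \near powerset_filter_from G,
    nbhs x (~` W).
  move=> Aa; apply: contrapT => nU; apply: nA; exists a => //.
  apply: cvg_openP => U oU Ua; have [//|GU] := in_ultra_setVsetC U UG.
  case: nU; exists (U, [set W | W `<=` ~` U]).
    split; first exact: open_nbhs_nbhs.
    apply/near_powerset_filter_fromP; first by move=> ? ?; exact: subset_trans.
    by exists (~` U).
  move=> [x W] [/= Ux WU]; apply: (@filterS _ _ _ U); last exact: open_nbhs_nbhs.
  by move=> z Uz /WU.
have [R [RG _ [W RW]] AW] := cA _ _ _ _ nU.
have /filter_ex [z []] // : G (W `&` ~` W).
by apply: filterI; [exact: RG|apply: AG => x /(AW _ RW)].
Qed.

(** If all neighbourhoods of [A] meet all neighbourhoods of [B], the intersections generate a proper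
    filter; a finer ultrafilter converges to a point of [A] and to a point of [B], which
    coincide. *)
Lemma compact_separation (T : topologicalType) (A B : set T) :
  hausdorff_space T -> compact A -> compact B -> A `&` B = set0 ->
  exists U V, [/\ open U, open V, A `<=` U, B `<=` V & U `&` V = set0].
Proof.
move=> hT cA cB AB; apply: contrapT => nUV.
pose F := filter_from (set_nbhs A `*` set_nbhs B) (fun UV => UV.1 `&` UV.2).
have PF : ProperFilter F.
  apply: filter_from_proper; last first.
    move=> [U V] [/= /set_nbhsP[U' [oU AU UU]] /set_nbhsP[V' [oV BV VV]]].
    apply: contrapT => /set0P/negP/negPn/eqP UV0.
    apply: nUV; exists U', V'; split=> //; apply/seteqP; split=> // z [/UU Uz /VV Vz].
    by rewrite -UV0.
  apply: filter_from_filter; first by exists (setT, setT); split; exact: filterT.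
  move=> [U V] [U' V'] [/= ? ?] [/= ? ?]; exists (U `&` U', V `&` V').
    by split=> z ?; apply: filterI; auto.
  by move=> z [/= [? ?] [? ?]].
have [G [UG FG]] := ultraFilterLemma PF.
have [|a Aa Ga] := ultra_set_nbhs cA UG.
  by move=> U AU; apply: FG; exists (U, setT); [split=> //; exact: filterT|move=> ? []].
have [|b Bb Gb] := ultra_set_nbhs cB UG.
  by move=> U AU; apply: FG; exists (setT, U); [split=> //; exact: filterT|move=> ? []].
have ab : a = b by apply: (cvg_unique hT Ga Gb).
by have : set0 a by rewrite -AB; split=> //; rewrite ab.
Qed.

(** A base of compact open sets: the form in which total disconnectedness is used from here on. *)
Definition zdim (T : topologicalType) := forall (x : T) U, nbhs x U ->
  exists V, [/\ open V, compact V, V x & V `<=` U].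

Lemma locally_compactE (T : topologicalType) :
  locally_compact [set: T] ->
  forall x : T, exists2 C, nbhs x C & compact C /\ closed C.
Proof. by move=> + x => /(_ x Logic.I) [C xC cC]; exists C => //; apply: (@filterS _ (nbhs x) _ _ _ _ xC) => y; exact. Qed.

Lemma zdim_locally_compact (T : topologicalType) :
  hausdorff_space T -> (forall x : T, exists2 C, nbhs x C & compact C) ->
  locally_compact [set: T].
Proof.
move=> hT cT x _; have [C xC cC] := cT x.
by exists C; [exact: filterS xC|split=> //; exact: compact_closed].
Qed.

(* In a compact Hausdorff space components and quasi-components coincide. *)
Lemma totally_disconnected_zdim (T : topologicalType) :
  hausdorff_space T -> locally_compact [set: T] ->
  totally_disconnected [set: T] -> zdim T.
Proof.
move=> hT lT tT x U0 xU0; have [C xC [cC clC]] := locally_compactE lT x.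
(* [S] collects the relatively clopen subsets of [C] around [x], so that [Q] is the quasi-component
   of [x] in [C]. *)
pose S := [set D : set T | [/\ D x, closed D, D `<=` C &
  exists2 N, open N & D = N `&` C]].
have SI D E : S D -> S E -> S (D `&` E).
  move=> [Dx clD DC [N oN DE]] [? ? ? [M oM EE]]; split=> //.
  - exact: closedI.
  - by move=> z [/DC].
  - rewrite DE EE; by exists (N `&` M); [exact: openI|rewrite setIACA setIid].
have SC : S C.
  split=> //; first exact: nbhs_singleton.
  by exists setT; [exact: openT|rewrite setTI].
pose Q := \bigcap_(D in S) D.
have Qx : Q x by move=> D [].
have clQ : closed Q by apply: closed_bigI => D [].
have QC : Q `<=` C by move=> z /(_ C SC).
(* Otherwise the sets D minus U, for D in [S], generate a filter in the compact [C]. A cluster point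
   lies in [Q], hence in the open [U], which misses all these sets. *)
have QU U : open U -> Q `<=` U -> exists2 D, S D & D `<=` U.
  move=> oU QU; apply: contrapT => nD.
  pose F := filter_from S (fun D => D `\` U).
  have PF : ProperFilter F.
    apply: filter_from_proper; last first.
      move=> D SD; apply: contrapT => D0; apply: nD; exists D => // z Dz.
      by apply: contrapT => nUz; apply: D0; exists z.
    apply: filter_from_filter; first by exists C.
    by move=> D E SD SE; exists (D `&` E); [exact: SI|move=> z [[]]].
  have [|p [Cp clp]] := cC F PF; first by exists C => // z [].
  suff Qp : Q p.
    have [] := clp (C `\` U) U; first by exists C.
      by apply: open_nbhs_nbhs; split=> //; exact: QU.
    by move=> z [[]].
  move=> D SD; have [_ clD _ _] := SD; apply: clD => V pV.
  have [|z [[Dz _] Vz]] := clp (D `\` U) V _ pV; first by exists D.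
  by exists z.
(* A separation of [Q] thickens to disjoint open [V] and [W]. Some [D] in [S] lies in their union,
   and the half of [D] containing [x] is again in [S]; hence [Q] lies in that half and the other
   piece is empty. *)
have Qconn : connected Q.
  apply/connectedP => E [E0 QE [sep1 sep2]].
  have clE b : closed (E b).
    move=> z zE; have Qz : Q z.
      apply: clQ; apply: closureS zE; rewrite QE; case: b => ? ?; by [right|left].
    move: Qz; rewrite QE; case: b zE => zE [] // Ez.
    - by have : set0 z by rewrite -sep2; split.
    - by have : set0 z by rewrite -sep1; split.
  have cE b : compact (E b).
    apply: subclosed_compact cC _ => //.
    by apply: subset_trans QC; rewrite QE; case: b => ? ?; by [right|left].
  have E00 : E false `&` E true = set0.
    by apply/seteqP; split=> // z [Ef Et]; rewrite -sep2; split=> //; exact: subset_closure.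
  have [V [W [oV oW EV EW VW]]] := compact_separation hT (cE false) (cE true) E00.
  have [||D SD DVW] := QU (V `|` W); first exact: openU.
    by rewrite QE => z [/EV|/EW]; [left|right].
  have [Dx clD DC [N oN DN]] := SD.
  have half V' W' : open V' -> open W' -> V' `&` W' = set0 -> D `<=` V' `|` W' ->
      V' x -> Q `<=` V'.
    move=> oV' oW' VW' DVW' V'x z Qz; suff : S (D `&` V') by move=> /(Qz _) [].
    split=> //; last by exists (N `&` V'); [exact: openI|rewrite DN setIAC].
    - rewrite (_ : D `&` V' = D `&` ~` W').
        by apply: closedI => //; exact: open_closedC.
      apply/seteqP; split=> t [Dt Vt]; split=> //.
        by move=> Wt; have : set0 t by rewrite -VW'.
      by case: (DVW' t Dt).
    - by move=> t [/DC].
  have [Vx|Wx] := DVW _ Dx.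
    have [t Et] := E0 true.
    suff : set0 t by []. rewrite -VW; split; last exact: EW.
    by apply: (half V W) => //; rewrite QE; right.
  have [t Et] := E0 false.
  suff : set0 t by []. rewrite -VW; split; first exact: EV.
  apply: (half W V) => //; first by rewrite setIC.
    by move=> u /DVW; rewrite setUC.
  by rewrite QE; left.
have Qset1 : Q `<=` [set x].
  rewrite -(tT x) // => z Qz; by exists Q.
have [||D SD DU] := QU (C° `&` U0°).
- by apply: openI; exact: open_interior.
- by move=> z /Qset1 ->; split.
have [Dx clD DC [N oN DN]] := SD.
(* [D] lies in the interior of [C], so being relatively open in [C] makes it open in [T]. *)
have {}DN : D = N `&` C°.
  apply/seteqP; split=> z; last by move=> [Nz /interior_subset Cz]; rewrite DN.
  by move=> Dz; split; [move: Dz; rewrite DN => -[]|have [] := DU _ Dz].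
exists D; split=> //.
- by rewrite DN; apply: openI => //; exact: open_interior.
- exact: subclosed_compact cC DC.
- by move=> z /DU[_ /interior_subset].
Qed.

(** * Regular maps and the fine topology *)

(** Properness in terms of ultrafilters; for continuous [q] and Hausdorff [Y'] the limit lies over
    [y']. *)
Definition uproper (Y Y' : topologicalType) (q : Y -> Y') :=
  forall (F : set_system Y) (y' : Y'), UltraFilter F -> q @ F --> y' ->
  exists y : Y, F --> y.

Lemma proper_uproper (Y Y' : topologicalType) (q : Y -> Y') :
  locally_compact [set: Y'] -> proper_map q -> uproper q.
Proof.
move=> lY' pq F y' UF qF; have [C y'C [cC _]] := locally_compactE lY' y'.
by have [||y _ Fy] := @compact_ultraP _ (q @^-1` C) F; [exact: pq|exact: qF|exists y].
Qed.

Lemma uproper_proper (Y Y' : topologicalType) (q : Y -> Y') :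
  hausdorff_space Y' -> continuous q -> uproper q -> proper_map q.
Proof.
move=> hY' cq uq K cK; apply: ultraP_compact => F UF FK.
have Uq := ultra_fmap q UF.
have [y' Ky' qF] := compact_ultraP cK Uq FK.
have [y Fy] := uq F y' UF qF; exists y => //.
rewrite /preimage /= (_ : q y = y') //.
by apply: (cvg_unique hY' _ qF); apply: cvg_comp Fy (cq y).
Qed.

(** Proper maps are closed. Otherwise points outside [U] can be chosen in fibres tending to [y'];
    along an ultrafilter they converge to a point of the fibre over [y'], hence enter [U]. *)
Lemma uproper_closed (Y Y' : topologicalType) (q : Y -> Y') (y' : Y') U :
  hausdorff_space Y' -> continuous q -> uproper q ->
  open U -> q @^-1` [set y'] `<=` U ->
  \forall z' \near y', q @^-1` [set z'] `<=` U.
Proof.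
move=> hY' cq uq oU fU; apply: contrapT => nU.
pose B := [set z' | ~ (q @^-1` [set z'] `<=` U)].
have PB : ProperFilter (within B (nbhs y')).
  apply: Build_ProperFilter; rewrite /within /= => B0; apply: nU.
  by apply: filterS B0 => z' nB; apply: contrapT.
have [G [UG BG]] := ultraFilterLemma PB.
have GB : G B by apply: BG; rewrite /within /=; exact: nearW.
have [z0 Bz0] := filter_ex GB.
(* Any point serves as the value of [a] outside [B]. *)
have [y0 _] : exists y0, ~ (q y0 = z0 -> U y0) by exact/existsNP.
have [a aP] : {a : Y' -> Y & forall z, B z -> q (a z) = z /\ ~ U (a z)}.
  apply: (@choice _ _ (fun z y => B z -> q y = z /\ ~ U y)) => z.
  have [Bz|] := pselect (B z); last by exists y0.
  have /existsNP [y /not_implyP [qy nUy]] := Bz; by exists y.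
have UaG := ultra_fmap a UG.
have qaG : q @ (a @ G) --> y'.
  move=> N y'N; have GN : G N by apply: BG; apply: filterS y'N.
  apply: (near_fmap (F := a @ G) (A := q @^-1` N)) => //.
  by apply: (near_fmap (filterI GN GB)) => z [Nz /aP[qaz _]]; rewrite /preimage /= qaz.
have [y aGy] := uq _ _ UaG qaG.
have qy : q y = y'.
  by apply: (cvg_unique hY' _ qaG); apply: cvg_comp aGy (cq y).
have aGU : (a @ G) U by apply: aGy; apply: open_nbhs_nbhs; split=> //; exact: fU.
have GU : G (a @^-1` U) := aGU.
have PG : ProperFilter G by exact: ultra_proper.
by have [z [/aP[_ nU']]] := filter_ex (filterI GB GU).
Qed.

(* [F] converges to [y'] in the topology generated by the images of open sets,
   which is that of the Hausdorff distance between the fibres. *)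
Definition fcvg (Y : topologicalType) (Y' : Type) (q : Y -> Y')
    (F : set_system Y') (y' : Y') :=
  forall W, open W -> (q @` W) y' -> F (q @` W).

Lemma fcvg_cvg (Y Y' : topologicalType) (q : Y -> Y') (F : set_system Y')
    {FF : Filter F} (y' : Y') :
  continuous q -> set_surj [set: Y] [set: Y'] q ->
  fcvg q F y' -> F --> y'.
Proof.
move=> cq sq fF; apply: cvg_openP => U oU Uy'.
have [y _ qy] := sq y' Logic.I.
apply: (@filterS _ F _ (q @` (q @^-1` U))); first by move=> _ [z Uz <-].
apply: fF; last by exists y => //; rewrite /preimage /= qy.
by apply: open_comp => // z _; exact: cq.
Qed.

(* Regularity without metrics: a fibre that meets small neighbourhoods of two
   distinct points of a given fibre has large diameter, so it must be close to
   that fibre in the Hausdorff distance. *)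
Definition reg_map (Y : topologicalType) (Y' : Type) (q : Y -> Y') :=
  forall a b, a <> b -> q a = q b -> forall W, open W -> (q @` W) (q a) ->
  \forall z \near (a, b), q z.1 = q z.2 -> (q @` W) (q z.1).

(** The form in which regularity is used: to obtain fine convergence of fibres it is enough to
    follow two points in each of them whose limits are distinct points of one fibre. *)
Lemma reg_fcvg (Y : topologicalType) (Y' I : Type) (q : Y -> Y')
    (F : set_system I) {FF : Filter F} (a b : I -> Y) (a0 b0 : Y) : reg_map q ->
  a @ F --> a0 -> b @ F --> b0 -> a0 <> b0 -> q a0 = q b0 ->
  (\forall i \near F, q (a i) = q (b i)) -> fcvg q ((q \o a) @ F) (q a0).
Proof.
move=> rq aF bF ab qab qF W oW Wa; have := rq _ _ ab qab W oW Wa.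
move=> /(cvg_pairP aF bF) W2.
by apply: (near_fmap (@filterI _ F _ _ _ W2 qF)) => i [Wi qi]; exact: Wi.
Qed.

(** A pseudometric inducing the given topology. [mdist] and the l1 sums on nerves are both
    instances, so that the results below apply in every degree. *)
Record compat_dist (R : realType) (Y : topologicalType) (d : Y -> Y -> R) := {
  cd_ge0 : forall x y, 0 <= d x y;
  cd_xx : forall x, d x x = 0;
  cd_sym : forall x y, d x y = d y x;
  cd_tri : forall x y z, d x z <= d x y + d y z;
  cd_nbhs : forall x U, nbhs x U <-> exists2 e, 0 < e & [set y | d x y < e] `<=` U
}.

Section Dist.
Variables (R : realType) (Y : topologicalType) (d : Y -> Y -> R).
Hypothesis cd : compat_dist d.

Lemma near_dist x e : 0 < e -> \forall y \near x, d x y < e.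
Proof. by move=> e0; apply/(cd_nbhs cd); exists e. Qed.

Lemma dist_ball_open (x : Y) e : open [set y | d x y < e].
Proof.
apply: open_nearP => y /= xy; apply/(cd_nbhs cd); exists (e - d x y).
  by rewrite subr_gt0.
by move=> z /=; rewrite ltrBrDl; apply: le_lt_trans; exact: (cd_tri cd).
Qed.

Lemma compact_dist_bounded (K : set Y) x0 : compact K ->
  exists M, forall x, K x -> d x0 x <= M.
Proof.
move=> /compact_near_coveringP cK.
suff /filter_ex[M KM] : \forall M \near +oo, K `<=` (fun x => d x0 x <= M).
  by exists M.
apply: (cK R _ (fun M x => d x0 x <= M)) => x Kx.
exists ([set y | d x y < 1], [set M | d x0 x + 1 <= M]).
  split; first exact: near_dist.
  by apply: nbhs_pinfty_ge; exact: num_real.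
move=> [y M] [/= xy]; apply: le_trans.
by rewrite (le_trans (cd_tri cd _ x _)) // lerD2l ltW.
Qed.

Lemma compact2_dist_bounded (K L : set Y) : compact K -> compact L ->
  exists M, forall x y, K x -> L y -> d x y <= M.
Proof.
move=> cK cL; have [[x0 Kx0]|K0] := pselect (K !=set0); last first.
  by exists 0 => x y Kx; case: K0; exists x.
have [M KM] := compact_dist_bounded x0 cK.
have [N LN] := compact_dist_bounded x0 cL.
exists (M + N) => x y Kx Ly; rewrite (le_trans (cd_tri cd _ x0 _)) //.
by rewrite lerD ?KM ?LN // (cd_sym cd) KM.
Qed.

Lemma diam_lt (K : set Y) e x y : compact K -> diam d K < e -> K x -> K y ->
  d x y < e.
Proof.
move=> cK Ke Kx Ky; apply: le_lt_trans Ke; apply: ub_le_sup; last by exists (x, y).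
have [M KM] := compact2_dist_bounded cK cK.
by exists M => _ [[u v] [/= Ku Kv] <-]; exact: KM.
Qed.

Let has_lb (T : Type) (f : T -> R) (A : set T) :
  (forall t, 0 <= f t) -> has_lbound [set f t | t in A].
Proof. by move=> f0; exists 0 => _ [t _ <-]. Qed.

Let sup_ge0 (A : set R) : (forall x, A x -> 0 <= x) -> 0 <= sup A.
Proof.
move=> A0; have [[[x Ax] ubA]|nA] := pselect (has_sup A); last by rewrite sup_out.
by apply: le_trans (A0 _ Ax) _; exact: ub_le_sup.
Qed.

Let inf_ge0 (A : set R) : (forall x, A x -> 0 <= x) -> 0 <= inf A.
Proof.
move=> A0; have [[neA lbA]|nA] := pselect (has_inf A); last by rewrite inf_out.
exact: lb_le_inf.
Qed.

(** Valid for arbitrary sets: where a supremum or infimum does not exist, its default value 0 is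
    non-negative as well. *)
Lemma hausdorff_dist_ge0 K L : 0 <= hausdorff_dist d K L.
Proof.
rewrite /hausdorff_dist le_max; apply/orP; left.
apply: sup_ge0 => _ [x _ <-]; apply: inf_ge0 => _ [y _ <-]; exact: (cd_ge0 cd).
Qed.

(** Compactness bounds the distances, so that the supremum is a true one, and the point [l] of [L]
    makes the infimum a true one. *)
Lemma hausdorff_dist_lt (K L : set Y) e : compact K -> compact L ->
  L !=set0 -> hausdorff_dist d K L < e ->
  forall x, K x -> exists2 y, L y & d x y < e.
Proof.
move=> cK cL [l Ll] + x Kx; rewrite /hausdorff_dist gt_max => /andP[KLe _].
have xe : inf [set d x y | y in L] < e.
  apply: le_lt_trans KLe; apply: ub_le_sup; last by exists x.
  have [M KM] := compact2_dist_bounded cK cL.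
  exists M => _ [z Kz <-]; apply: le_trans (KM z l Kz Ll).
  apply: ge_inf; last by exists l.
  by apply: has_lb => t; exact: (cd_ge0 cd).
have [|_ [y Ly <-] ye] := inf_lt _ xe; last by exists y.
by exists (d x l), l.
Qed.

Lemma hausdorff_dist_le (K L : set Y) e : K !=set0 -> L !=set0 ->
  (forall x, K x -> exists2 y, L y & d x y <= e) ->
  (forall y, L y -> exists2 x, K x & d x y <= e) ->
  hausdorff_dist d K L <= e.
Proof.
move=> [k Kk] [l Ll] KL LK; rewrite /hausdorff_dist ge_max; apply/andP; split.
  apply: ge_sup; first by exists (inf [set d k y | y in L]), k.
  move=> _ [x Kx <-]; have [y Ly xy] := KL _ Kx; apply: le_trans xy.
  apply: ge_inf; last by exists y.
  by apply: has_lb => t; exact: (cd_ge0 cd).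
apply: ge_sup; first by exists (inf [set d x l | x in K]), l.
move=> _ [y Ly <-]; have [x Kx xy] := LK _ Ly; apply: le_trans xy.
apply: ge_inf; last by exists x.
by apply: (@has_lb _ (d^~ y)) => t; exact: (cd_ge0 cd).
Qed.

End Dist.

Section FinePi.
Variables (R : realType) (Y Y' : topologicalType) (d : Y -> Y -> R).
Variable q : Y -> Y'.
Hypotheses (cd : compat_dist d) (hY' : hausdorff_space Y').
Hypotheses (cq : continuous q) (sq : set_surj [set: Y] [set: Y'] q).
Hypothesis uq : uproper q.

Local Notation fib y' := (q @^-1` [set y']).

Lemma fibre_compact y' : compact (fib y').
Proof.
apply: ultraP_compact => F UF Ffib.
have qF : q @ F --> y'.
  by move=> N y'N; apply: filterS Ffib => y /= ->; exact: nbhs_singleton.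
have [y Fy] := uq UF qF; exists y => //; rewrite /preimage /=.
apply: (cvg_unique2 hY' _ qF); exact: (cvg_comp _ _ Fy (@cq y)).
Qed.

Lemma fibre_nonempty y' : fib y' !=set0.
Proof. by have [y _ <-] := @sq y' Logic.I; exists y. Qed.

Lemma regular_reg : (forall a b, a <> b -> 0 < d a b) -> regular_map d q ->
  reg_map q.
Proof.
move=> d0 rq a b ab qab W oW [w Ww qw].
have /(cd_nbhs cd)[r r0 rW] : nbhs w W by exact: open_nbhs_nbhs.
(* Points within [D] of [a] and of [b] are at distance at least [D] apart. The threshold
   [Num.min r D] thus excludes the second alternative of regularity and, in the first, puts a point
   of the fibre in the ball of radius [r] around [w]. *)
pose D := d a b / 3%:R.
have D0 : 0 < D by rewrite divr_gt0 ?d0.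
have [|U' [oU' Ua HU']] := rq (q a) (Num.min r D); first by rewrite lt_min r0.
exists ([set y | d a y < D] `&` q @^-1` U', [set y | d b y < D]).
  split=> /=; last exact: near_dist.
  apply: filterI; first exact: near_dist.
  by apply: cq; exact: open_nbhs_nbhs.
move=> [y z] /= [[ay Uy] bz] qyz; have [hlt|dlt] := HU' _ Uy.
  have [|||v qv wv] := hausdorff_dist_lt cd _ _ _ hlt (x := w) qw.
  - exact: fibre_compact.
  - exact: fibre_compact.
  - exact: fibre_nonempty.
  by exists v => //; apply: rW => /=; apply: lt_le_trans wv _; rewrite ge_min lexx.
have yz : d y z < Num.min r D by apply: (diam_lt cd _ dlt) => //; exact: fibre_compact.
have {}yz : d y z < D by apply: lt_le_trans yz _; rewrite ge_min lexx orbT.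
have : d a b < d a b.
  apply: le_lt_trans (cd_tri cd _ y _) _; rewrite [ltRHS](_ : _ = D + (D + D)).
    rewrite ltrD //; apply: le_lt_trans (cd_tri cd _ z _) _.
    by rewrite ltrD // (cd_sym cd).
  by rewrite /D; lra.
by rewrite ltxx.
Qed.

(** The two halves of the Hausdorff distance have different sources. The fibre over [y'] is compact,
    hence controlled by finitely many small balls that the nearby fibres meet; the nearby fibres lie
    in a thickening of it because [q] is closed. *)
Lemma near_bpi_dist (I : Type) (G : set_system I) (f : I -> bpi d q)
    {FG : Filter G} (y' : bpi d q) :
  fcvg q ((fun i => bpi_val (f i)) @ G) (bpi_val y') ->
  forall e, 0 < e -> \forall i \near G, @bpi_dist R Y d Y' q y' (f i) < e.
Proof.
(* [hausdorff_dist_le] yields a weak inequality only, whence a radius smaller than [e]. *)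
move=> fG e e0; pose r := e / 2.
have r0 : 0 < r by rewrite divr_gt0.
have r2 : 0 < r / 2 by rewrite divr_gt0.
have near1 : \forall i \near G, fib (bpi_val y') `<=`
    (fun x => exists2 y, q y = bpi_val (f i) & d x y <= r).
  have /compact_near_coveringP := @fibre_compact (bpi_val y').
  apply => x qx; exists ([set z | d x z < r / 2],
      [set i | exists2 y, d x y < r / 2 & q y = bpi_val (f i)]).
    split; first exact: near_dist.
    apply: (fG [set z | d x z < r / 2]); first exact: dist_ball_open.
    by exists x => //=; rewrite (cd_xx cd).
  move=> [z i] [/= xz [y xy qy]]; exists y => //.
  apply: le_trans (cd_tri cd _ x _) _; rewrite (cd_sym cd) [r]splitr.
  by rewrite lerD // ltW.
pose U := [set y | exists2 x, q x = bpi_val y' & d x y < r].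
have oU : open U.
  rewrite (_ : U = \bigcup_(x in fib (bpi_val y')) [set y | d x y < r]).
    by apply: bigcup_open => x _; exact: dist_ball_open.
  by apply/seteqP; split=> y [x ? ?]; exists x.
have near2 : \forall i \near G, fib (bpi_val (f i)) `<=` U.
  have fU : fib (bpi_val y') `<=` U by move=> x qx; exists x => //; rewrite (cd_xx cd).
  have := uproper_closed hY' cq uq oU fU.
  exact: (fcvg_cvg cq sq fG).
apply: (@filterS _ G _ _ _ _ (@filterI _ G _ _ _ near1 near2)) => i [n1 n2].
apply: (@le_lt_trans _ _ r); last by rewrite ltr_pdivrMr // ltr_pMr // ltr1n.
apply: (hausdorff_dist_le cd); [exact: fibre_nonempty|exact: fibre_nonempty| |].
- move=> x qx; have [y qy xy] := n1 x qx; by exists y.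
- move=> y qy; have [x qx xy] := n2 y qy; by exists x => //; exact: ltW.
Qed.

Lemma bpi_openW W : open W -> open [set y' : bpi d q | (q @` W) (bpi_val y')].
Proof.
move=> oW; change (dist_open (@bpi_dist R Y d Y' q) [set y' | (q @` W) (val y')]).
move=> y' [w Ww qw].
have /(cd_nbhs cd)[r r0 rW] : nbhs w W by exact: open_nbhs_nbhs.
exists r => // z' /= yz.
have [|||v qv wv] := hausdorff_dist_lt cd _ _ _ yz (x := w) qw.
- exact: fibre_compact.
- exact: fibre_compact.
- exact: fibre_nonempty.
by exists v => //; exact: rW.
Qed.

Lemma bpi_cvgP (I : Type) (G : set_system I) (f : I -> bpi d q)
    {FG : Filter G} (y' : bpi d q) :
  f @ G --> y' <-> fcvg q ((fun i => bpi_val (f i)) @ G) (bpi_val y').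
Proof.
split=> [fG W oW Wy'|fG].
  by apply: (fG [set y' | (q @` W) (bpi_val y')]); apply: open_nbhs_nbhs; split=> //; exact: bpi_openW.
apply: cvg_openP => U oU Uy'; have [e e0 eU] := oU _ Uy'.
by apply: (near_fmap (near_bpi_dist fG e0)) => i /eU.
Qed.

Lemma pi_restr_continuous : continuous (@pi_restr R Y d Y' q).
Proof.
apply/continuousP => U oU.
change (dist_open (@tpi_dist R Y d Y' q) (@pi_restr R Y d Y' q @^-1` U)).
move=> z Uz; have [r r0 rU] := oU _ Uz; exists r => //.
move=> y /= zy; apply: rU => /=; apply: le_lt_trans zy.
by rewrite /tpi_dist lerDr (cd_ge0 cd).
Qed.

Lemma tpi_val_continuous : continuous (@tpi_val R Y d Y' q).
Proof.
apply/continuousP => U oU.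
change (dist_open (@tpi_dist R Y d Y' q) (@tpi_val R Y d Y' q @^-1` U)).
move=> z Uz; have [r r0 rU] : exists2 r, 0 < r & [set y | d (val z) y < r] `<=` U.
  apply/(cd_nbhs cd).
    by apply: open_nbhs_nbhs; split.
exists r => // y /= zy; apply: rU => /=; apply: le_lt_trans zy.
by rewrite /tpi_dist lerDl hausdorff_dist_ge0.
Qed.

Lemma tpi_cvgP (I : Type) (G : set_system I) (f : I -> tpi d q)
    {FG : Filter G} (x : tpi d q) :
  f @ G --> x <-> (fun i => tpi_val (f i)) @ G --> tpi_val x /\
    fcvg q ((fun i => q (tpi_val (f i))) @ G) (q (tpi_val x)).
Proof.
split=> [fG|[vG fG]].
  split; first exact: (cvg_comp _ _ fG (@tpi_val_continuous x)).
  apply/(bpi_cvgP (fun i => pi_restr (f i)) (pi_restr x)).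
  exact: (cvg_comp _ _ fG (@pi_restr_continuous x)).
apply: cvg_openP => U oU Ux; have [e e0 eU] := oU _ Ux.
have e2 : 0 < e / 2 by rewrite divr_gt0.
have near1 := @near_bpi_dist _ G (fun i => pi_restr (f i)) FG (pi_restr x) fG _ e2.
have near2 := vG _ (near_dist cd (tpi_val x) e2).
apply: (near_fmap (@filterI _ G _ _ _ near2 near1)) => i [h1 h2]; apply: eU => /=.
by rewrite /tpi_dist (splitr e) ltrD.
Qed.

Lemma pi_restr_surj : set_surj [set: tpi d q] [set: bpi d q] (@pi_restr R Y d Y' q).
Proof.
move=> y' _; have /set_mem [x [y [xy qx qy]]] := valP y'.
have mx : x \in q @^-1` multiple_fibre q.
  by apply: mem_set; rewrite /preimage /= qx; exists x, y.
exists (exist _ x mx) => //; exact: val_inj.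
Qed.

Lemma bpi_val_continuous : continuous (@bpi_val R Y d Y' q).
Proof.
apply/continuousP => U oU; rewrite (_ : _ @^-1` U =
    [set y' | (q @` (q @^-1` U)) (bpi_val y')]).
  by apply: bpi_openW; move/continuousP: cq; exact.
apply/seteqP; split=> y' /=; last by move=> [y Uy <-].
by move=> Uy'; have [y _ qy] := @sq (bpi_val y') Logic.I; exists y => //; rewrite /preimage /= qy.
Qed.

Lemma bpi_hausdorff : hausdorff_space (bpi d q).
Proof.
move=> x y clxy; apply: val_inj; apply: hY' => U V xU yV.
have [z [Uz Vz]] := clxy _ _ (bpi_val_continuous xU) (bpi_val_continuous yV).
by exists (bpi_val z).
Qed.

Lemma tpi_hausdorff : hausdorff_space Y -> hausdorff_space (tpi d q).
Proof.
move=> hY x y clxy; apply: val_inj; apply: hY => U V xU yV.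
have [z [Uz Vz]] := clxy _ _ (tpi_val_continuous xU) (tpi_val_continuous yV).
by exists (tpi_val z).
Qed.

(** Fine convergence depends only on the images in [Y'], so that an ultrafilter limit in [Y] is
    already a limit in [tpi d q]. *)
Lemma pi_restr_uproper : uproper (@pi_restr R Y d Y' q).
Proof.
move=> F y' UF /(bpi_cvgP (@pi_restr R Y d Y' q)) fF.
have PF : ProperFilter F by exact: ultra_proper.
have qF : q @ (@tpi_val R Y d Y' q @ F) --> bpi_val y' by exact: fcvg_cvg cq sq fF.
have [x vF] := uq (ultra_fmap (@tpi_val R Y d Y' q) UF) qF.
have qx : q x = bpi_val y'.
  by apply: (cvg_unique2 hY' _ qF); exact: (cvg_comp _ _ vF (@cq x)).
have mx : x \in q @^-1` multiple_fibre q.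
  by apply: mem_set; rewrite /preimage /= qx; exact: set_mem (valP y').
exists (exist _ x mx); apply/(@tpi_cvgP _ F id _ (exist _ x mx)); split=> //.
by rewrite /tpi_val /= qx.
Qed.

End FinePi.

(** * Local homeomorphisms *)

Section LocalHomeo.
Variables (X Y : topologicalType) (f : X -> Y).

Lemma local_homeoI : continuous f -> (forall W, open W -> open (f @` W)) ->
  (forall x, exists U, [/\ open U, U x & set_inj U f]) -> local_homeo f.
Proof.
move=> cf of_ injf x; have [U [oU Ux iU]] := injf x; exists U; split=> //.
  exact: continuous_subspaceT.
by move=> V oV _; exact: of_.
Qed.

Hypothesis lf : local_homeo f.

Lemma local_homeo_continuous : continuous f.
Proof.
move=> x; have [U [oU Ux _ cU _]] := lf x.
have := cU x; rewrite /continuous_at /nbhs /= -nbhs_subspace_in //.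
by rewrite within_interior; [exact|exact: open_nbhs_nbhs].
Qed.

Lemma local_homeo_open W : open W -> open (f @` W).
Proof.
move=> oW; apply: open_nearP => _ [x Wx <-].
have [U [oU Ux _ _ oV]] := lf x.
have := oV (W `&` U) (openI oW oU) (@subIsetr _ _ _).
move=> oWU; apply: (@filterS _ (nbhs (f x)) _ (f @` (W `&` U))).
  by move=> _ [z [Wz _] <-]; exists z.
by apply: open_nbhs_nbhs; split=> //; exists x.
Qed.

Lemma local_homeo_inj x : exists U, [/\ open U, U x & set_inj U f].
Proof. by have [U [oU Ux iU _ _]] := lf x; exists U. Qed.

(** A local inverse as a total function. Only its convergence at [f x] is recorded, which is what
    [section_open] asks for in order to prove openness. *)
Lemma local_homeo_section x : exists2 s : Y -> X,
  s @ f x --> x & \forall y \near f x, f (s y) = y.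
Proof.
have [U [oU Ux iU]] := local_homeo_inj x.
have [s sP] : {s : Y -> X & forall y, (f @` U) y -> U (s y) /\ f (s y) = y}.
  apply: (@choice _ _ (fun y z => (f @` U) y -> U z /\ f z = y)) => y.
  by have [[z Uz zy]|] := pselect ((f @` U) y); [exists z|exists x].
exists s; last first.
  apply: (@filterS _ (nbhs (f x)) _ (f @` U)); first by move=> y /sP[].
  by apply: open_nbhs_nbhs; split; [exact: local_homeo_open|exists x].
apply: cvg_openP => V oV Vx.
apply: (near_fmap (A := f @` (U `&` V))).
  apply: open_nbhs_nbhs; split; last by exists x.
  by apply: local_homeo_open; exact: openI.
move=> _ [z [Uz Vz] <-]; have [Usz fsz] : U (s (f z)) /\ f (s (f z)) = f z.
  by apply: sP; exists z.
by rewrite (_ : s (f z) = z) //; apply: iU; rewrite ?inE.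
Qed.

End LocalHomeo.

Lemma section_open (X Y : topologicalType) (f : X -> Y) :
  (forall x, exists2 s : Y -> X, s @ f x --> x & \forall y \near f x, f (s y) = y) ->
  forall W, open W -> open (f @` W).
Proof.
move=> sf W oW; apply: open_nearP => _ [x Wx <-]; have [s sx fs] := sf x.
have Ws : (s @ f x) W by apply: sx; exact: open_nbhs_nbhs.
apply: (@filterS _ (nbhs (f x)) _ _ _ _ (@filterI _ (nbhs (f x)) _ _ _ Ws fs)).
by move=> y [Wsy fsy]; exists (s y).
Qed.

Lemma local_homeo_comp (X Y Z : topologicalType) (f : X -> Y) (g : Y -> Z) :
  local_homeo f -> local_homeo g -> local_homeo (g \o f).
Proof.
move=> lf lg; apply: local_homeoI.
- move=> x; exact: (cvg_comp _ _ (local_homeo_continuous lf (x:=x)) (local_homeo_continuous lg (x:=f x))).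
- by move=> W oW; rewrite -image_comp; apply: local_homeo_open => //; exact: local_homeo_open.
- move=> x; have [U [oU Ux iU]] := local_homeo_inj lf x.
  have [V [oV Vx iV]] := local_homeo_inj lg (f x).
  exists (U `&` f @^-1` V); split=> //.
    apply: openI => //; move/continuousP: (local_homeo_continuous lf); exact.
  move=> y z /set_mem[Uy Vy] /set_mem[Uz Vz] /= gyz; apply: iU; rewrite ?inE //.
  by apply: iV; rewrite ?inE.
Qed.

(** Openness of [f]: where [g] is injective, a point [y] near [f x] equals [f z] as soon as [g y]
    equals [g (f z)], and such [z] exist because [g \o f] is open. *)
Lemma local_homeo_cancel (X Y Z : topologicalType) (f : X -> Y) (g : Y -> Z) :
  continuous f -> local_homeo g -> local_homeo (g \o f) -> local_homeo f.
Proof.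
move=> cf lg lgf; apply: local_homeoI => //; last first.
  move=> x; have [U [oU Ux iU]] := local_homeo_inj lgf x; exists U; split=> //.
  by move=> y z Uy Uz fyz; apply: iU => //=; rewrite fyz.
move=> W oW; apply: open_nearP => _ [x Wx <-].
have [V [oV Vx iV]] := local_homeo_inj lg (f x).
pose W1 := W `&` f @^-1` V.
have oW1 : open W1 by apply: openI => //; move/continuousP: cf; exact.
have gW1 : nbhs (g (f x)) ((g \o f) @` W1).
  apply: open_nbhs_nbhs; split; first exact: local_homeo_open.
  by exists x.
have VfV : nbhs (f x) V by exact: open_nbhs_nbhs.
apply: (@filterS _ (nbhs (f x)) _ _ _ _
  (filterI VfV (local_homeo_continuous lg gW1))) => y [Vy [z [Wz Vz] /= gz]].
by exists z => //; apply: iV; rewrite ?inE.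
Qed.

Lemma local_homeo_val (X : topologicalType) (A : set X) : open A ->
  local_homeo (val : A -> X).
Proof.
move=> oA; apply: local_homeoI.
- exact: val_continuous.
- move=> _ [V oV <-]; rewrite (_ : _ @` _ = V `&` A); first exact: openI.
  apply/seteqP; split=> [_ [z Vz <-]|x [Vx Ax]].
    by split=> //; exact: set_mem (valP z).
  by exists (exist _ x (mem_set Ax)).
- by move=> x; exists setT; split; [exact: openT|by []|by move=> ? ? _ _ /val_inj].
Qed.

Lemma local_homeo_zdim (X Y : topologicalType) (f : X -> Y) :
  local_homeo f -> zdim Y -> zdim X.
Proof.
move=> lf zY x N xN; have [U [oU Ux iU]] := local_homeo_inj lf x.
pose U1 := U `&` N°.
have oU1 : open U1 by apply: openI => //; exact: open_interior.
have U1x : U1 x by split.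
have [|C [oC cC Cx CU]] := zY (f x) (f @` U1).
  by apply: open_nbhs_nbhs; split; [exact: local_homeo_open|exists x].
have cf := local_homeo_continuous lf.
(* The copy of [C] in [U1]; it is compact because [C] lies in the image of [U1] and [f] is injective
   on [U1]. *)
exists (U1 `&` f @^-1` C); split=> //; last by move=> z [[_ /interior_subset]].
  by apply: openI => //; move/continuousP: cf; exact.
apply: ultraP_compact => F UF FV.
have [|y Cy Fy] := compact_ultraP cC (ultra_fmap f UF).
  by apply: (near_fmap FV) => z [].
have [v [Uv Nv] fv] := CU _ Cy; exists v; first by split=> //; rewrite /preimage /= fv.
apply: cvg_openP => M oM Mv.
have FM : (f @ F) (f @` (M `&` U1)).
  apply: Fy; apply: open_nbhs_nbhs; split; last by exists v.
  by apply: local_homeo_open => //; exact: openI.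
apply: (@filterS _ F _ _ _ _ (@filterI _ F _ _ _ FV FM)).
move=> z [[[Uz Nz] Cz] [u [Mu [Uu Nu]] fu]].
by rewrite (_ : z = u) //; apply: iU; rewrite ?inE.
Qed.

Section Square.
Variables (Y Y' Z Z' : topologicalType).
Variables (q : Y -> Y') (p : Z -> Z') (f : Y -> Z) (f' : Y' -> Z').
Hypotheses (lf : local_homeo f) (lf' : local_homeo f').
Hypotheses (cq : continuous q) (sq : set_surj [set: Y] [set: Y'] q).
Hypothesis (fqE : forall y, f' (q y) = p (f y)).
Hypothesis lift : forall z y', p z = f' y' -> exists2 y, f y = z & q y = y'.

(** Left to right, the preimage of an open set under [f] is open, and [lift] shows that it meets the
    fibre over [y']. Right to left, [W] is cut down to the points over an open [U] on which [f'] is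
    injective; its image under [f] is open, and injectivity brings the fibre condition back from
    [Z'] to [Y']. *)
Lemma fcvg_square (F : set_system Y') {FF : Filter F} (y' : Y') :
  fcvg q F y' <-> F --> y' /\ fcvg p (f' @ F) (f' y').
Proof.
split=> [fF|[Fy fF]].
  split; first exact: fcvg_cvg fF.
  move=> W oW [z Wz pz]; have [y fy qy] := lift pz.
  apply: (near_fmap (A := q @` (f @^-1` W))).
    apply: fF; last by exists y => //; rewrite /preimage /= fy.
    by move/continuousP: (local_homeo_continuous lf); exact.
  by move=> _ [t Wt <-]; exists (f t) => //; rewrite fqE.
move=> W oW [w Ww qw]; have [U [oU Uy iU]] := local_homeo_inj lf' y'.
pose B := W `&` q @^-1` U.
have oB : open B by apply: openI => //; move/continuousP: cq; exact.
have FB : F (f' @^-1` (p @` (f @` B))).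
  apply: fF; first exact: local_homeo_open.
  by exists (f w); [exists w => //; split=> //; rewrite /preimage /= qw|rewrite -fqE qw].
have FU : F U by apply: Fy; exact: open_nbhs_nbhs.
apply: (@filterS _ F _ _ _ _ (@filterI _ F _ _ _ FU FB)).
move=> y1 [Uy1 [_ [b [Wb Ub] <-]]]; rewrite -fqE => fy1; exists b => //.
by apply: iU; rewrite ?inE.
Qed.

(** Regularity of [q] is fine convergence along the pairs in a common fibre near [(a, b)].
    Injectivity of [f] on the fibres of [q] keeps the images of [a] and [b] distinct, so that
    regularity of [p] applies to them. *)
Lemma reg_square : (forall a b, q a = q b -> f a = f b -> a = b) ->
  reg_map p -> reg_map q.
Proof.
move=> ifib rp a b ab qab W oW Wa.
pose F := within [set z | q z.1 = q z.2] (nbhs (a, b)).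
have FF : Filter F by exact: within_filter.
have aF : (fun z : Y * Y => z.1) @ F --> a by apply: cvg_within_filter; exact: cvg_fst.
have bF : (fun z : Y * Y => z.2) @ F --> b by apply: cvg_within_filter; exact: cvg_snd.
have qF : \forall z \near F, q z.1 = q z.2 by rewrite /prop_near1 /F /within /=; exact: nearW.
suff : fcvg q ((q \o fst) @ F) (q a) by move=> /(_ W oW Wa).
have cf := local_homeo_continuous lf.
apply/fcvg_square; split; first exact: (cvg_comp _ _ aF (@cq a)).
have -> : f' @ ((q \o fst) @ F) = (p \o (f \o fst)) @ F.
  by apply/funext => A; rewrite /fmap /=; congr F; apply/funext => z /=; rewrite /preimage /= fqE.
rewrite fqE; apply: (reg_fcvg (b := f \o snd) (b0 := f b) rp).
- exact: (cvg_comp _ _ aF (@cf a)).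
- exact: (cvg_comp _ _ bF (@cf b)).
- by move=> fab; apply: ab; exact: ifib.
- by rewrite -!fqE qab.
- by apply: filterS qF => z /=; rewrite -!fqE => ->.
Qed.

(** Applied with the range maps as [f] and [f'] and the inclusions of units as [i] and [i']:
    regularity passes from a groupoid to its unit space. *)
Lemma reg_retract (i : Z -> Y) (i' : Z' -> Y') : continuous i ->
  cancel i f -> (forall z, q (i z) = i' (p z)) -> reg_map q -> reg_map p.
Proof.
move=> ci ifK qi rq a b ab pab W oW [w Ww pw].
have iab : i a <> i b by move/(can_inj ifK).
have oW' : open (f @^-1` W) by move/continuousP: (local_homeo_continuous lf); exact.
have := rq _ _ iab _ _ oW'; rewrite !qi pab => /(_ erefl) [].
  by exists (i w); [rewrite /preimage /= ifK|rewrite qi pw pab].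
move=> [A B] [/= aA bB] AB.
exists (i @^-1` A, i @^-1` B); first by split; [exact: ci|exact: ci].
move=> [y z] [/= Ay Bz] pyz; have [||t Wt] := AB (i y, i z); first by [].
  by rewrite /= !qi pyz.
move=> /= qt; exists (f t) => //; rewrite -fqE qt fqE ifK //.
Qed.

End Square.

(** * The nerve of an etale groupoid *)

Section Etale.
Variables (T : topologicalType) (G : groupoid T).
Hypothesis eG : etale G.

Lemma gr_id u : gunits G u -> gr G u = u.
Proof. by move=> [g _ <-]; rewrite gr_gr. Qed.

Lemma gunitsE u : gunits G u <-> gr G u = u.
Proof. by split=> [/gr_id //|<-]; exists u. Qed.

Lemma gr_unit_id (u : gunits G) : gr_unit G (val u) = u.
Proof. by apply: val_inj => /=; apply: gr_id; exact: set_mem (valP u). Qed.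

Lemma gr_unit_local_homeo : local_homeo (gr_unit G).
Proof. exact: etale_range. Qed.

Lemma gr_continuous : continuous (gr G).
Proof.
move=> g; exact: (cvg_comp _ _ (local_homeo_continuous gr_unit_local_homeo (x := g))
  (@val_continuous _ _ (gr_unit G g))).
Qed.

Lemma ginv_continuous : continuous (ginv G).
Proof. exact: (continuous_ginv (etale_topological eG)). Qed.

Lemma gs_continuous : continuous (gs G).
Proof.
rewrite (_ : gs G = gr G \o ginv G); last first.
  by apply/funext => h /=; rewrite gr_inv.
move=> g; exact: (cvg_comp _ _ (@ginv_continuous g) (@gr_continuous (ginv G g))).
Qed.

Lemma gs_unit_local_homeo : local_homeo (gs_unit G).
Proof.
rewrite (_ : gs_unit G = gr_unit G \o ginv G); last first.
  by apply/funext => h /=; apply: val_inj; rewrite /= gr_inv.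
apply: local_homeo_comp gr_unit_local_homeo; apply: local_homeoI.
- exact: ginv_continuous.
- move=> W oW; rewrite (_ : _ @` W = ginv G @^-1` W).
    by move/continuousP: ginv_continuous; exact.
  apply/seteqP; split=> [_ [g Wg <-]|g Wg]; first by rewrite /preimage /= ginvK.
  by exists (ginv G g); rewrite ?ginvK.
- by move=> x; exists setT; split; [exact: openT|by []|move=> ? ? _ _; exact: (can_inj (ginvK G))].
Qed.

(** Near a unit, both [g] and its range lie in an open set on which the range map is injective;
    having the same range, they coincide. *)
Lemma gunits_open : open (gunits G).
Proof.
apply: open_nearP => u Gu; have [U [oU Uu iU]] := local_homeo_inj gr_unit_local_homeo u.
have nU : nbhs u U by exact: open_nbhs_nbhs.
have nrU : nbhs (gr G u) U by rewrite gr_id.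
apply: (@filterS _ (nbhs u) _ _ _ _ (filterI nU (@gr_continuous u _ nrU))).
move=> g [Ug Urg]; apply/gunitsE; apply: iU; rewrite ?inE //.
by apply: val_inj; rewrite /= gr_gr.
Qed.

Lemma gmul_cvg (I : Type) (F : set_system I) {FF : Filter F} (a b : I -> T)
    (a0 b0 : T) : a @ F --> a0 -> b @ F --> b0 ->
  (\forall i \near F, gcomp G (a i) (b i)) -> gcomp G a0 b0 ->
  (fun i => gmul G (a i) (b i)) @ F --> gmul G a0 b0.
Proof.
move=> aF bF abF ab0 N Nab.
have := continuous_gmul (etale_topological eG) (x := (a0, b0)).
rewrite /continuous_at /nbhs /= -nbhs_subspace_in // => /(_ N Nab) WN.
have WF : F (fun i => gcomp G (a i) (b i) -> N (gmul G (a i) (b i))).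
  exact: (cvg_pairP aF bF WN).
by apply: (near_fmap (@filterI _ F _ _ _ WF abF)) => i [Wi abi]; exact: Wi.
Qed.

Lemma gcomp_closed (I : Type) (F : set_system I) {FF : ProperFilter F}
    (a b : I -> T) (a0 b0 : T) : a @ F --> a0 -> b @ F --> b0 ->
  (\forall i \near F, gcomp G (a i) (b i)) -> gcomp G a0 b0.
Proof.
move=> aF bF abF; have hT := etale_hausdorff eG.
have sF := cvg_comp _ _ aF (@gs_continuous a0).
have rF := cvg_comp _ _ bF (@gr_continuous b0).
apply: (cvg_unique2 hT sF).
move=> N rN; have rN' := rF _ rN.
by apply: (near_fmap (@filterI _ F _ _ _ rN' abF)) => i [Ni] /=; rewrite /gcomp /gs => ->.
Qed.

End Etale.

Section NerveTopology.
Variables (T : topologicalType) (G : groupoid T).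

Lemma nerveS_cvgP m (I : Type) (F : set_system I) {FF : Filter F}
    (f : I -> nerve G m.+1) (g : nerve G m.+1) :
  f @ F --> g <-> forall j, (fun i => val (f i) j) @ F --> val g j.
Proof.
split=> h; first by apply/cvg_projP; exact/cvg_valP.
by apply/cvg_valP; exact/cvg_projP.
Qed.

Lemma nerveS_cvg_at (Y : topologicalType) m (f : Y -> nerve G m.+1) (y : Y)
    (g : nerve G m.+1) :
  (forall j, (fun z => val (f z) j) @ y --> val g j) -> f @ y --> g.
Proof. by move=> fy; apply/nerveS_cvgP. Qed.

Definition mk_nerve m (h : 'I_m.+1 -> T) (c : h \in composable G m.+1) :
  nerve G m.+1 := exist (fun h => h \in composable G m.+1) h c.

Lemma coord_continuous m j : continuous (fun g : nerve G m.+1 => val g j).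
Proof. by move=> g; move: (@cvg_id _ (nbhs g)) => /nerveS_cvgP; exact. Qed.

Lemma nerve_comp m (g : nerve G m.+1) (i j : 'I_m.+1) : j = i.+1 :> nat ->
  gcomp G (val g i) (val g j).
Proof. by move=> ij; have /set_mem cg := valP g; exact: cg. Qed.

Definition nerve_range n : nerve G n -> nerve G 0 :=
  match n with 0 => id | m.+1 => fun g => gr_unit G (val g ord0) end.

Lemma nerve_hausdorff n : hausdorff_space T -> hausdorff_space (nerve G n).
Proof.
move=> hT; case: n => [|n] g h gh; apply: val_inj.
  apply: hT => U V gU hV.
  have [z [Uz Vz]] := gh _ _ (val_continuous gU) (val_continuous hV).
  by exists (val z).
apply/funext => j; apply: hT => U V gU hV.
have [z [Uz Vz]] := gh _ _ (coord_continuous gU) (coord_continuous hV).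
by exists (val z j).
Qed.

Definition ext_last m (h : 'I_m.+1 -> T) (x : T) (j : 'I_m.+2) : T :=
  if (j < m.+1)%N then h (inord j) else x.

Definition ext_first m (h : 'I_m.+1 -> T) (x : T) (j : 'I_m.+2) : T :=
  if j == ord0 then x else h (inord j.-1).

Lemma ext_last_composable m (h : nerve G m.+1) x :
  gcomp G (val h ord_max) x -> ext_last (val h) x \in composable G m.+2.
Proof.
move=> hx; apply: mem_set => i j ij; rewrite /ext_last.
have im : (i < m.+1)%N by rewrite -ltnS -ij.
rewrite im; case: ltnP => jm.
  by apply: nerve_comp; rewrite !inordK.
rewrite (_ : inord i = ord_max) //; apply: val_inj; rewrite /= inordK //.
by apply/eqP; rewrite -eqSS -ij eqn_leq jm -ltnS ltn_ord.
Qed.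

Lemma ext_first_composable m (h : nerve G m.+1) x :
  gcomp G x (val h ord0) -> ext_first (val h) x \in composable G m.+2.
Proof.
move=> xh; apply: mem_set => i j ij; rewrite /ext_first.
have -> : (j == ord0) = false by apply/negbTE; rewrite -val_eqE /= ij.
case: (eqVneq i ord0) => [i0|i0].
  by rewrite (_ : inord j.-1 = ord0) //; apply: val_inj; rewrite /= inordK ij i0.
have ipos : (0 < i)%N by rewrite lt0n; rewrite -val_eqE in i0.
have jm : (j.-1 < m.+1)%N by rewrite -ltnS prednK ?ltn_ord // ij.
apply: nerve_comp; rewrite !inordK // ?ij ?prednK //.
by rewrite -ltnS ltn_ord.
Qed.

Lemma face_lastE m (g : nerve G m.+2) j :
  val (face ord_max g) j = val g (widen_ord (leqnSn m.+1) j).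
Proof. by rewrite /= /face_fun /= ltnS ltn_ord. Qed.

Lemma face_firstE m (g : nerve G m.+2) j :
  val (face ord0 g) j = val g (lift ord0 j).
Proof. by []. Qed.

End NerveTopology.

Section NerveEtale.
Variables (T : topologicalType) (G : groupoid T).
Hypothesis eG : etale G.

Lemma face_continuous n (i : 'I_n.+2) : continuous (face i : nerve G n.+1 -> nerve G n).
Proof.
case: n i => [|m] i g.
  rewrite /face; case: (i == ord0).
  - exact: (cvg_comp _ _ (@coord_continuous _ G _ ord0 g)
      (local_homeo_continuous (gs_unit_local_homeo eG) (x := val g ord0))).
  - exact: (cvg_comp _ _ (@coord_continuous _ G _ ord0 g)
      (local_homeo_continuous (gr_unit_local_homeo eG) (x := val g ord0))).
apply: nerveS_cvg_at => j.
suff : (fun h : nerve G m.+2 => face_fun G i (val h) j) @ g --> face_fun G i (val g) j by [].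
rewrite /face_fun.
case: ifP => _; first exact: coord_continuous.
case: ifP => _; last exact: coord_continuous.
apply: (@gmul_cvg T G eG (nerve G m.+2) (nbhs g) (nbhs_filter g)).
- exact: coord_continuous.
- exact: coord_continuous.
- by apply: nearW => h; exact: nerve_comp.
- exact: nerve_comp.
Qed.

(** A local inverse appends to a tuple the value, at the source of its last entry, of a local
    section of the range map. *)
Lemma face_last_local_homeo m :
  local_homeo (face ord_max : nerve G m.+2 -> nerve G m.+1).
Proof.
apply: local_homeoI; first exact: face_continuous.
- apply: section_open => g; set x := val g ord_max.
  have [s sx rs] := local_homeo_section (gr_unit_local_homeo eG) x.
  pose h0 := face ord_max g : nerve G m.+1.
  have gx : gcomp G (val h0 ord_max) x by rewrite face_lastE; exact: nerve_comp.
  pose u (h : nerve G m.+1) := s (gs_unit G (val h ord_max)).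
  have u0 : gs_unit G (val h0 ord_max) = gr_unit G x by apply: val_inj.
  have scv : (fun h : nerve G m.+1 => gs_unit G (val h ord_max)) @ h0 --> gr_unit G x.
    rewrite -u0; exact: (cvg_comp _ _ (@coord_continuous _ G _ ord_max h0)
      (local_homeo_continuous (gs_unit_local_homeo eG) (x := val h0 ord_max))).
  have hu : \forall h \near h0, gcomp G (val h ord_max) (u h).
    apply: (@filterS _ (nbhs h0) _ _ _ _ (scv _ rs)) => h; rewrite /preimage /= => e.
    by have := congr1 val e.
  (* The fallback [g] is taken only where the new entry is not composable, which does not happen
     near [h0]. *)
  pose t (h : nerve G m.+1) : nerve G m.+2 :=
    match pselect (gcomp G (val h ord_max) (u h)) with
    | left c => mk_nerve (ext_last_composable c)
    | right _ => g
    end.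
  exists t; last first.
    apply: filterS hu => h c; apply: val_inj; apply/funext => j.
    rewrite face_lastE /t; case: pselect => //= c'.
    by rewrite /ext_last /= ltn_ord inord_val.
  apply: nerveS_cvg_at => j.
  suff ej : (fun h : nerve G m.+1 => ext_last (val h) (u h) j) @ h0 --> val g j.
    move=> N gN; apply: (near_fmap (@filterI _ (nbhs h0) _ _ _ hu (ej N gN))) => h [c].
    by rewrite /preimage /= /t; case: pselect.
  rewrite /ext_last; case: ltnP => jm.
    rewrite (_ : val g j = val h0 (inord j)); first exact: coord_continuous.
    by rewrite face_lastE; congr (val g _); apply: val_inj; rewrite /= inordK.
  rewrite (_ : j = ord_max); last first.
    by apply: val_inj; apply/eqP; rewrite eqn_leq jm andbT -ltnS ltn_ord.
  exact: (cvg_comp _ _ scv sx).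
- move=> g; have [U [oU Ux iU]] := local_homeo_inj (gr_unit_local_homeo eG) (val g ord_max).
  exists ((fun h : nerve G m.+2 => val h ord_max) @^-1` U); split=> //.
    by move/continuousP: (@coord_continuous _ G m.+1 ord_max); exact.
  move=> h k /set_mem Uh /set_mem Uk hk.
  have e j : val h (widen_ord (leqnSn m.+1) j) = val k (widen_ord (leqnSn m.+1) j).
    by rewrite -!face_lastE hk.
  apply: val_inj; apply/funext => j; have [jm|jm] := ltnP j m.+1.
    by rewrite (_ : j = widen_ord (leqnSn m.+1) (Ordinal jm)) //; exact: val_inj.
  rewrite (_ : j = ord_max); last first.
    by apply: val_inj; apply/eqP; rewrite eqn_leq jm andbT -ltnS ltn_ord.
  apply: iU; rewrite ?inE //; apply: val_inj.
  have ch : gcomp G (val h (widen_ord (leqnSn m.+1) ord_max)) (val h ord_max) by exact: nerve_comp.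
  have ck : gcomp G (val k (widen_ord (leqnSn m.+1) ord_max)) (val k ord_max) by exact: nerve_comp.
  by rewrite /= -ch -ck e.
Qed.

(** As for the last face, with an entry prepended by means of a local section of the source map. *)
Lemma face_first_local_homeo m :
  local_homeo (face ord0 : nerve G m.+2 -> nerve G m.+1).
Proof.
apply: local_homeoI; first exact: face_continuous.
- apply: section_open => g; set x := val g ord0.
  have [s sx rs] := local_homeo_section (gs_unit_local_homeo eG) x.
  pose h0 := face ord0 g : nerve G m.+1.
  have gx : gcomp G x (val h0 ord0) by exact: nerve_comp.
  pose u (h : nerve G m.+1) := s (gr_unit G (val h ord0)).
  have u0 : gr_unit G (val h0 ord0) = gs_unit G x by apply: val_inj; rewrite /= -gx.
  have scv : (fun h : nerve G m.+1 => gr_unit G (val h ord0)) @ h0 --> gs_unit G x.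
    rewrite -u0; exact: (cvg_comp _ _ (@coord_continuous _ G _ ord0 h0)
      (local_homeo_continuous (gr_unit_local_homeo eG) (x := val h0 ord0))).
  have hu : \forall h \near h0, gcomp G (u h) (val h ord0).
    apply: (@filterS _ (nbhs h0) _ _ _ _ (scv _ rs)) => h; rewrite /preimage /= => e.
    by have := congr1 val e.
  pose t (h : nerve G m.+1) : nerve G m.+2 :=
    match pselect (gcomp G (u h) (val h ord0)) with
    | left c => mk_nerve (ext_first_composable c)
    | right _ => g
    end.
  exists t; last first.
    apply: filterS hu => h c; apply: val_inj; apply/funext => j.
    rewrite face_firstE /t; case: pselect => //= c'.
    rewrite /ext_first -val_eqE /=; congr (sval h _).
    by rewrite add0n inord_val.
  apply: nerveS_cvg_at => j.
  suff ej : (fun h : nerve G m.+1 => ext_first (val h) (u h) j) @ h0 --> val g j.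
    move=> N gN; apply: (near_fmap (@filterI _ (nbhs h0) _ _ _ hu (ej N gN))) => h [c].
    by rewrite /preimage /= /t; case: pselect.
  rewrite /ext_first; case: (eqVneq j ord0) => [->|j0].
    exact: (cvg_comp _ _ scv sx).
  rewrite (_ : val g j = val h0 (inord j.-1)); first exact: coord_continuous.
  have jpos : (0 < j)%N by rewrite lt0n; rewrite -val_eqE in j0.
  have jm : (j.-1 < m.+1)%N by rewrite -ltnS prednK.
  rewrite face_firstE; congr (val g _); apply: val_inj.
  by rewrite /= /bump leq0n add1n inordK // prednK.
- move=> g; have [U [oU Ux iU]] := local_homeo_inj (gs_unit_local_homeo eG) (val g ord0).
  exists ((fun h : nerve G m.+2 => val h ord0) @^-1` U); split=> //.
    by move/continuousP: (@coord_continuous _ G m.+1 ord0); exact.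
  move=> h k /set_mem Uh /set_mem Uk hk.
  have e j : val h (lift ord0 j) = val k (lift ord0 j) by rewrite -!face_firstE hk.
  apply: val_inj; apply/funext => j; case: (unliftP ord0 j) => [j' -> //|->].
  apply: iU; rewrite ?inE //; apply: val_inj.
  have ch : gcomp G (val h ord0) (val h (lift ord0 ord0)) by exact: nerve_comp.
  have ck : gcomp G (val k ord0) (val k (lift ord0 ord0)) by exact: nerve_comp.
  by rewrite /= ch ck e.
Qed.

Lemma coord0_local_homeo : local_homeo (fun g : nerve G 1 => val g ord0).
Proof.
have c1 x : (fun=> x) \in composable G 1.
  by apply: mem_set => i j; rewrite !ord1.
apply: local_homeoI; first exact: coord_continuous.
- apply: section_open => g; exists (fun x => mk_nerve (c1 x));
    last exact: nearW.
  by apply: nerveS_cvg_at => j; rewrite ord1; exact: cvg_id.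
- move=> x; exists setT; split; [exact: openT|by []|move=> h k _ _ hk].
  apply: val_inj; apply/funext => j.
  by rewrite ord1.
Qed.

Lemma nerve_range_local_homeo n :
  @local_homeo (nerve G n) (nerve G 0) (@nerve_range T G n).
Proof.
case: n => [|n].
  apply: local_homeoI => /=; first by move=> x; exact: cvg_id.
  - by move=> W oW; rewrite image_id.
  - by move=> x; exists setT; split=> //; exact: openT.
elim: n => [|m IH].
  exact: (local_homeo_comp coord0_local_homeo (gr_unit_local_homeo eG)).
rewrite (_ : @nerve_range T G m.+2 = @nerve_range T G m.+1 \o face ord_max).
  by apply: local_homeo_comp; [exact: face_last_local_homeo|exact: IH].
apply/funext => g /=; congr (gr_unit G); rewrite /face_fun /=.
by congr (val g _); apply: val_inj.
Qed.

Lemma nerve_range_face m (i : 'I_m.+3) (g : nerve G m.+2) : i != ord0 ->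
  nerve_range (face i g : nerve G m.+1) = nerve_range g.
Proof.
move=> i0; apply: val_inj => /=; rewrite /face_fun /=.
have ipos : (0 < i)%N by rewrite lt0n; rewrite -val_eqE in i0.
have e0 : widen_ord (leqnSn m.+1) ord0 = ord0 :> 'I_m.+2 by apply: val_inj.
rewrite e0; case: ltnP => // i1; rewrite eqn_leq ipos i1 /= gr_mul //.
exact: nerve_comp.
Qed.

(** All faces but the zeroth preserve the range of a tuple, hence cancel against the local
    homeomorphism [nerve_range]; the zeroth one changes the range and is treated directly. *)
Lemma face_local_homeo n (i : 'I_n.+2) :
  local_homeo (face i : nerve G n.+1 -> nerve G n).
Proof.
case: n i => [|m] i.
  rewrite /=; have [_|_] := eqVneq i ord0.
  - exact: (local_homeo_comp coord0_local_homeo (gs_unit_local_homeo eG)).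
  - exact: (local_homeo_comp coord0_local_homeo (gr_unit_local_homeo eG)).
have [->|i0] := eqVneq i ord0; first exact: face_first_local_homeo.
apply: (@local_homeo_cancel (nerve G m.+2) (nerve G m.+1) (nerve G 0) (face i)
  (@nerve_range T G m.+1) (@face_continuous _ i) (@nerve_range_local_homeo m.+1) _).
rewrite (_ : _ \o _ = @nerve_range T G m.+2); first exact: nerve_range_local_homeo.
by apply/funext => g; exact: nerve_range_face.
Qed.

Lemma nerve_zdim n : zdim T -> zdim (nerve G n).
Proof.
move=> zT; apply: (@local_homeo_zdim (nerve G n) T (val \o @nerve_range T G n)) zT.
exact: (@local_homeo_comp (nerve G n) (nerve G 0) T _ _ (@nerve_range_local_homeo n) (local_homeo_val (gunits_open eG))).
Qed.

End NerveEtale.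

(** * Push-forward and the complex of an etale groupoid *)

(* [pushforward] alone is the image of a measure in MathComp-Analysis. *)
Local Notation pushforward := Defs.pushforward.

Lemma near_all_seq (I : eqType) (Y : Type) (s : seq I) (F : set_system Y)
    {FF : Filter F} (P : I -> Y -> Prop) :
  (forall x, x \in s -> \forall y \near F, P x y) ->
  \forall y \near F, forall x, x \in s -> P x y.
Proof.
elim: s => [|a s IH] sP; first exact: nearW.
have := IH (fun x xs => sP x (@mem_behead _ (a :: s) _ xs)).
apply: filterS2 (sP a (mem_head _ _)) => y Pa Ps x; rewrite inE.
by case: eqVneq => [->|_ /=]; [|exact: Ps].
Qed.

Section CcTheory.
Variables (X : topologicalType) (A : zmodType).
Implicit Types f g : X -> A.

Definition loc_const f := forall x, \forall y \near x, f y = f x.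

Lemma loc_const_neq0_closed f : loc_const f -> closed [set x | f x != 0].
Proof.
move=> lf x clx; have [y [fy0 fyx]] := clx _ (lf x).
by rewrite /= -fyx.
Qed.

(** The set where a locally constant function does not vanish is closed, so it is its own
    closure. *)
Lemma is_CcP f : f \in @is_Cc X A <->
  loc_const f /\ compact [set x | f x != 0].
Proof.
split=> [/asboolP[/continuous_discreteP lf cf]|[lf cf]].
  by split=> //; move: cf; rewrite -(closure_id _).1 //; exact: loc_const_neq0_closed.
apply/asboolP; split; first exact/continuous_discreteP.
by rewrite -(closure_id _).1 //; exact: loc_const_neq0_closed.
Qed.

Lemma loc_const_cst (c : A) : loc_const (fun=> c).
Proof. by move=> x; exact: nearW. Qed.

Lemma is_Cc_sub f (K : set X) : loc_const f -> compact K ->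
  (forall x, f x != 0 -> K x) -> f \in @is_Cc X A.
Proof.
move=> lf cK fK; apply/is_CcP; split=> //.
by apply: subclosed_compact cK _ => //; exact: loc_const_neq0_closed.
Qed.

Lemma Cc_loc_const (f : Cc X A) : loc_const f.
Proof. by have /is_CcP[] := CcP f. Qed.

Lemma Cc_compact (f : Cc X A) : compact [set x | f x != 0].
Proof. by have /is_CcP[] := CcP f. Qed.

Lemma Cc_ext (f g : Cc X A) : (forall x, f x = g x) -> f = g.
Proof. by move=> fg; apply: val_inj; apply/funext. Qed.

Definition Cc_ev (x : X) (f : Cc X A) : A := f x.

Lemma Cc_ev_is_zmod_morphism x : zmod_morphism (Cc_ev x).
Proof. by move=> f g; rewrite /Cc_ev /= !fctE. Qed.

HB.instance Definition _ x :=
  GRing.isZmodMorphism.Build _ _ (Cc_ev x) (Cc_ev_is_zmod_morphism x).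

Lemma CcB (f g : Cc X A) x : (f - g) x = f x - g x.
Proof. exact: (raddfB (Cc_ev x)). Qed.

Lemma Cc_sum (I : Type) (r : seq I) (P : pred I) (F : I -> Cc X A) x :
  (\sum_(i <- r | P i) F i) x = \sum_(i <- r | P i) F i x.
Proof. exact: (raddf_sum (Cc_ev x)). Qed.

Lemma CcMz (f : Cc X A) n x : (f *~ n) x = f x *~ n.
Proof. exact: (raddfMz (Cc_ev x)). Qed.

End CcTheory.

Section Pushforward.
Variables (X Y : topologicalType) (A : zmodType) (phi : X -> Y).

(** Any duplicate-free list that contains the support in the fibre computes the sum, so that one
    list can serve several functions. *)
Lemma pushforwardE (f : X -> A) y (s : seq X) : uniq s ->
  (forall x, phi x = y -> f x != 0 -> x \in s) ->
  pushforward phi f y = \sum_(x <- s | phi x == y) f x.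
Proof.
move=> us fs; rewrite /pushforward (fsbigE [seq x <- s | phi x == y]).
- rewrite big_filter_cond; apply: eq_bigl => x.
  by apply: andb_idr => /eqP xy; apply: mem_set.
- exact: filter_uniq.
- by move=> x /=; rewrite mem_filter => /andP[/eqP].
- move=> x xy; rewrite mem_filter negb_and xy eqxx /= => xs.
  by apply/eqP; apply: contraNT xs => /(fs _ xy).
Qed.

Hypothesis inj_phi : forall x, exists U, [/\ open U, U x & set_inj U phi].

Lemma compact_fibre_finite (K : set X) y : compact K ->
  exists2 s : seq X, uniq s & forall x, K x -> phi x = y -> x \in s.
Proof.
move=> /compact_near_coveringP cK.
(* Lists ordered by inclusion: a property holds eventually along [F] when it holds for all lists
   containing some fixed one. *)
pose F := filter_from [set: seq X] (fun l => [set l' : seq X | {subset l <= l'}]).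
have FF : ProperFilter F.
  apply: filter_from_proper; last by move=> l _; exists l => x.
  apply: filter_from_filter; first by exists [::].
  move=> l l' _ _; exists (l ++ l') => // t lt.
  by split=> x xl; apply: lt; rewrite mem_cat xl ?orbT.
have [|l lP] := filter_ex (cK _ F (fun l x => phi x = y -> x \in l) FF _).
  move=> x Kx; have [U [oU Ux iU]] := inj_phi x.
  have [[z [Uz zy]]|nz] := pselect (exists z, U z /\ phi z = y); last first.
    exists (U, setT); first by split; [exact: open_nbhs_nbhs|exact: filterT].
    by move=> [z l] [/= Uz _] zy; case: nz; exists z.
  exists (U, [set l : seq X | z \in l]).
    split; first exact: open_nbhs_nbhs.
    by exists [:: z] => // l; apply; rewrite inE.
  move=> [t l] [/= Ut zl] ty; rewrite (_ : t = z) //.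
  by apply: iU; rewrite ?inE // ty zy.
exists (undup l); first exact: undup_uniq.
by move=> x Kx xy; rewrite mem_undup; exact: lP.
Qed.

End Pushforward.

Lemma compact_fibre_finite2 (X Y : topologicalType) (A : zmodType) (phi : X -> Y)
    (f g : Cc X A) y : (forall x, exists U, [/\ open U, U x & set_inj U phi]) ->
  exists s : seq X, [/\ uniq s,
    forall x, phi x = y -> f x != 0 -> x \in s &
    forall x, phi x = y -> g x != 0 -> x \in s].
Proof.
move=> iphi.
have [s us sP] := compact_fibre_finite iphi y 
  (compactU (@Cc_compact _ _ f) (@Cc_compact _ _ g)).
by exists s; split=> // x xy fx; apply: sP => //; [left|right].
Qed.

Section PushforwardCc.
Variables (X Y : topologicalType) (A : zmodType) (phi : X -> Y).
Hypotheses (lphi : local_homeo phi).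
Hypotheses (hX : hausdorff_space X) (hY : hausdorff_space Y).

(** Over [y] near [y0], the points of the support are among the [sec x y] with [x] in the finite
    fibre [s] over [y0]. These are lifts of [y] with unchanged values ([n1]), pairwise distinct
    ([n2]) and exhaustive ([n3]), so the two sums agree term by term. *)
Lemma pushforward_loc_const (f : Cc X A) : loc_const (pushforward phi f).
Proof.
move=> y0; pose K := [set x | f x != 0].
have cK : compact K := @Cc_compact _ _ f.
have [s0 us0 s0P] := compact_fibre_finite (local_homeo_inj lphi) y0 cK.
pose s := [seq x <- s0 | phi x == y0].
have us : uniq s by exact: filter_uniq.
have sphi x : x \in s -> phi x = y0 by rewrite mem_filter => /andP[/eqP].
have sP x : K x -> phi x = y0 -> x \in s.
  by move=> Kx xy; rewrite mem_filter xy eqxx s0P.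
have [sec secP] : {sec : X -> Y -> X & forall x, sec x @ phi x --> x /\
    \forall y \near phi x, phi (sec x y) = y}.
  apply: (@choice _ _ (fun x (t : Y -> X) => t @ phi x --> x /\
    \forall y \near phi x, phi (t y) = y)) => x.
  by have [t ? ?] := local_homeo_section lphi x; exists t.
have n1 : \forall y \near y0, forall x, x \in s -> phi (sec x y) = y /\ f (sec x y) = f x.
  apply: near_all_seq => x xs; have [c1 c2] := secP x; rewrite (sphi _ xs) in c1 c2.
  by have c3 := c1 _ (Cc_loc_const f x); apply: filterS2 c2 c3.
have n2 : \forall y \near y0, forall x, x \in s -> forall x', x' \in s -> x <> x' ->
    sec x y <> sec x' y.
  apply: near_all_seq => x xs; apply: near_all_seq => x' xs'.
  have [xx'|xx'] := pselect (x = x'); first exact: nearW.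
  have [c1 _] := secP x; have [c1' _] := secP x'.
  rewrite (sphi _ xs) in c1; rewrite (sphi _ xs') in c1'.
  have [U [V [oU oV xU x'V UV]]] := hausdorff_sep hX xx'.
  have {}xU : nbhs x U by exact: open_nbhs_nbhs.
  have {}x'V : nbhs x' V by exact: open_nbhs_nbhs.
  apply: (@filterS _ (nbhs y0) _ _ _ _
    (@filterI _ (nbhs y0) _ _ _ (c1 _ xU) (c1' _ x'V))) => y [Uy Vy] _ e.
  by have : set0 (sec x y) by rewrite -UV; split=> //; rewrite /preimage /= e.
have n3 : \forall y \near y0, forall x, K x -> phi x = y -> exists2 z, z \in s & x = sec z y.
  move: cK => /compact_near_coveringP cK.
  apply: (cK _ (nbhs y0) (fun y x => phi x = y -> exists2 z, z \in s & x = sec z y)).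
  move=> x Kx; have [xy|xy] := eqVneq (phi x) y0.
    have [U [oU Ux iU]] := local_homeo_inj lphi x.
    have [c1 c2] := secP x; rewrite xy in c1 c2.
    have c3 : \forall y \near y0, U (sec x y) by apply: c1; exact: open_nbhs_nbhs.
    exists (U, [set y | U (sec x y) /\ phi (sec x y) = y]).
      by split; [exact: open_nbhs_nbhs|exact: filterI].
    move=> [t y] [/= Ut [Uy sy]] ty; exists x; first exact: sP.
    by apply: iU; rewrite ?inE // sy.
  (* Near a point outside the fibre over [y0], continuity keeps the images away from a neighbourhood
     of [y0]. *)
  have [U [V [oU oV xU yV UV]]] := hausdorff_sep hY (elimN eqP xy).
  exists (phi @^-1` U, V).
    split; last exact: open_nbhs_nbhs.
    by apply: (local_homeo_continuous lphi); exact: open_nbhs_nbhs.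
  move=> [t y] [/= Ut Vy] ty; suff : set0 y by [].
  by rewrite -UV; split=> //; rewrite -ty.
apply: filterS3 n1 n2 n3 => y n1 n2 n3.
rewrite (@pushforwardE _ _ _ _ f y0 s) //; last by move=> x xy0 fx; exact: sP.
rewrite (@pushforwardE _ _ _ _ f y [seq sec x y | x <- s]).
- rewrite big_map big_seq_cond [RHS]big_seq_cond; apply: eq_big => x.
    case xs : (x \in s) => //=; rewrite (sphi _ xs) eqxx.
    by have [-> _] := n1 _ xs; rewrite eqxx.
  by move=> /andP[xs _]; have [_ ->] := n1 _ xs.
- rewrite map_inj_in_uniq // => x x' xs xs' e.
  by apply: contrapT => xx'; exact: (n2 _ xs _ xs' xx').
- by move=> x xy fx; have [z zs ->] := n3 x fx xy; exact: map_f.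
Qed.

Lemma pushforward_neq0 (f : Cc X A) y : pushforward phi f y != 0 ->
  exists2 x, phi x = y & f x != 0.
Proof.
move=> fy; apply: contrapT => nx; move/eqP: fy; apply.
rewrite /pushforward fsbig1 // => x /= xy; apply/eqP; apply: contrapT => /negP fx.
by apply: nx; exists x.
Qed.

Lemma pushforward_Cc (f : Cc X A) : pushforward phi f \in @is_Cc Y A.
Proof.
apply: (@is_Cc_sub _ _ _ (phi @` [set x | f x != 0])).
- exact: pushforward_loc_const.
- apply: continuous_compact; last exact: Cc_compact.
  by apply: continuous_subspaceT; exact: local_homeo_continuous.
- by move=> y /pushforward_neq0[x xy fx]; exists x.
Qed.

Definition push_fun (f : Cc X A) : Cc Y A := MkCc (pushforward_Cc f).

Lemma push_is_zmod_morphism : zmod_morphism push_fun.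
Proof.
move=> f g; apply: Cc_ext => y; rewrite CcB /=.
have [s [us sf sg]] := compact_fibre_finite2 f g y (local_homeo_inj lphi).
have sfg x : phi x = y -> (f - g) x != 0 -> x \in s.
  move=> xy; rewrite CcB => fgx; have [fx|fx] := eqVneq (f x) 0; last exact: sf.
  by apply: sg => //; apply: contra_neq fgx => ->; rewrite fx subrr.
rewrite (pushforwardE us sfg) (pushforwardE us sf) (pushforwardE us sg) -sumrB.
by apply: eq_bigr => x _; rewrite CcB.
Qed.

Definition push : {additive Cc X A -> Cc Y A} :=
  HB.pack push_fun (GRing.isZmodMorphism.Build _ _ push_fun push_is_zmod_morphism).

End PushforwardCc.

Lemma pushforward_comp (X Y Z : topologicalType) (A : zmodType) (phi : X -> Y)
    (psi : Y -> Z) (f : Cc X A) z : local_homeo phi -> local_homeo psi ->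
  pushforward psi (pushforward phi f) z = pushforward (psi \o phi) f z.
Proof.
move=> lphi lpsi; have lc := local_homeo_comp lphi lpsi.
have [s us sP] := compact_fibre_finite (local_homeo_inj lc) z (@Cc_compact _ _ f).
rewrite (@pushforwardE _ _ _ _ f z s) //; last by move=> x xz fx; exact: sP.
rewrite (@pushforwardE _ _ _ psi _ z (undup (map phi s))) ?undup_uniq //; last first.
  move=> y yz /pushforward_neq0[x xy fx]; rewrite mem_undup -xy; apply: map_f.
  by apply: sP => //=; rewrite xy.
transitivity (\sum_(y <- undup (map phi s) | psi y == z) \sum_(x <- s | phi x == y) f x).
  apply: eq_bigr => y /eqP yz; apply: pushforwardE => // x xy fx.
  by apply: sP => //=; rewrite xy.
rewrite (exchange_big_dep (fun x => psi (phi x) == z)) /=; last first.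
  by move=> y x /eqP yz /eqP ->; rewrite yz.
rewrite big_seq_cond [RHS]big_seq_cond; apply: eq_bigr => x /andP[xs xz].
have xu : phi x \in undup (map phi s) by rewrite mem_undup map_f.
rewrite -big_filter (_ : [seq y <- _ | _] = [:: phi x]) ?big_seq1 //.
rewrite (eq_filter (a2 := pred1 (phi x))); last first.
  by move=> y /=; rewrite [phi x == y]eq_sym; case: (eqVneq y (phi x)) => [->|_]; rewrite ?xz ?andbF.
by rewrite filter_pred1_uniq ?undup_uniq.
Qed.

Lemma eq_pushforward (X Y : topologicalType) (A : zmodType) (phi psi : X -> Y)
    (f g : X -> A) y : phi =1 psi -> f =1 g ->
  pushforward phi f y = pushforward psi g y.
Proof. by move=> /funext -> /funext ->. Qed.

Section FaceFace.
Variables (T : topologicalType) (G : groupoid T).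

(** [face_fun] on sequences indexed by [nat], so that the simplicial identities reduce to
    comparisons of numbers without casts between ordinals. *)
Let ff (i : nat) (g : nat -> T) (k : nat) : T :=
  if (k.+1 < i)%N then g k else if k.+1 == i then gmul G (g k) (g k.+1) else g k.+1.

Let tn m (h : 'I_m.+1 -> T) (k : nat) : T := h (inord k).

Let face_ff m (i : 'I_m.+3) (h : 'I_m.+2 -> T) (k : nat) : (k < m.+1)%N ->
  tn (face_fun G i h) k = ff i (tn h) k.
Proof.
move=> km; rewrite /tn /face_fun /ff inordK //.
have -> : widen_ord (leqnSn m.+1) (inord k) = inord k :> 'I_m.+2.
  by apply: val_inj; rewrite /= !inordK // ltnW.
have -> // : lift ord0 (inord k : 'I_m.+1) = inord k.+1 :> 'I_m.+2.
by apply: val_inj; rewrite /= /bump leq0n add1n !inordK.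
Qed.

Let ff_ff (g : nat -> T) i j k : (i <= j)%N ->
  (forall l, (l < k.+2)%N -> gcomp G (g l) (g l.+1)) ->
  ff i (ff j.+1 g) k = ff j (ff i g) k.
Proof.
move=> ij cg; rewrite /ff.
have [ki|ik|ki] := ltngtP k.+1 i.
- rewrite ltnS (leq_trans (ltnW ki) ij) /=; first by rewrite (leq_trans ki ij).
- have [kj|jk|kj] := ltngtP k.+1 j.
  + by rewrite ltnS kj.
  + rewrite ltnS ltnNge (ltnW jk) /= eqSS gtn_eqF //.
    by rewrite ltnNge (leqW (ltnW ik)) /= gtn_eqF // leqW.
  + by rewrite -kj ltnn eqxx ltnNge (leqW (ltnW ik)) /= gtn_eqF // leqW.
- subst i; rewrite ltnS ij; have [kj|jk|kj] := ltngtP k.+1 j.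
  + by rewrite ltnS kj.
  + by rewrite leqNgt jk in ij.
  + rewrite -kj ltnn eqxx ltnNge leqnSn /= gtn_eqF //.
    by have [_ _ ->] := gmulA (cg k (leqnSn _)) (cg k.+1 (leqnn _)).
Qed.

(** Associativity enters when [i] and [j] coincide at the inspected entry. Degree 0, where the outer
    faces are source and range, is verified case by case. *)
Lemma face_face n (i j : 'I_n.+2) (g : nerve G n.+2) : (i <= j)%N ->
  face i (face (lift ord0 j) g : nerve G n.+1) =
  face j (face (widen_ord (leqnSn _) i) g : nerve G n.+1) :> nerve G n.
Proof.
case: n i j g => [|m] i j g ij; apply: val_inj.
  have c01 : gcomp G (val g (inord 0)) (val g (inord 1)).
    by apply: nerve_comp; rewrite !inordK.
  have e0 : (widen_ord (leqnSn 1) ord0 : 'I_2) = inord 0 by apply: val_inj; rewrite /= inordK.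
  have e1 : (lift ord0 ord0 : 'I_2) = inord 1 by apply: val_inj; rewrite /= inordK.
  move: i j ij => [[|[|//]] Hi] [[|[|//]] Hj] //= _;
    rewrite /= /face_fun /= ?e0 ?e1.
  - by rewrite gs_mul.
  - exact: c01.
  - by rewrite gr_mul.
apply/funext => k.
rewrite -[k]inord_val -/(tn _ k) -[RHS]/(tn _ k).
have km := ltn_ord k.
have tnE (h h' : nat -> T) l r : (forall x, (x < r.+2)%N -> h x = h' x) -> ff l h r = ff l h' r.
  by move=> hh; rewrite /ff !hh.
change (tn (face_fun G i (face_fun G (lift ord0 j) (val g))) k =
        tn (face_fun G j (face_fun G (widen_ord (leqnSn _) i) (val g))) k).
rewrite !face_ff //.
transitivity (ff i (ff j.+1 (tn (val g))) k).
  by apply: tnE => l lk; rewrite face_ff //; exact: leq_trans lk _.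
rewrite ff_ff //; last first.
  move=> l lk; apply: nerve_comp.
  have lm : (l.+1 < m.+3)%N by rewrite ltnS; exact: leq_trans lk _.
  by rewrite !inordK // ltnW.
by apply: tnE => l lk; rewrite face_ff //; exact: leq_trans lk _.
Qed.

End FaceFace.

Lemma sum_ord_split (V : zmodType) N (i : 'I_N.+1) (F : 'I_N.+2 -> V) :
  \sum_(j < N.+2) F j =
  \sum_(j < N.+1 | (j <= i)%N) F (widen_ord (leqnSn _) j) +
  \sum_(j < N.+1 | (i <= j)%N) F (lift ord0 j).
Proof.
rewrite (bigID (fun j : 'I_N.+2 => (j <= i)%N)) /=; congr (_ + _).
  rewrite big_mkcond big_ord_recr /= [X in _ + X]ifF; last first.
    by rewrite leqNgt ltn_ord.
  by rewrite addr0 [RHS]big_mkcond.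
rewrite big_mkcond big_ord_recl /= add0r [RHS]big_mkcond; apply: eq_bigr => j _.
by rewrite /bump leq0n add1n -ltnNge ltnS.
Qed.

(** [sum_ord_split] cuts the rectangle of indices into two triangles. [tE] identifies a term of one
    with the transposed term of the other, and [lift ord0] raises the index by one, so the signs are
    opposite. *)
Lemma alternating_sum_sum (V : zmodType) N (t : 'I_N.+1 -> 'I_N.+2 -> V) :
  (forall i j : 'I_N.+1, (i <= j)%N ->
    t i (lift ord0 j) = t j (widen_ord (leqnSn _) i)) ->
  \sum_(i < N.+1) (\sum_(j < N.+2) t i j *~ ((-1) ^+ j)) *~ ((-1) ^+ i) = 0.
Proof.
move=> tE.
under eq_bigr => i _ do rewrite (sum_ord_split i) mulrzDl !mulrz_suml.
rewrite big_split /= [X in _ + X](exchange_big_dep xpredT) //=.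
rewrite -big_split /= big1 // => i _.
rewrite -big_split /= big1 // => j ji.
by rewrite (tE _ _ ji) /bump leq0n add1n exprS mulN1r mulrNz mulNrz -!mulrzA mulrC subrr.
Qed.

Section Complex.
Variables (T : topologicalType) (G : groupoid T) (A : zmodType).
Hypothesis eG : etale G.

Let hN n : hausdorff_space (nerve G n).
Proof. exact: nerve_hausdorff (etale_hausdorff eG). Qed.

Definition face_push n (i : 'I_n.+2) : {additive Cc (nerve G n.+1) A -> Cc (nerve G n) A} :=
  push A (@face_local_homeo T G eG n i) (@hN n.+1) (@hN n).

Definition nerve_bd_fun n (f : Cc (nerve G n.+1) A) : Cc (nerve G n) A :=
  \sum_(i < n.+2) face_push i f *~ ((-1) ^+ i).

Lemma nerve_bd_is_zmod_morphism n : zmod_morphism (@nerve_bd_fun n).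
Proof.
move=> f g; rewrite /nerve_bd_fun -sumrB; apply: eq_bigr => i _.
by rewrite raddfB mulrzBl.
Qed.

Definition nerve_bd n : {additive Cc (nerve G n.+1) A -> Cc (nerve G n) A} :=
  HB.pack (@nerve_bd_fun n)
    (GRing.isZmodMorphism.Build _ _ (@nerve_bd_fun n) (@nerve_bd_is_zmod_morphism n)).

Lemma nerve_bdE n (f : Cc (nerve G n.+1) A) (y : nerve G n) :
  nerve_bd n f y = \sum_(i < n.+2) pushforward (@face _ G n i) f y *~ ((-1) ^+ i).
Proof. by rewrite /= Cc_sum; apply: eq_bigr => i _; rewrite CcMz. Qed.

Lemma face_push_comp n (i j : 'I_n.+2) (f : Cc (nerve G n.+2) A) : (i <= j)%N ->
  face_push i (face_push (lift ord0 j) f) =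
  face_push j (face_push (widen_ord (leqnSn _) i) f).
Proof.
move=> ij; apply: Cc_ext => y /=.
rewrite !pushforward_comp; try exact: face_local_homeo.
by apply: eq_pushforward => // g; exact: face_face.
Qed.

Lemma nerve_bd_bd n (f : Cc (nerve G n.+2) A) : nerve_bd n (nerve_bd n.+1 f) = 0.
Proof.
rewrite -[RHS](@alternating_sum_sum _ n.+1 (fun i j => face_push i (face_push j f))).
  by apply: eq_bigr => i _; rewrite raddf_sum; congr (_ *~ _); apply: eq_bigr => j _; rewrite raddfMz.
by move=> i j; exact: face_push_comp.
Qed.

Definition nerve_complex : groupoid_complex G A :=
  GroupoidComplex nerve_bdE nerve_bd_bd.

End Complex.

(** * The long exact sequence *)

Section QuotientFacts.
Local Open Scope quotient_scope.
Variables (V : zmodType) (S : zmodClosed V).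

Lemma quot_eqP (x y : V) :
  \pi_(Quotient.quot S) x = \pi_(Quotient.quot S) y <-> x - y \in S.
Proof. by rewrite Quotient.idealrBE; split=> [->|/eqP]. Qed.

Lemma quot_eq0 (x : V) : \pi_(Quotient.quot S) x = 0 <-> x \in S.
Proof. by rewrite -[0](raddf0 (\pi_(Quotient.quot S))) quot_eqP subr0. Qed.

Lemma quot_surj (c : Quotient.quot S) : exists x, \pi_(Quotient.quot S) x = c.
Proof. by exists (repr c); exact: reprK. Qed.

End QuotientFacts.

(** Used for the connecting homomorphisms and for the map induced by the reduction. Compatibility
    with subtraction reduces single-valuedness to the value at 0. *)
Lemma additive_of_relation (V W : zmodType) (Q : V -> W -> Prop) :
  (forall v, exists w, Q v w) ->
  (forall v v' w w', Q v w -> Q v' w' -> Q (v - v') (w - w')) ->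
  (forall w, Q 0 w -> w = 0) ->
  exists f : {additive V -> W}, (forall v w, Q v w <-> f v = w).
Proof.
move=> Qt QB Q0; have [f fP] := choice Qt.
have fE v w : Q v w -> f v = w.
  by move=> vw; apply/eqP; rewrite -subr_eq0; apply/eqP/Q0; rewrite -(subrr v); exact: QB.
have fB : zmod_morphism f by move=> v v'; apply: fE; exact: QB.
pose F : {additive V -> W} := HB.pack f (GRing.isZmodMorphism.Build _ _ f fB).
by exists F => v w; split=> [/fE|<-].
Qed.

Section HomologyFacts.
Variable C : chainComplex.

Lemma cycleS_bd n (z : cycles C n.+1) : bd C n (cyval z) = 0.
Proof. by have := cyvalP z; rewrite unfold_in /= => /eqP. Qed.

Lemma hclass_eq n (z z' : cycles C n) :
  hclass z = hclass z' <-> exists y, bd C n y = cyval z - cyval z'.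
Proof.
rewrite quot_eqP unfold_in; split=> [/asboolP[y yz]|[y yz]]; last apply/asboolP.
  by exists y; rewrite yz.
by exists y; rewrite yz.
Qed.

Lemma hclass_eq0 n (z : cycles C n) :
  hclass z = 0 <-> exists y, bd C n y = cyval z.
Proof.
rewrite quot_eq0 unfold_in; split=> [/asboolP[y yz]|[y yz]]; last apply/asboolP.
  by exists y.
by exists y.
Qed.

Lemma hclass_surj n (h : homology C n) : exists z, hclass z = h.
Proof. exact: quot_surj. Qed.

Lemma hclassB n (z z' : cycles C n) : hclass (z - z') = hclass z - hclass z'.
Proof. exact: raddfB. Qed.

Lemma cycle_bd n (y : C n.+1) : bd C n y \in @cycle_pred C n.
Proof. by case: n y => [//|n] y; rewrite unfold_in /= bd_bd. Qed.

Lemma cycleB n (x y : C n) : x \in @cycle_pred C n -> y \in @cycle_pred C n ->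
  x - y \in @cycle_pred C n.
Proof. exact: rpredB. Qed.

End HomologyFacts.

Lemma hmapE (C D : chainComplex) (f : chainMap C D) n (z : cycles C n) :
  hmap f n (hclass z) = hclass (cycles_map f z).
Proof. exact: quot_mapE. Qed.

Lemma cycle_injective (C D : chainComplex) (f : chainMap C D) n (x : C n) :
  (forall m, injective (f m)) -> f n x \in @cycle_pred D n ->
  x \in @cycle_pred C n.
Proof.
move=> fI; case: n x => [//|n] x; rewrite !unfold_in /= -cmap_bd.
by rewrite -[0 in X in X -> _](raddf0 (f n)) (inj_eq (fI n)).
Qed.

Lemma hmap_bijective (C D : chainComplex) (f : chainMap C D) :
  (forall n, bijective (f n)) -> forall n, bijective (hmap f n).
Proof.
move=> fb n; have fI m : injective (f m) by exact: bij_inj.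
have fS m y : exists x, f m x = y by have [g _ gK] := fb m; exists (g y).
have hI : injective (hmap f n).
  apply: raddf_inj => h; have [z <-] := hclass_surj h; rewrite hmapE.
  move=> /hclass_eq0[y /= yz]; have [u uy] := fS _ y.
  by apply/hclass_eq0; exists u; apply: (fI n); rewrite cmap_bd uy.
have hS h : exists h', hmap f n h' = h.
  have [z <-] := hclass_surj h; have [u uz] := fS _ (cyval z).
  have uc : u \in @cycle_pred C n by apply: cycle_injective fI _; rewrite uz; exact: cyvalP.
  exists (hclass (Cycle uc)); rewrite hmapE; congr hclass; exact: val_inj.
have [g gK] := choice hS.
by exists g => // h; apply: hI; rewrite gK.
Qed.

Section LES.
Variables (C' C : chainComplex) (i : chainMap C' C).
Hypothesis iI : forall n, injective (i n).
Let Q := quotComplex i.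

Lemma quot_proj_eq n (x y : C n) :
  quot_proj i n x = quot_proj i n y <-> exists w, i n w = x - y.
Proof. by rewrite quot_eqP unfold_in; split=> [/asboolP|/asboolP]. Qed.

Lemma quot_proj_eq0 n (x : C n) :
  quot_proj i n x = 0 <-> exists w, i n w = x.
Proof. by rewrite quot_eq0 unfold_in; split=> [/asboolP|/asboolP]. Qed.

Lemma quot_proj_surj n (c : Q n) : exists x, quot_proj i n x = c.
Proof. exact: quot_surj. Qed.

(** The snake relation; by [additive_of_relation] it is the graph of the connecting homomorphism. *)
Let conn n (h : homology Q n.+1) (h' : homology C' n) :=
  exists (z : cycles Q n.+1) (c : C n.+1) (c' : cycles C' n),
  [/\ h = hclass z, h' = hclass c', cyval z = quot_proj i n.+1 c
    & i n (cyval c') = bd C n c].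

Let conn_lift n (z : cycles Q n.+1) (c : C n.+1) :
  cyval z = quot_proj i n.+1 c ->
  exists c' : cycles C' n, i n (cyval c') = bd C n c.
Proof.
move=> zc; have := cycleS_bd z; rewrite zc -(cmap_bd (quot_proj i)).
move=> /quot_proj_eq0 [w wc].
have cw : w \in @cycle_pred C' n by apply: cycle_injective iI _; rewrite wc; exact: cycle_bd.
by exists (Cycle cw).
Qed.

Let conn_total n h : exists h', @conn n h h'.
Proof.
have [z <-] := hclass_surj h; have [c cz] := quot_proj_surj (cyval z).
have [c' cc'] := conn_lift (esym cz).
by exists (hclass c'), z, c, c'.
Qed.

Let connB n h1 h2 h1' h2' : @conn n h1 h1' -> conn h2 h2' -> conn (h1 - h2) (h1' - h2').
Proof.
move=> [z1 [c1 [c1' [-> -> e1 f1]]]] [z2 [c2 [c2' [-> -> e2 f2]]]].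
exists (z1 - z2), (c1 - c2), (c1' - c2'); split; rewrite ?hclassB //.
  by rewrite raddfB -e1 -e2.
by rewrite [RHS]raddfB -f1 -f2 -raddfB.
Qed.

Let conn0 n h' : @conn n 0 h' -> h' = 0.
Proof.
(* If [z] bounds, [c] differs from the boundary of a lift [u] of the bounding chain by the image of
   some [w], and [w] bounds [c'] because [i] is injective. *)
move=> [z [c [c' [/esym/hclass_eq0[y yz] -> zc cc']]]].
have [u uy] := quot_proj_surj y.
have : quot_proj i n.+1 (bd C n.+1 u) = quot_proj i n.+1 c.
  by rewrite cmap_bd uy yz.
move=> /esym/quot_proj_eq[w wc]; apply/hclass_eq0; exists w; apply: (iI (n := n)).
by rewrite cmap_bd wc raddfB bd_bd subr0.
Qed.

Lemma long_exact : exists delta : forall n, {additive homology Q n.+1 -> homology C' n},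
  (forall n, connecting (delta n)) /\ long_exact_sequence delta.
Proof.
have dex n := additive_of_relation (@conn_total n) (@connB n) (@conn0 n).
pose delta n := projT1 (cid (dex n)).
have deltaP n h h' : conn h h' <-> delta n h = h' by exact: (projT2 (cid (dex n))).
have dconn n : connecting (delta n).
  by move=> z c c' zc cc'; apply/deltaP; exists z, c, c'.
exists delta; split=> //; split=> [n|n|n|h].
- apply/seteqP; split=> [_ [h _ <-]|h h0].
    have [z <-] := hclass_surj h.
    change (hmap (quot_proj i) n (hmap i n (hclass z)) = 0).
    rewrite !hmapE; apply/hclass_eq0; exists 0.
    by rewrite raddf0; apply/esym/quot_proj_eq0; exists (cyval z).
  move: (h0 : hmap (quot_proj i) n h = 0) => {h0}.
  have [z <-] := hclass_surj h; rewrite hmapE => /hclass_eq0[y yz].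
  have [u uy] := quot_proj_surj y.
  have : quot_proj i n (cyval z) = quot_proj i n (bd C n u) by rewrite cmap_bd uy yz.
  move=> /quot_proj_eq[w wz].
  have cw : w \in @cycle_pred C' n.
    by apply: cycle_injective iI _; rewrite wz; apply: cycleB; [exact: cyvalP|exact: cycle_bd].
  exists (hclass (Cycle cw)) => //; rewrite hmapE; apply/hclass_eq; exists (- u).
  by rewrite raddfN /= wz addrAC subrr sub0r.
- apply/seteqP; split=> [_ [h _ <-]|h h0].
    have [z <-] := hclass_surj h.
    change (delta n (hmap (quot_proj i) n.+1 (hclass z)) = 0); rewrite hmapE.
    have := dconn n (cycles_map (quot_proj i) z) (cyval z) 0 erefl.
    by rewrite /= raddf0 cycleS_bd => /(_ erefl) ->; apply/hclass_eq0; exists 0; rewrite raddf0.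
  have [z hz] := hclass_surj h; move: h0; rewrite -{h}hz => h0.
  have [c cz] := quot_proj_surj (cyval z); have [c' cc'] := conn_lift (esym cz).
  move: (h0 : delta n (hclass z) = 0).
  rewrite (dconn n z c c' (esym cz) cc') => /hclass_eq0[w wc'].
  (* Correcting the lift [c] by the image of [w] turns it into a cycle without changing its class in
     the quotient. *)
  have cc : c - i n.+1 w \in @cycle_pred C n.+1.
    by rewrite unfold_in /= raddfB -cmap_bd wc' cc' subrr.
  exists (hclass (Cycle cc)) => //; rewrite hmapE; congr hclass; apply: val_inj.
  rewrite /= -cz; apply/quot_proj_eq; exists (- w).
  by rewrite raddfN addrAC subrr sub0r.
- apply/seteqP; split=> [_ [h _ <-]|h h0].
    have [z <-] := hclass_surj h; have [c cz] := quot_proj_surj (cyval z).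
    have [c' cc'] := conn_lift (esym cz).
    change (hmap i n (delta n (hclass z)) = 0).
    rewrite (dconn n z c c' (esym cz) cc') hmapE.
    by apply/hclass_eq0; exists c; rewrite /= cc'.
  move: (h0 : hmap i n h = 0) => {h0}.
  have [c' <-] := hclass_surj h; rewrite hmapE => /hclass_eq0[c cc'].
  have cz : quot_proj i n.+1 c \in @cycle_pred Q n.+1.
    change (bd Q n (quot_proj i n.+1 c) == 0).
    rewrite -(cmap_bd (quot_proj i)) cc'; apply/eqP/quot_proj_eq0.
    by exists (cyval c').
  by exists (hclass (Cycle cz)) => //; apply: (dconn n _ c c').
- have [z <-] := hclass_surj h; have [c cz] := quot_proj_surj (cyval z).
  have cc : c \in @cycle_pred C 0 by [].
  by exists (hclass (Cycle cc)); rewrite hmapE; congr hclass; apply: val_inj.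
Qed.

End LES.

(** * Pull-back along a fibre-bijective homomorphism *)

(** Base change: by unique lifting, [q] maps the fibre of [phi] over [y] bijectively to the fibre of
    [phi'] over [p y]. *)
Lemma pushforward_square (X X' Y Y' : topologicalType) (A : zmodType)
    (phi : X -> Y) (phi' : X' -> Y') (q : X -> X') (p : Y -> Y')
    (f : X' -> A) y :
  (forall x, phi' (q x) = p (phi x)) ->
  (forall x', phi' x' = p y -> exists2 x, phi x = y & q x = x') ->
  (forall x1 x2, phi x1 = y -> phi x2 = y -> q x1 = q x2 -> x1 = x2) ->
  pushforward phi (f \o q) y = pushforward phi' f (p y).
Proof.
move=> sq ex inj; rewrite /pushforward.
rewrite (@reindex_fsbig _ _ _ _ _ q (phi @^-1` [set y]) (phi' @^-1` [set p y])) //.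
split.
- by move=> x /= xy; rewrite /preimage /= sq xy.
- by move=> x1 x2 /set_mem x1y /set_mem x2y; exact: inj.
- by move=> x' /= /ex[x xy qx]; exists x.
Qed.

Lemma nerve_range_face0 (T : topologicalType) (G : groupoid T) n (g : nerve G n.+1) :
  val (nerve_range (face ord0 g : nerve G n)) = gs G (val g ord0).
Proof.
case: n g => [//|m] g /=; rewrite /face_fun /=.
by have := @nerve_comp _ _ _ g ord0 (lift ord0 ord0) erefl.
Qed.

Lemma nerve_range_faceN0 (T : topologicalType) (G : groupoid T) n (i : 'I_n.+2)
    (g : nerve G n.+1) : i != ord0 ->
  nerve_range (face i g : nerve G n) = nerve_range g.
Proof.
case: n i g => [|m] i g i0; last exact: nerve_range_face.
by rewrite /face /= (negbTE i0).
Qed.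

Section Cartesian.
Variables (T T' : topologicalType) (G : groupoid T) (G' : groupoid T').
Variables (p : T -> T') (hp : is_hom G G' p) (hb : fibre_bijective G G' p).

Lemma range_lift u g' : gunits G u -> gr G' g' = p u ->
  exists2 g, gr G g = u & p g = g'.
Proof. by move=> Gu gu; have [_ _ sj] := hb Gu; have [g ? ?] := sj g' gu; exists g. Qed.

Lemma range_lift_unique g1 g2 : gr G g1 = gr G g2 -> p g1 = p g2 -> g1 = g2.
Proof.
move=> r12 p12; have [|_ ij _] := hb (x := gr G g1); first by exists g1.
by apply: ij => //; rewrite inE.
Qed.

Lemma source_lift u g' : gunits G u -> gs G' g' = p u ->
  exists2 g, gs G g = u & p g = g'.
Proof.
move=> Gu gu; have [|g gE pg] := range_lift (g' := ginv G' g') Gu.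
  by rewrite gr_inv.
by exists (ginv G g); rewrite ?gs_inv // (hom_inv hp) pg ginvK.
Qed.

Lemma source_lift_unique g1 g2 : gs G g1 = gs G g2 -> p g1 = p g2 -> g1 = g2.
Proof.
move=> s12 p12; apply: (can_inj (ginvK G)); apply: range_lift_unique.
  by rewrite !gr_inv.
by rewrite !(hom_inv hp) p12.
Qed.

Lemma nerve_map_face n (i : 'I_n.+2) (g : nerve G n.+1) :
  face i (nerve_map hp n.+1 g) = nerve_map hp n (face i g).
Proof.
case: n i g => [|m] i g; apply: val_inj.
  rewrite /face; case: (i == ord0) => /=; first by rewrite (hom_gs hp).
  by rewrite (hom_gr hp).
apply/funext => j /=; rewrite /face_fun; case: ifP => // _; case: ifP => // _.
by have [] := hp (@nerve_comp _ _ _ g (widen_ord (leqnSn m.+1) j) (lift ord0 j) erefl).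
Qed.

Lemma nerve_map_range n (g : nerve G n) :
  nerve_range (nerve_map hp n g) = nerve_map hp 0 (nerve_range g).
Proof. by case: n g => [//|m] g; apply: val_inj; rewrite /= (hom_gr hp). Qed.

Lemma nerve0_unit (u : nerve G 0) : gunits G (val u).
Proof. exact: set_mem (valP u). Qed.

(** The entries are lifted one after another: the range of each lift has to be the source of the
    lift before it, and [range_lift] provides it. *)
Lemma nerve_range_lift n (u : nerve G 0) (g' : nerve G' n) :
  nerve_range g' = nerve_map hp 0 u ->
  exists2 g : nerve G n, nerve_range g = u & nerve_map hp n g = g'.
Proof.
case: n g' => [|n] g'; first by move=> ge; exists u; [by []|exact: esym ge].
elim: n u g' => [|m IH] u g' gu.
  have gu' : gr G' (val g' ord0) = p (val u) by exact: (congr1 val gu).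
  have [x xu px] := range_lift (nerve0_unit u) gu'.
  have c1 : (fun=> x) \in composable G 1 by apply: mem_set => i j; rewrite !ord1.
  exists (mk_nerve c1); first exact: val_inj.
  by apply: val_inj; apply/funext => j /=; rewrite ord1.
have gu' : nerve_range (face ord_max g' : nerve G' m.+1) = nerve_map hp 0 u.
  by rewrite -gu nerve_range_face.
have [h hu hg] := IH _ _ gu'.
have hl : p (val h ord_max) = val g' (widen_ord (leqnSn m.+1) ord_max).
  by rewrite -face_lastE -hg.
have cg : gcomp G' (val g' (widen_ord (leqnSn m.+1) ord_max)) (val g' ord_max).
  exact: nerve_comp.
have [||x xu px] := @range_lift (gs G (val h ord_max)) (val g' ord_max).
- exact: set_mem (gunits_s _ _).
- by rewrite (hom_gs hp) hl; exact/esym/cg.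
have hx : gcomp G (val h ord_max) x by rewrite /gcomp; exact/esym/xu.
exists (mk_nerve (ext_last_composable hx)).
  rewrite -hu; apply: val_inj => /=; congr (gr G _).
  by rewrite /ext_last /=; congr (sval h _); apply: val_inj; rewrite /= inordK.
apply: val_inj; apply/funext => j /=; rewrite /ext_last.
case: ltnP => jm.
  have -> : j = widen_ord (leqnSn m.+1) (Ordinal jm) by exact: val_inj.
  rewrite -face_lastE -hg /=; congr (p (sval h _)).
  by apply: val_inj; rewrite /= inordK.
rewrite px; congr (val g' _).
by apply: val_inj; apply/eqP; rewrite eqn_leq jm /= -ltnS ltn_ord.
Qed.

Lemma nerve_range_lift_unique n (g1 g2 : nerve G n) :
  nerve_range g1 = nerve_range g2 -> nerve_map hp n g1 = nerve_map hp n g2 ->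
  g1 = g2.
Proof.
case: n g1 g2 => [//|n] g1 g2.
elim: n g1 g2 => [|m IH] g1 g2 r12 p12.
  have pE j : p (val g1 j) = p (val g2 j) by have := congr1 (fun g => val g j) p12.
  apply: val_inj; apply/funext => j; rewrite ord1; apply: range_lift_unique => //.
  exact: (congr1 val r12).
have pE j : p (val g1 j) = p (val g2 j) by have := congr1 (fun g => val g j) p12.
have f12 : (face ord_max g1 : nerve G m.+1) = face ord_max g2.
  apply: IH; first by rewrite !nerve_range_face.
  by rewrite -!nerve_map_face p12.
have fE j : val g1 (widen_ord (leqnSn m.+1) j) = val g2 (widen_ord (leqnSn m.+1) j).
  by rewrite -!face_lastE f12.
apply: val_inj; apply/funext => j; have [jm|jm] := ltnP j m.+1.
  by have -> : j = widen_ord (leqnSn m.+1) (Ordinal jm) by exact: val_inj.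
have -> : j = ord_max.
  by apply: val_inj; apply/eqP; rewrite eqn_leq jm andbT -ltnS ltn_ord.
apply: range_lift_unique => //.
have c1 := @nerve_comp _ _ _ g1 (widen_ord (leqnSn m.+1) ord_max) ord_max erefl.
have c2 := @nerve_comp _ _ _ g2 (widen_ord (leqnSn m.+1) ord_max) ord_max erefl.
by rewrite -c1 -c2 fE.
Qed.

(** A lift of a tuple is determined by its range. All faces but the zeroth keep the range; for the
    zeroth, the first entry is lifted along its source, and the range of this lift is used. *)
Lemma face_lift n (i : 'I_n.+2) (h : nerve G n) (g' : nerve G' n.+1) :
  face i g' = nerve_map hp n h ->
  exists2 g : nerve G n.+1, face i g = h & nerve_map hp n.+1 g = g'.
Proof.
move=> gh; have [i0|i0] := eqVneq i ord0; last first.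
  have gu : nerve_range g' = nerve_map hp 0 (nerve_range h).
    by rewrite -(nerve_range_faceN0 g' i0) gh nerve_map_range.
  have [g gr pg] := nerve_range_lift gu; exists g => //.
  apply: nerve_range_lift_unique; first by rewrite nerve_range_faceN0.
  by rewrite -nerve_map_face pg.
subst i.
have su : gs G' (val g' ord0) = p (val (nerve_range h)).
  by rewrite -nerve_range_face0 gh nerve_map_range.
have [x xs px] := source_lift (nerve0_unit _) su.
have gu : nerve_range g' = nerve_map hp 0 (gr_unit G x).
  by apply: val_inj; rewrite /= (hom_gr hp) px.
have [g gr pg] := nerve_range_lift gu; exists g => //.
apply: nerve_range_lift_unique; last by rewrite -nerve_map_face pg.
apply: val_inj; rewrite nerve_range_face0 -xs; congr (gs G _).
apply: range_lift_unique; first exact: (congr1 val gr).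
by rewrite px -pg.
Qed.

Lemma face_lift_unique n (i : 'I_n.+2) (g1 g2 : nerve G n.+1) :
  face i g1 = face i g2 :> nerve G n -> nerve_map hp n.+1 g1 = nerve_map hp n.+1 g2 ->
  g1 = g2.
Proof.
move=> f12 p12; apply: nerve_range_lift_unique => //.
have [i0|i0] := eqVneq i ord0; last first.
  by rewrite -(nerve_range_faceN0 g1 i0) -(nerve_range_faceN0 g2 i0) f12.
subst i; apply: val_inj => /=; congr (gr G _); apply: source_lift_unique.
  by rewrite -!nerve_range_face0 f12.
exact: (congr1 (fun g => val g ord0) p12).
Qed.

Lemma face_pushforward (A : zmodType) n (i : 'I_n.+2) (f : nerve G' n.+1 -> A)
    (h : nerve G n) :
  pushforward (@face _ G n i) (f \o nerve_map hp n.+1) h =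
  pushforward (@face _ G' n i) f (nerve_map hp n h).
Proof.
apply: pushforward_square.
- by move=> g; exact: nerve_map_face.
- by move=> g'; exact: face_lift.
- by move=> g1 g2 g1h g2h; apply: (@face_lift_unique _ i); rewrite g1h g2h.
Qed.

Lemma nerve_map_surj n : set_surj [set: T] [set: T'] p ->
  set_surj [set: nerve G n] [set: nerve G' n] (nerve_map hp n).
Proof.
move=> sp; have s0 (u' : nerve G' 0) : exists u, nerve_map hp 0 u = u'.
  have [x _ px] := sp (val u') Logic.I; exists (gr_unit G x); apply: val_inj.
  by rewrite /= (hom_gr hp) px gr_id //; exact: set_mem (valP u').
move=> g' _; have [u uE] := s0 (nerve_range g').
by have [g _ <-] := nerve_range_lift (esym uE); exists g.
Qed.

End Cartesian.

Section NerveMapTopology.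
Variables (T T' : topologicalType) (G : groupoid T) (G' : groupoid T').
Variables (p : T -> T') (hp : is_hom G G' p).
Hypothesis cp : continuous p.

Lemma nerve_map_continuous n : continuous (nerve_map hp n).
Proof.
case: n => [|m] g.
  apply/(@cvg_valP _ _ _ (nbhs g) (nbhs_filter g)).
  exact: (cvg_comp _ _ (@val_continuous _ _ g) (@cp (val g))).
apply: nerveS_cvg_at => j.
exact: (cvg_comp _ _ (@coord_continuous _ G _ j g) (@cp (val g j))).
Qed.

(** Each entry has an ultrafilter limit. Being a unit and being composable are closed conditions in
    a Hausdorff groupoid, so the limits form a point of the nerve. *)
Lemma nerve_map_uproper n : etale G -> uproper p -> uproper (nerve_map hp n).
Proof.
move=> eG up F; case: n F => [|m] F g' UF qF.
  have qF' : p @ ((val : nerve G 0 -> T) @ F) --> val g'.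
    exact: (cvg_comp _ _ qF (@val_continuous _ _ g')).
  have [x Fx] := up _ _ (ultra_fmap _ UF) qF'.
  have Gx : gunits G x.
    apply/gunitsE; have := cvg_comp _ _ Fx (@gr_continuous _ _ eG x).
    move=> Frx; apply: (cvg_unique2 (etale_hausdorff eG) _ Fx).
    rewrite (_ : (fun i => val i) @ F = gr G @ ((val : nerve G 0 -> T) @ F)) //.
    apply/funext => B; rewrite /fmap /=; congr F; apply/funext => u.
    by rewrite /preimage /= gr_id //; exact: set_mem (valP u).
  exists (exist _ x (mem_set Gx)); apply/(@cvg_valP _ _ _ F _ id).
  exact: Fx.
have qFj j : p @ ((fun g : nerve G m.+1 => val g j) @ F) --> val g' j.
  exact: (cvg_comp _ _ qF (@coord_continuous _ G' _ j g')).
have [x Fx] := choice (fun j => up _ _ (ultra_fmap _ UF) (qFj j)).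
have cx : x \in composable G m.+1.
  apply: mem_set => i j ij; apply: (gcomp_closed eG (Fx i) (Fx j)).
  by apply: nearW => g; exact: nerve_comp.
by exists (mk_nerve cx); apply/(@nerveS_cvgP _ _ _ _ F _ id).
Qed.

End NerveMapTopology.

Section CcDescent.
Variables (Y Y' : topologicalType) (A : zmodType) (q : Y -> Y').
Hypotheses (hY' : hausdorff_space Y') (cq : continuous q) (uq : uproper q).

Lemma pull_Cc (f : Cc Y' A) : (f \o q) \in @is_Cc Y A.
Proof.
apply/is_CcP; split.
  by move=> y; exact: (@cq y _ (@Cc_loc_const _ _ f (q y))).
exact: (uproper_proper hY' cq uq (@Cc_compact _ _ f)).
Qed.

Definition pull_fun (f : Cc Y' A) : Cc Y A := MkCc (pull_Cc f).

Lemma pull_is_zmod_morphism : zmod_morphism pull_fun.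
Proof.
by move=> f g; apply: Cc_ext => y; rewrite [RHS]CcB; exact: (CcB f g (q y)).
Qed.

Definition pull : {additive Cc Y' A -> Cc Y A} :=
  HB.pack pull_fun (GRing.isZmodMorphism.Build _ _ pull_fun pull_is_zmod_morphism).

(** The fibre over [y'] lies in the open set where [f] takes the value [f' y']; closedness of [q]
    puts the nearby fibres there too. *)
Lemma descend_loc_const (f : Y -> A) (f' : Y' -> A) :
  set_surj [set: Y] [set: Y'] q -> loc_const f -> (forall y, f y = f' (q y)) ->
  loc_const f'.
Proof.
move=> sq lf ff y'.
have oU : open [set y | f y = f' y'].
  by apply: open_nearP => y /= fy; apply: filterS (lf y) => z /= ->.
have fibU : q @^-1` [set y'] `<=` [set y | f y = f' y'] by move=> y /= <-.
have := uproper_closed hY' cq uq oU fibU; apply: filterS => z' fz.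
by have [y _ qy] := sq z' Logic.I; rewrite -(fz y qy) -qy -ff.
Qed.

Lemma descend_Cc (f : Cc Y A) : set_surj [set: Y] [set: Y'] q ->
  (forall y z, q y = q z -> f y = f z) ->
  exists f' : Cc Y' A, forall y, f y = f' (q y).
Proof.
move=> sq ff; have [s sP] : {s : Y' -> Y & forall y', q (s y') = y'}.
  by apply: (@choice _ _ (fun y' y => q y = y')) => y'; have [y _] := sq y' Logic.I; exists y.
have fE y : f y = (f \o s) (q y) by apply: ff; rewrite sP.
suff F : (f \o s) \in @is_Cc Y' A by exists (MkCc F).
apply: (@is_Cc_sub _ _ _ (q @` [set y | f y != 0])).
- exact: descend_loc_const sq (@Cc_loc_const _ _ f) fE.
- by apply: continuous_compact; [exact: continuous_subspaceT|exact: Cc_compact].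
- by move=> y' /= fy; exists (s y').
Qed.

End CcDescent.

Section PullbackComplex.
Variables (T T' : topologicalType) (G : groupoid T) (G' : groupoid T').
Variables (p : T -> T') (hp : is_hom G G' p) (hb : fibre_bijective G G' p).
Hypotheses (eG : etale G) (eG' : etale G').
Hypotheses (cp : continuous p) (up : uproper p).
Variable A : zmodType.

Let hN' n : hausdorff_space (nerve G' n).
Proof. exact: nerve_hausdorff (etale_hausdorff eG'). Qed.

Definition nerve_pull n : {additive Cc (nerve G' n) A -> Cc (nerve G n) A} :=
  pull A (@hN' n) (@nerve_map_continuous _ _ _ _ _ hp cp n)
    (@nerve_map_uproper _ _ _ _ _ hp n eG up).

Lemma nerve_pull_bd n (f : Cc (nerve G' n.+1) A) :
  nerve_pull n (bd (nerve_complex A eG') n f) =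
  bd (nerve_complex A eG) n (nerve_pull n.+1 f).
Proof.
apply: Cc_ext => g.
transitivity (nerve_bd A eG' n f (nerve_map hp n g)); first by [].
rewrite nerve_bdE [RHS]nerve_bdE; apply: eq_bigr => i _; congr (_ *~ _).
by rewrite -face_pushforward.
Qed.

Definition pullback_map : chainMap (nerve_complex A eG') (nerve_complex A eG) :=
  @ChainMap (nerve_complex A eG') (nerve_complex A eG) nerve_pull nerve_pull_bd.

Lemma pullback_mapP : is_pullback hp pullback_map.
Proof. by []. Qed.

Lemma pullback_map_inj : set_surj [set: T] [set: T'] p ->
  forall n, injective (pullback_map n).
Proof.
move=> sp n f g fg; apply: Cc_ext => g'.
have [h _ <-] := nerve_map_surj hp hb sp (n := n) (t := g') Logic.I.
exact: (congr1 (fun k : Cc (nerve G n) A => k h) fg).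
Qed.

End PullbackComplex.

(** * Etaleness of the groupoids of multiple fibres *)

Lemma fcvg_near (Y : topologicalType) (Y' I : Type) (q : Y -> Y')
    (F : set_system I) {FF : Filter F} (a b : I -> Y') y' :
  (\forall i \near F, a i = b i) -> fcvg q (a @ F) y' -> fcvg q (b @ F) y'.
Proof.
move=> ab fa W oW Wy; apply: (near_fmap (@filterI _ F _ _ _ ab (fa W oW Wy))).
by move=> i [<-].
Qed.

Lemma cvg_near_eq (Y : topologicalType) (I : Type)
    (F : set_system I) {FF : Filter F} (a b : I -> Y) (y : Y) :
  (\forall i \near F, a i = b i) -> a @ F --> y -> b @ F --> y.
Proof.
move=> ab ay N yN; apply: (near_fmap (@filterI _ F _ _ _ ab (ay N yN))).
by move=> i [<-].
Qed.

(** Being a subbasis is expressed by convergence of filters; the finite intersections [V s] form the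
    countable base. *)
Lemma subbasis_second_countable (I : countType) (Y : topologicalType)
    (U : I -> set Y) : (forall i, open (U i)) ->
  (forall (y : Y) (F : set_system Y), Filter F ->
    (forall i, U i y -> F (U i)) -> F --> y) ->
  @second_countable Y.
Proof.
move=> oU UF; pose V (s : seq I) := foldr (fun i W => U i `&` W) setT s.
have oV s : open (V s) by elim: s => [|i s IH]; [exact: openT|exact: openI].
have VI s t : V (s ++ t) = V s `&` V t.
  by elim: s => [|i s IH]; rewrite /= ?setTI // IH setIA.
exists (range V); first by apply: card_le_trans (card_image_le _ _) _; exact: countableP.
split=> [_ [s _ <-] //|y].
apply: UF; first apply: filter_from_filter.
- by exists setT; split=> //; exists [::].
- move=> _ _ [[s _ <-] Vs] [[t _ <-] Vt]; exists (V s `&` V t) => //; split=> //.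
  by exists (s ++ t).
- move=> i Uy; exists (U i) => //; split=> //; exists [:: i] => //=.
  by rewrite setIT.
Qed.

Lemma second_countable_seq (Y : topologicalType) : @second_countable Y ->
  exists U : nat -> set Y, (forall n, open (U n)) /\
    forall y W, nbhs y W -> exists n, U n y /\ U n `<=` W.
Proof.
move=> [B /countable_injP[f fI] [oB By]].
pose U n := xget setT [set W | B W /\ f W = n].
have UB W : B W -> U (f W) = W.
  move=> BW; have : [set W' | B W' /\ f W' = f W] (U (f W)) by apply: (@xgetPex _ setT); exists W.
  by move=> [BU fU]; apply: fI; rewrite ?inE.
exists U; split=> [n|y W yW].
  rewrite /U; case: xgetP => [W _ [/oB]//|_]; exact: openT.
have [W' [BW' W'y] WW] := By y W yW.
by exists (f W'); rewrite UB.
Qed.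

Lemma compact_open_clopen (Y : topologicalType) (V : set Y) :
  hausdorff_space Y -> open V -> compact V -> clopen V.
Proof. by move=> hY oV cV; split=> //; exact: compact_closed. Qed.

Lemma if_loc_const (Y : topologicalType) (A : zmodType) (V : set Y)
    (f g : Y -> A) : clopen V -> loc_const f -> loc_const g ->
  loc_const (fun y => if `[< V y >] then f y else g y).
Proof.
move=> [oV clV] lf lg x; have [Vx|nVx] := pselect (V x).
  have nV : nbhs x V by exact: open_nbhs_nbhs.
  apply: (@filterS _ (nbhs x) _ _ _ _ (@filterI _ (nbhs x) _ _ _ nV (lf x))).
  by move=> y [Vy fy]; rewrite !asboolT.
have nV : nbhs x (~` V) by apply: open_nbhs_nbhs; split=> //; exact: closed_openC.
apply: (@filterS _ (nbhs x) _ _ _ _ (@filterI _ (nbhs x) _ _ _ nV (lg x))).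
by move=> y [Vy gy]; rewrite !asboolF.
Qed.

Lemma if_Cc (Y : topologicalType) (A : zmodType) (V : set Y) (f g : Cc Y A) :
  clopen V -> (fun y => if `[< V y >] then f y else g y) \in @is_Cc Y A.
Proof.
move=> cV; apply: is_Cc_sub.
- exact: if_loc_const cV (@Cc_loc_const _ _ f) (@Cc_loc_const _ _ g).
- exact: (compactU (@Cc_compact _ _ f) (@Cc_compact _ _ g)).
- by move=> y; case: ifP => _; [left|right].
Qed.

Lemma cst_Cc (Y : topologicalType) (A : zmodType) (V : set Y) (c : A) :
  hausdorff_space Y -> open V -> compact V ->
  (fun y => if `[< V y >] then c else 0) \in @is_Cc Y A.
Proof.
move=> hY oV cV; apply: (@is_Cc_sub _ _ _ V) => //; last first.
  by move=> x; case: asboolP; rewrite ?eqxx.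
by apply: if_loc_const; [exact: compact_open_clopen|exact: loc_const_cst|exact: loc_const_cst].
Qed.

Section NonConstant.
Variables (R : realType) (Y Y' : topologicalType) (d : Y -> Y -> R).
Variable q : Y -> Y'.
Hypotheses (cd : compat_dist d) (hY : hausdorff_space Y) (hY' : hausdorff_space Y').
Hypotheses (cq : continuous q) (sq : set_surj [set: Y] [set: Y'] q).
Hypotheses (uq : uproper q) (rq : reg_map q).

(** The multiple fibres that prevent [f] from descending; [reduction_exists] takes this set as the
    threshold for truncations. *)
Definition nonconst (A : Type) (f : Y -> A) : set (bpi d q) :=
  [set y' | exists a b, [/\ q a = bpi_val y', q b = bpi_val y' & f a <> f b]].

(** Fibres near [y'] in the fine topology meet the open level sets of [f] through [a] and [b]. *)
Lemma nonconst_open (A : zmodType) (f : Y -> A) : loc_const f -> open (nonconst f).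
Proof.
move=> lf; apply: open_nearP => y' [a [b [qa qb fab]]].
have H c (qc : q c = bpi_val y') :
    nbhs y' [set z' : bpi d q | (q @` [set x | f x = f c]) (bpi_val z')].
  apply: open_nbhs_nbhs; split; last by exists c.
  apply: (bpi_openW cd hY' cq sq uq); apply: open_nearP => x /= fx.
  by apply: filterS (lf x) => z /= ->.
apply: (@filterS _ (nbhs y') _ _ _ _ (@filterI _ (nbhs y') _ _ _ (H a qa) (H b qb))).
move=> z' [[a' fa' qa'] [b' fb' qb']]; exists a', b'; split=> //.
by rewrite fa' fb'.
Qed.

(** In each fibre two points with different values of [f] are chosen, the first in the support.
    Along an ultrafilter the first converges by compactness of the support, the second by
    properness; the limits keep different values, and [reg_fcvg] gives fine convergence. *)
Lemma nonconst_compact (A : zmodType) (f : Cc Y A) : compact (nonconst f).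
Proof.
apply: ultraP_compact => F UF FK.
have [y0' [a0 _]] := filter_ex FK.
have [ab abP] : {ab : bpi d q -> Y * Y & forall y', nonconst f y' ->
    [/\ q (ab y').1 = bpi_val y', q (ab y').2 = bpi_val y' &
        f (ab y').1 != 0 /\ f (ab y').1 <> f (ab y').2]}.
  apply: (@choice _ _ (fun y' z => nonconst f y' -> [/\ q z.1 = bpi_val y',
    q z.2 = bpi_val y' & f z.1 != 0 /\ f z.1 <> f z.2])) => y'.
  have [[a [b [qa qb fab]]]|] := pselect (nonconst f y'); last by exists (a0, a0).
  (* Two different values are not both 0, so a swap makes the first one nonzero. *)
  have [fa|fa] := eqVneq (f a) 0; last by exists (a, b).
  by exists (b, a) => _ /=; split=> //; rewrite -fa; split; [apply/eqP; exact/nesym|exact/nesym].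
have cf := @Cc_compact _ _ f.
have [|a _ aF] := compact_ultraP cf (ultra_fmap (fst \o ab) UF).
  by apply: (near_fmap FK) => y' /abP[_ _ []].
have aqF : (fun y' => q (ab y').1) @ F --> q a by exact: (cvg_comp _ _ aF (@cq a)).
have bqF : q @ ((snd \o ab) @ F) --> q a.
  apply: (@cvg_near_eq _ _ F _ (fun y' => q (ab y').1)) aqF.
  by apply: filterS FK => y' /abP[-> ->].
have [b bF] := uq (ultra_fmap (snd \o ab) UF) bqF.
have qab : q a = q b by apply: (cvg_unique2 hY' bqF); exact: (cvg_comp _ _ bF (@cq b)).
have fab : f a <> f b.
  have na : F [set y' | f (ab y').1 = f a] := aF _ (@Cc_loc_const _ _ f a).
  have nb : F [set y' | f (ab y').2 = f b] := bF _ (@Cc_loc_const _ _ f b).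
  have [y' [[fa fb] /abP[_ _ [_ ne]]]] := filter_ex (filterI (filterI na nb) FK).
  by move=> e; apply: ne; rewrite fa fb.
have mq : q a \in multiple_fibre q.
  by apply: mem_set; exists a, b; split=> // e; apply: fab; rewrite e.
exists (exist _ (q a) mq); first by exists a, b.
apply/(@bpi_cvgP _ _ _ _ _ cd hY' cq sq uq _ F id).
apply: (@fcvg_near _ _ _ _ F _ (fun y' => q (ab y').1)).
  by apply: filterS FK => y' /abP[-> _].
apply: (reg_fcvg rq aF bF) => //; first by move=> e; apply: fab; rewrite e.
by apply: filterS FK => y' /abP[-> ->].
Qed.

(** Two points [a] and [b] of the fibre are separated by a compact open [V]; the fibres on which the
    indicator function of [V] is not constant form a compact open neighbourhood. *)
Lemma bpi_compact_nbhs : zdim Y -> forall y' : bpi d q,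
  exists2 K, nbhs y' K & compact K.
Proof.
move=> zY y'; have /set_mem [a [b [ab qa qb]]] := valP y'.
have [U [W [oU oW Ua Wb UW]]] := hausdorff_sep hY ab.
have [V [oV cV Va VU]] : exists V, [/\ open V, compact V, V a & V `<=` U].
  by apply: zY; exact: open_nbhs_nbhs.
pose f := MkCc (cst_Cc (1 : int) hY oV cV).
exists (nonconst f); last exact: nonconst_compact.
apply: open_nbhs_nbhs; split; first exact: nonconst_open (@Cc_loc_const _ _ f).
exists a, b; split=> //=; rewrite asboolT // asboolF // => Vb.
by have : set0 b by rewrite -UW; split=> //; exact: VU.
Qed.

Lemma bpi_locally_compact : zdim Y -> locally_compact [set: bpi d q].
Proof.
move=> zY; apply: zdim_locally_compact (bpi_compact_nbhs zY).
exact: (bpi_hausdorff cd hY' cq sq uq).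
Qed.

Lemma pi_restr_proper : proper_map (@pi_restr R Y d Y' q).
Proof.
apply: uproper_proper.
- exact: (bpi_hausdorff cd hY' cq sq uq).
- exact: (pi_restr_continuous cd).
- exact: (pi_restr_uproper cd hY' cq sq uq).
Qed.

Lemma tpi_locally_compact : zdim Y -> locally_compact [set: tpi d q].
Proof.
move=> zY; apply: zdim_locally_compact.
  exact: (tpi_hausdorff cd hY).
move=> x; have [K yK cK] := bpi_compact_nbhs zY (pi_restr x).
exists (@pi_restr R Y d Y' q @^-1` K); last exact: pi_restr_proper.
exact: (pi_restr_continuous cd) yK.
Qed.

Lemma bpi_second_countable : @second_countable Y -> @second_countable (bpi d q).
Proof.
move=> /second_countable_seq[U [oU UP]].
apply: (@subbasis_second_countable nat _
  (fun n => [set y' : bpi d q | (q @` U n) (bpi_val y')])).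
- by move=> n; exact: (bpi_openW cd hY' cq sq uq).
- move=> y' F FF UF; apply/(@bpi_cvgP _ _ _ _ _ cd hY' cq sq uq _ F id).
  move=> W oW [w Ww qw]; have [n [Unw UnW]] := UP w W (open_nbhs_nbhs (conj oW Ww)).
  have Un : (q @` U n) (bpi_val y') by exists w.
  by apply: (near_fmap (UF n Un)) => z' [t Ut <-]; exists t => //; exact: UnW.
Qed.

Lemma tpi_second_countable : @second_countable Y -> @second_countable (tpi d q).
Proof.
move=> /second_countable_seq[U [oU UP]].
apply: (@subbasis_second_countable (bool * nat)%type _
  (fun bn => if bn.1 then @tpi_val R Y d Y' q @^-1` U bn.2
             else @pi_restr R Y d Y' q @^-1` [set y' : bpi d q | (q @` U bn.2) (bpi_val y')])).
- move=> [[] n] /=.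
    by move/continuousP: (tpi_val_continuous cd (q := q)); exact.
  move/continuousP: (pi_restr_continuous cd (q := q)); apply.
  exact: (bpi_openW cd hY' cq sq uq).
- move=> x F FF UF; apply/(@tpi_cvgP _ _ _ _ _ cd hY' cq sq uq _ F id); split.
    apply: cvg_openP => W oW Wx.
    have [n [Unx UnW]] := UP _ W (open_nbhs_nbhs (conj oW Wx)).
    by apply: (near_fmap (UF (true, n) Unx)) => z /UnW.
  move=> W oW [w Ww qw]; have [n [Unw UnW]] := UP w W (open_nbhs_nbhs (conj oW Ww)).
  have Un : (q @` U n) (q (tpi_val x)) by exists w.
  by apply: (near_fmap (UF (false, n) Un)) => z' [t Ut qt]; exists t => //; exact: UnW.
Qed.

End NonConstant.

(* H stands for G_pi or G'_pi. [S_cvgP] says that its topology is determined by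
   the inclusion [iota] and by the fine topology of the unit space, in which the
   range [th (iota x)] has to converge. *)
Section FineGroupoid.
Variables (T S Z Z' : topologicalType) (G : groupoid T) (H : groupoid S).
Variables (iota : S -> T) (th : T -> Z') (p0 : Z -> Z').
Hypotheses (eG : etale G) (hi : is_hom H G iota) (bi : fibre_bijective H G iota).
Hypothesis iotaI : injective iota.
Hypothesis th_gr : forall g, th (gr G g) = th g.
Hypothesis S_cvgP : forall (I : Type) (F : set_system I) (f : I -> S) (x : S),
  Filter F -> f @ F --> x <-> (iota \o f) @ F --> iota x /\
    fcvg p0 ((th \o iota \o f) @ F) (th (iota x)).
Hypothesis S_cvg_inv : forall (I : Type) (F : set_system I) (f : I -> S) (x : S),
  Filter F -> f @ F --> x ->
    fcvg p0 ((th \o ginv G \o iota \o f) @ F) (th (ginv G (iota x))).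

Let iota_cont : continuous iota.
Proof.
move=> x; have FF := nbhs_filter x.
by have [] := (@S_cvgP _ (nbhs x) id x FF).1 (@cvg_id _ _).
Qed.

Let th_cvg (x : S) : fcvg p0 ((th \o iota) @ x) (th (iota x)).
Proof.
have FF := nbhs_filter x.
by have [] := (@S_cvgP _ (nbhs x) id x FF).1 (@cvg_id _ _).
Qed.

Lemma fine_ginv_continuous : continuous (ginv H).
Proof.
move=> x; have FF := nbhs_filter x; apply/(@S_cvgP _ (nbhs x) (ginv H) _ FF); split.
  rewrite (_ : iota \o ginv H = ginv G \o iota); last first.
    by apply/funext => g /=; rewrite (hom_inv hi).
  rewrite (hom_inv hi).
  exact: (cvg_comp _ _ (@iota_cont x) (@ginv_continuous _ _ eG (iota x))).
rewrite (_ : th \o iota \o ginv H = th \o ginv G \o iota \o id); last first.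
  by apply/funext => g /=; rewrite (hom_inv hi).
by rewrite (hom_inv hi); apply: S_cvg_inv => //; exact: cvg_id.
Qed.

(** A product has the range of its first factor, so its [th] component converges with that factor;
    the rest is continuity of multiplication in [G]. *)
Lemma fine_topological_groupoid : topological_groupoid H.
Proof.
split; first exact: fine_ginv_continuous.
apply/subspace_continuousP => -[a b] /= ab.
set D := [set gh : S * S | _]; pose F := within D (nbhs (a, b)).
have FF : Filter F by exact: within_filter.
have aF : (fun z : S * S => z.1) @ F --> a by apply: cvg_within_filter; exact: cvg_fst.
have bF : (fun z : S * S => z.2) @ F --> b by apply: cvg_within_filter; exact: cvg_snd.
have DF : \forall z \near F, gcomp H z.1 z.2.
  by rewrite /prop_near1 /F /within /=; exact: nearW.
have [_ mab] := hi ab.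
apply/(@S_cvgP _ F (fun gh : S * S => gmul H gh.1 gh.2) _ FF); split.
  apply: (@cvg_near_eq _ _ F _ (fun z : S * S => gmul G (iota z.1) (iota z.2))).
    by apply: filterS DF => z /hi[_].
  rewrite mab; apply: (gmul_cvg eG).
  - exact: (cvg_comp _ _ aF (@iota_cont a)).
  - exact: (cvg_comp _ _ bF (@iota_cont b)).
  - by apply: filterS DF => z /hi[].
  - by have [] := hi ab.
have thM g h : gcomp H g h -> th (iota (gmul H g h)) = th (iota g).
  by move=> gh; rewrite -th_gr -(hom_gr hi) gr_mul // (hom_gr hi) th_gr.
rewrite /= (thM _ _ ab).
apply: (@fcvg_near _ _ _ _ F _ (fun z : S * S => th (iota z.1))).
  by apply: filterS DF => z /thM /= ->.
by have [] := (@S_cvgP _ F (fun z : S * S => z.1) a FF).1 aF.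
Qed.

Lemma fine_range_local_homeo : local_homeo (gr_unit H).
Proof.
apply: local_homeoI.
- move=> x; have FF := nbhs_filter x; apply/(@cvg_valP _ _ _ (nbhs x)).
  apply/(@S_cvgP _ (nbhs x) (gr H) _ FF); split.
    rewrite (_ : iota \o gr H = gr G \o iota); last first.
      by apply/funext => g /=; rewrite (hom_gr hi).
    rewrite (hom_gr hi).
    exact: (cvg_comp _ _ (@iota_cont x) (@gr_continuous _ _ eG (iota x))).
  rewrite (_ : th \o iota \o gr H = th \o iota); last first.
    by apply/funext => g /=; rewrite (hom_gr hi) th_gr.
  by rewrite /= (hom_gr hi) th_gr; exact: th_cvg.
- apply: section_open => x.
  have [s0 s0x gs0] := local_homeo_section (gr_unit_local_homeo eG) (iota x).
  have iu (u : gunits H) : gr G (iota (val u)) = iota (val u).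
    by rewrite -(hom_gr hi) gr_id //; exact: set_mem (valP u).
  pose ju (u : gunits H) := gr_unit G (iota (val u)).
  (* The local section [s0] of the range map of [G], lifted to [H] by fibre bijectivity of
     [iota]. *)
  have [s sP] : {s : gunits H -> S & forall u, gr_unit G (s0 (ju u)) = ju u ->
      gr H (s u) = val u /\ iota (s u) = s0 (ju u)}.
    apply: (@choice _ _ (fun u h => gr_unit G (s0 (ju u)) = ju u ->
      gr H h = val u /\ iota h = s0 (ju u))) => u.
    have [e|] := pselect (gr_unit G (s0 (ju u)) = ju u); last by exists x.
    have Hu : gunits H (val u) by exact: set_mem (valP u).
    have e' : gr G (s0 (ju u)) = iota (val u) by have := congr1 val e; rewrite /= iu.
    by have [h hu ih] := range_lift bi Hu e'; exists h.
  set u0 := gr_unit H x; have FF := nbhs_filter u0.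
  have vu : (fun u : gunits H => val u) @ u0 --> gr H x by exact: (@val_continuous _ _ u0).
  have [ivu tvu] := (@S_cvgP _ (nbhs u0) (fun u => val u) (gr H x) FF).1 vu.
  have ju0 : ju u0 = gr_unit G (iota x) by apply: val_inj; rewrite /= (hom_gr hi) gr_gr.
  have jcv : ju @ u0 --> gr_unit G (iota x).
    rewrite -ju0; exact: (cvg_comp _ _ ivu
      (local_homeo_continuous (gr_unit_local_homeo eG) (x := iota (gr H x)))).
  have nj : \forall u \near u0, gr_unit G (s0 (ju u)) = ju u by exact: jcv gs0.
  exists s; last by apply: filterS nj => u /sP[gsu _]; exact: val_inj.
  apply/(@S_cvgP _ (nbhs u0) s x FF); split.
    apply: (@cvg_near_eq _ _ (nbhs u0) _ (s0 \o ju)).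
      by apply: filterS nj => u /sP[_ e] /=; rewrite e.
    exact: (cvg_comp _ _ jcv s0x).
  rewrite -th_gr -(hom_gr hi).
  apply: (@fcvg_near _ _ _ _ (nbhs u0) _ (fun u : gunits H => th (iota (val u)))) => //.
  by apply: filterS nj => u /sP[e _] /=; rewrite -e (hom_gr hi) th_gr.
- move=> x; have [U [oU Ux iU]] := local_homeo_inj (gr_unit_local_homeo eG) (iota x).
  exists (iota @^-1` U); split=> //; first by move/continuousP: iota_cont; exact.
  move=> g h /set_mem Ug /set_mem Uh gh; apply: iotaI; apply: iU; rewrite ?inE //.
  by apply: val_inj; have := congr1 (iota \o val) gh; rewrite /= !(hom_gr hi).
Qed.

Let nth (n : nat) (g : nerve G n) : Z' := th (val (nerve_range g)).

(** Fine convergence of the first entry propagates along the tuple: the range of an entry is the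
    source of the one before it, which [S_cvg_inv] controls. *)
Lemma fine_nerve_cvgP n (I : Type) (F : set_system I) (f : I -> nerve H n)
    (x : nerve H n) : Filter F ->
  f @ F --> x <-> (nerve_map hi n \o f) @ F --> nerve_map hi n x /\
    fcvg p0 ((@nth n \o nerve_map hi n \o f) @ F) (nth (nerve_map hi n x)).
Proof.
move=> FF; case: n f x => [|m] f x.
  rewrite (@cvg_valP _ _ _ F FF f x) (@S_cvgP _ F (fun i => val (f i)) (val x) FF).
  by rewrite (@cvg_valP _ _ _ F FF (nerve_map hi 0 \o f) (nerve_map hi 0 x)).
rewrite (@nerveS_cvgP _ _ _ _ F FF f x).
rewrite (@nerveS_cvgP _ _ _ _ F FF (nerve_map hi m.+1 \o f) (nerve_map hi m.+1 x)).
have nthE (g : nerve H m.+1) : nth (nerve_map hi m.+1 g) = th (iota (val g ord0)).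
  by rewrite /nth /= th_gr.
have coordP j := @S_cvgP _ F (fun i => val (f i) j) (val x j) FF.
rewrite nthE (_ : @nth m.+1 \o nerve_map hi m.+1 \o f =
    fun i => th (iota (val (f i) ord0))); last by apply/funext => i; exact: nthE.
split=> [fx|[fx f0] j].
  by split=> [j|]; [have [] := (coordP j).1 (fx j)|have [] := (coordP ord0).1 (fx ord0)].
case: j => j; elim: j => [|j IH] jm; apply/coordP; split; try exact: fx.
  by rewrite (_ : Ordinal jm = ord0) //; exact: val_inj.
have jm' : (j < m.+1)%N by exact: ltnW.
have := S_cvg_inv FF (IH jm').
have thE (g : nerve H m.+1) :
    th (ginv G (iota (val g (Ordinal jm')))) = th (iota (val g (Ordinal jm))).
  have [c _] := hi (@nerve_comp _ _ _ g (Ordinal jm') (Ordinal jm) erefl).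
  by rewrite -th_gr gr_inv c th_gr.
rewrite thE; apply: (@fcvg_near _ _ _ _ F); apply: nearW => i; exact: thE.
Qed.

End FineGroupoid.

Section PiGroupoid.
Variables (R : realType) (T T' : topologicalType) (d : T -> T -> R).
Variables (G : groupoid T) (G' : groupoid T') (p : T -> T').
Hypotheses (hp : is_hom G G' p) (hb : fibre_bijective G G' p).
Hypotheses (cd : compat_dist d) (eG : etale G) (eG' : etale G').
Hypotheses (cp : continuous p) (sp : set_surj [set: T] [set: T'] p).
Hypotheses (up : uproper p).

Let hT := etale_hausdorff eG.
Let hT' := etale_hausdorff eG'.
Let p0 := nerve_map hp 0.
Let Gpi := tgpi d hp hb.
Let G'pi := bgpi d hp hb.

Lemma fcvg_range (F : set_system T') {FF : Filter F} (x' : T') :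
  fcvg p F x' <-> F --> x' /\ fcvg p0 (gr_unit G' @ F) (gr_unit G' x').
Proof.
apply: (@fcvg_square T T' (nerve G 0) (nerve G' 0) p p0 (gr_unit G) (gr_unit G')).
- exact: gr_unit_local_homeo.
- exact: gr_unit_local_homeo.
- exact: cp.
- exact: sp.
- by move=> x; apply: val_inj; rewrite /= (hom_gr hp).
- move=> u g' ug; have gu : gr G' g' = p (val u) by exact: esym (congr1 val ug).
  have [g gE pg] := range_lift hb (nerve0_unit u) gu.
  by exists g => //; exact: val_inj.
Qed.

(** With [fcvg_range]: for a filter converging in [G'], ranges and sources detect the same fine
    convergence. This makes inversion continuous on [G_pi] and [G'_pi]. *)
Lemma fcvg_source (F : set_system T') {FF : Filter F} (x' : T') :
  fcvg p F x' <-> F --> x' /\ fcvg p0 (gs_unit G' @ F) (gs_unit G' x').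
Proof.
apply: (@fcvg_square T T' (nerve G 0) (nerve G' 0) p p0 (gs_unit G) (gs_unit G')).
- exact: gs_unit_local_homeo.
- exact: gs_unit_local_homeo.
- exact: cp.
- exact: sp.
- by move=> x; apply: val_inj; rewrite /= (hom_gs hp).
- move=> u g' ug; have gu : gs G' g' = p (val u) by exact: esym (congr1 val ug).
  have [g gE pg] := source_lift hp hb (nerve0_unit u) gu.
  by exists g => //; exact: val_inj.
Qed.

(** Two points over the range are the ranges of two lifts of [g']. Hence over a unit of [G'_pi] the
    range map has the same fibre in [G'_pi] as in [G']. *)
Lemma multiple_range g' : multiple_fibre p (gr G' g') -> multiple_fibre p g'.
Proof.
move=> [x [y [xy px py]]].
have H z : p z = gr G' g' -> exists2 g, gr G g = gr G z & p g = g'.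
  move=> pz; apply: (range_lift hb); first by exists z.
  by rewrite (hom_gr hp) pz gr_gr.
have [g gx pg] := H _ px; have [h hy ph] := H _ py.
exists g, h; split=> // gh; apply: xy; apply: (range_lift_unique hb).
  by rewrite -gx gh hy.
by rewrite px py.
Qed.

Lemma bpi_val_fibre_bijective : fibre_bijective G'pi G' (@bpi_val R T d T' p).
Proof.
move=> x Gx; split.
- move=> g /= gx; rewrite /preimage /= -gx.
  by rewrite (hom_gr (bpi_val_hom d hp hb)).
- by move=> g h _ _ /val_inj.
- move=> g' /= gx; have mg : multiple_fibre p g'.
    by apply: multiple_range; rewrite gx; exact: set_mem (valP x).
  exists (exist _ g' (mem_set mg)) => //; apply: val_inj.
  by rewrite [LHS](hom_gr (bpi_val_hom d hp hb)).
Qed.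

Lemma tpi_val_fibre_bijective : fibre_bijective Gpi G (@tpi_val R T d T' p).
Proof.
move=> x Gx; split.
- move=> g /= gx; rewrite /preimage /= -gx.
  by rewrite (hom_gr (tpi_val_hom d hp hb)).
- by move=> g h _ _ /val_inj.
- move=> g /= gx; have mg : multiple_fibre p (p g).
    by apply: multiple_range; rewrite -(hom_gr hp) gx; exact: set_mem (valP x).
  have mg' : (p @^-1` multiple_fibre p) g by [].
  exists (exist _ g (mem_set mg')) => //; apply: val_inj.
  by rewrite [LHS](hom_gr (tpi_val_hom d hp hb)).
Qed.

Lemma pi_restr_fibre_bijective : fibre_bijective Gpi G'pi (@pi_restr R T d T' p).
Proof.
move=> x Gx; split.
- move=> g /= gx; rewrite /preimage /= -gx.
  by rewrite (hom_gr (pi_restr_hom d hp hb)).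
- move=> g h /set_mem gx /set_mem hx gh; apply: val_inj.
  apply: (range_lift_unique hb); last exact: (congr1 (@bpi_val R T d T' p) gh).
  have := congr1 (@tpi_val R T d T' p) (etrans gx (esym hx)).
  by rewrite !(hom_gr (tpi_val_hom d hp hb)).
- move=> g' /= gx.
  have gx' : gr G' (bpi_val g') = p (tpi_val x).
    by rewrite -(hom_gr (bpi_val_hom d hp hb)); exact: (congr1 (@bpi_val R T d T' p) gx).
  have Gvx : gunits G (tpi_val x).
    by case: Gx => z _ <-; rewrite (hom_gr (tpi_val_hom d hp hb)); exists (tpi_val z).
  have [g gE pg] := range_lift hb Gvx gx'.
  have mg : (p @^-1` multiple_fibre p) g.
    by rewrite /preimage /= pg; exact: set_mem (valP g').
  exists (exist _ g (mem_set mg)); last exact: val_inj.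
  by apply: val_inj; rewrite [LHS](hom_gr (tpi_val_hom d hp hb)).
Qed.

Let thb (g' : T') : nerve G' 0 := gr_unit G' g'.
Let tht (g : T) : nerve G' 0 := gr_unit G' (p g).

Let thb_gr g' : thb (gr G' g') = thb g'.
Proof. by apply: val_inj; rewrite /= gr_gr. Qed.

Let tht_gr g : tht (gr G g) = tht g.
Proof. by apply: val_inj; rewrite /= (hom_gr hp) gr_gr. Qed.

Let gr_unit_inv g' : gr_unit G' (ginv G' g') = gs_unit G' g'.
Proof. by apply: val_inj; rewrite /= gr_inv. Qed.

Lemma bpi_cvg_range (I : Type) (F : set_system I) (f : I -> bpi d p)
    (x : bpi d p) : Filter F ->
  f @ F --> x <-> (@bpi_val R T d T' p \o f) @ F --> bpi_val x /\
    fcvg p0 ((thb \o @bpi_val R T d T' p \o f) @ F) (thb (bpi_val x)).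
Proof. by move=> FF; rewrite (bpi_cvgP cd hT' cp sp up) fcvg_range. Qed.

Let bpi_cvg_inv (I : Type) (F : set_system I) (f : I -> bpi d p)
    (x : bpi d p) : Filter F -> f @ F --> x ->
  fcvg p0 ((thb \o ginv G' \o @bpi_val R T d T' p \o f) @ F)
    (thb (ginv G' (bpi_val x))).
Proof.
move=> FF; rewrite (bpi_cvgP cd hT' cp sp up) fcvg_source => -[_].
rewrite -gr_unit_inv.
by apply: (@fcvg_near _ _ _ _ F); apply: nearW => i; rewrite -gr_unit_inv.
Qed.

Lemma tpi_cvg_range (I : Type) (F : set_system I) (f : I -> tpi d p)
    (x : tpi d p) : Filter F ->
  f @ F --> x <-> (@tpi_val R T d T' p \o f) @ F --> tpi_val x /\
    fcvg p0 ((tht \o @tpi_val R T d T' p \o f) @ F) (tht (tpi_val x)).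
Proof.
move=> FF; rewrite (tpi_cvgP cd hT' cp sp up); split=> -[vF].
  by rewrite fcvg_range => -[].
move=> fF; split=> //; apply/fcvg_range; split=> //.
exact: (cvg_comp _ _ vF (@cp (tpi_val x))).
Qed.

Let tpi_cvg_inv (I : Type) (F : set_system I) (f : I -> tpi d p)
    (x : tpi d p) : Filter F -> f @ F --> x ->
  fcvg p0 ((tht \o ginv G \o @tpi_val R T d T' p \o f) @ F)
    (tht (ginv G (tpi_val x))).
Proof.
move=> FF; rewrite (tpi_cvgP cd hT' cp sp up) => -[_]; rewrite fcvg_source => -[_].
rewrite /tht (hom_inv hp) gr_unit_inv.
apply: (@fcvg_near _ _ _ _ F); apply: nearW => i.
by rewrite /tht /= (hom_inv hp) gr_unit_inv.
Qed.

Lemma bgpi_nerve_cvgP n (I : Type) (F : set_system I) (f : I -> nerve G'pi n)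
    (x : nerve G'pi n) : Filter F ->
  let v := nerve_map (bpi_val_hom d hp hb) n in
  f @ F --> x <-> (v \o f) @ F --> v x /\
    fcvg p0 ((@nerve_range _ G' n \o v \o f) @ F) (nerve_range (v x)).
Proof.
move=> FF v; have E (g : nerve G' n) : nerve_range g = thb (val (nerve_range g)).
  by rewrite /thb gr_unit_id.
rewrite E (_ : @nerve_range _ G' n \o v \o f =
    (fun g => thb (val (nerve_range g))) \o v \o f); last by apply/funext => i; exact: E.
exact: (@fine_nerve_cvgP _ _ _ _ _ _ _ _ p0 (bpi_val_hom d hp hb) thb_gr
  bpi_cvg_range bpi_cvg_inv n I F f x FF).
Qed.

Lemma tgpi_nerve_cvgP n (I : Type) (F : set_system I) (f : I -> nerve Gpi n)
    (x : nerve Gpi n) : Filter F ->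
  let v := nerve_map (tpi_val_hom d hp hb) n in
  f @ F --> x <-> (v \o f) @ F --> v x /\
    fcvg p0 ((@nerve_range _ G' n \o nerve_map hp n \o v \o f) @ F)
      (nerve_range (nerve_map hp n (v x))).
Proof.
move=> FF v.
have E (g : nerve G n) : nerve_range (nerve_map hp n g) = tht (val (nerve_range g)).
  by rewrite nerve_map_range; apply: val_inj => /=; rewrite -(hom_gr hp) gr_id //; exact: nerve0_unit.
rewrite E (_ : _ \o nerve_map hp n \o v \o f =
    (fun g => tht (val (nerve_range g))) \o v \o f); last by apply/funext => i; exact: E.
exact: (@fine_nerve_cvgP _ _ _ _ _ _ _ _ p0 (tpi_val_hom d hp hb) tht_gr
  tpi_cvg_range tpi_cvg_inv n I F f x FF).
Qed.

Hypotheses (rp : reg_map p) (zT : zdim T).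

Lemma bgpi_etale : etale G'pi.
Proof.
split.
- exact: (fine_topological_groupoid eG' (bpi_val_hom d hp hb) thb_gr
    bpi_cvg_range bpi_cvg_inv).
- exact: (bpi_second_countable cd hT' cp sp up (etale_second_countable eG)).
- exact: (bpi_locally_compact cd hT hT' cp sp up rp zT).
- exact: (bpi_hausdorff cd hT' cp sp up).
- apply: (fine_range_local_homeo eG' (bpi_val_hom d hp hb)
    bpi_val_fibre_bijective _ thb_gr bpi_cvg_range).
  exact: val_inj.
Qed.

Lemma tgpi_etale : etale Gpi.
Proof.
split.
- exact: (fine_topological_groupoid eG (tpi_val_hom d hp hb) tht_gr
    tpi_cvg_range tpi_cvg_inv).
- exact: (tpi_second_countable cd hT' cp sp up (etale_second_countable eG)).
- exact: (tpi_locally_compact cd hT hT' cp sp up rp zT).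
- exact: (tpi_hausdorff cd hT).
- apply: (fine_range_local_homeo eG (tpi_val_hom d hp hb)
    tpi_val_fibre_bijective _ tht_gr tpi_cvg_range).
  exact: val_inj.
Qed.

End PiGroupoid.

(** * The reduction map *)

(** Induction over a finite cover: [F] orders the sets with property [P] by inclusion, and closure
    under unions makes it a filter. *)
Lemma compact_ind (Y : topologicalType) (L : set Y) (P : set Y -> Prop) :
  compact L -> P set0 -> (forall U V, P U -> P V -> P (U `|` V)) ->
  (forall x, L x -> exists2 U, nbhs x U & P U) ->
  exists2 U, P U & L `<=` U.
Proof.
move=> /compact_near_coveringP cL P0 PU PL.
pose F := filter_from P (fun U => [set V | P V /\ U `<=` V]).
have FF : ProperFilter F.
  apply: filter_from_proper; last by move=> U PU'; exists U; split.
  apply: filter_from_filter; first by exists set0.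
  move=> U V PU' PV'; exists (U `|` V); first exact: PU.
  move=> W [PW UVW]; split; split=> //; apply: subset_trans UVW.
    exact: subsetUl.
  exact: subsetUr.
have FP : F P by exists set0 => // V [].
have FL : F [set U | L `<=` U].
  apply: (cL _ F (fun U x => U x)) => x Lx; have [U xU PU'] := PL x Lx.
  exists (U, [set V | U `<=` V]); first by split=> //; exists U => // V [].
  by move=> [y V] [/= Uy]; apply.
by have [U [PU' LU]] := filter_ex (filterI FP FL); exists U.
Qed.

(** Near each point of [L] a constant on a compact open set will do; two partial extensions are
    glued by preferring the first one on its clopen domain. *)
Lemma Cc_extend (Y : topologicalType) (A : zmodType) (L : set Y) (g : Y -> A) :
  hausdorff_space Y -> zdim Y -> compact L ->
  (forall x, L x -> \forall y \near x, L y -> g y = g x) ->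
  exists f : Cc Y A, forall x, L x -> f x = g x.
Proof.
move=> hY zY cL lg.
have [||x Lx|V [oV cV [f fg]] LV] := @compact_ind _ L (fun V => [/\ open V, compact V &
    exists f : Cc Y A, forall x, L x -> V x -> f x = g x]) cL.
- by split; [exact: open0|exact: compact0|exists 0].
- move=> U V [oU cU [f fg]] [oV cV [h hg]]; split; [exact: openU|exact: compactU|].
  exists (MkCc (if_Cc f h (compact_open_clopen hY oU cU))) => x Lx /= UVx.
  by case: asboolP => [Ux|nUx]; [exact: fg|case: UVx => // Vx; exact: hg].
- have [V [oV cV Vx VN]] := zY _ _ (lg x Lx).
  exists V; first exact: open_nbhs_nbhs.
  split=> //; exists (MkCc (cst_Cc (g x) hY oV cV)) => y Ly Vy /=.
  by rewrite asboolT // VN.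
- by exists f => x Lx; apply: fg => //; exact: LV.
Qed.

Section ReductionMap.
Variables (R : realType) (Y Y' : topologicalType) (d : Y -> Y -> R).
Variables (q : Y -> Y') (A : zmodType).
Hypotheses (cd : compat_dist d) (hY : hausdorff_space Y) (hY' : hausdorff_space Y').
Hypotheses (cq : continuous q) (sq : set_surj [set: Y] [set: Y'] q).
Hypotheses (uq : uproper q) (rq : reg_map q).

Local Notation tval := (@tpi_val R Y d Y' q).
Local Notation bval := (@bpi_val R Y d Y' q).
Local Notation pr := (@pi_restr R Y d Y' q).

Let hB : hausdorff_space (bpi d q) := bpi_hausdorff cd hY' cq sq uq.

(* The class of [h] modulo [Cc (bpi d q) A] is the reduction of [f]. *)
Definition red_rel (f : Y -> A) (h : tpi d q -> A) :=
  forall x y, pr x = pr y -> h x - f (tval x) = h y - f (tval y).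

Lemma not_nonconst (f : Y -> A) (y' : bpi d q) : ~ nonconst f y' ->
  forall x y : tpi d q, pr x = y' -> pr y = y' -> f (tval x) = f (tval y).
Proof.
move=> nf x y xy yy; apply: contrapT => fxy; apply: nf.
by exists (tval x), (tval y); split=> //; [rewrite -xy|rewrite -yy].
Qed.

Lemma truncation_Cc (f : Cc Y A) (K : set (bpi d q)) : compact K -> open K ->
  truncation K f \in @is_Cc (tpi d q) A.
Proof.
move=> cK oK; apply: (@is_Cc_sub _ _ _ (pr @^-1` K)).
- apply: (@if_loc_const _ _ (pr @^-1` K) (fun x => f (tval x)) (fun=> 0)).
  + have [_ clK] := compact_open_clopen hB oK cK.
    have cpr := pi_restr_continuous cd (q := q).
    by split; [move/continuousP: cpr; exact|move/continuous_closedP: cpr; exact].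
  + move=> x; exact: (@tpi_val_continuous _ _ _ _ _ cd x _ (@Cc_loc_const _ _ f (tval x))).
  + exact: loc_const_cst.
- exact: (pi_restr_proper cd hY' cq sq uq cK).
- by move=> x; rewrite /truncation; case: asboolP; rewrite ?eqxx.
Qed.

(** On fibres in [K] the difference vanishes; outside [K] the truncation is 0 and [f] is constant on
    each fibre. *)
Lemma truncation_red_rel (f : Cc Y A) (K : set (bpi d q)) : nonconst f `<=` K ->
  red_rel f (truncation K f).
Proof.
move=> fK x y xy; rewrite /truncation xy; case: asboolP => Ky; first by rewrite !subrr.
rewrite !sub0r; congr (- _).
by apply: (@not_nonconst f (pr y)) => // /fK.
Qed.

Lemma red_rel_fibre (f : Y -> A) (h h' : tpi d q -> A) : red_rel f h ->
  red_rel f h' -> forall x y, pr x = pr y -> h x - h' x = h y - h' y.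
Proof.
move=> fh fh' x y xy.
rewrite -[h x](subrK (f (tval x))) (fh _ _ xy) -[h' x](subrK (f (tval x))) (fh' _ _ xy).
by rewrite opprD addrACA subrr addr0 opprB addrA subrK.
Qed.

(** All truncations to sets containing [nonconst f] are related to [f] by [red_rel], so two of them
    differ by a function constant on fibres, which descends. *)
Lemma reduction_exists (f : Cc Y A) : exists h : Cc (tpi d q) A,
  is_reduction f (\pi_(Cc_quot d q A) h)%qT /\ red_rel f h.
Proof.
have oK : open (nonconst f : set (bpi d q)).
  exact: (nonconst_open cd hY' cq sq uq (@Cc_loc_const _ _ f)).
have cK : compact (nonconst f : set (bpi d q)) by exact: nonconst_compact.
pose h := MkCc (truncation_Cc f cK oK); have fh : red_rel f h by exact: truncation_red_rel.
exists h; split=> //; exists (nonconst f); split=> // K cK' oK' fK.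
exists (MkCc (truncation_Cc f cK' oK')); split=> //.
apply/quot_eqP; apply/asboolP.
apply: (@descend_Cc _ _ A pr hB (pi_restr_continuous cd)).
- exact: (pi_restr_uproper cd hY' cq sq uq).
- exact: pi_restr_surj.
- by move=> x y xy; rewrite !CcB; apply: (red_rel_fibre fh) xy; exact: truncation_red_rel.
Qed.

(** If [h] is constant on fibres, so is [f] on the multiple fibres; the remaining fibres are single
    points. *)
Lemma red_rel_const (f : Cc Y A) (h : tpi d q -> A) : red_rel f h ->
  (forall x y, pr x = pr y -> h x = h y) ->
  exists f' : Cc Y' A, forall y, f y = f' (q y).
Proof.
move=> fh hc; apply: descend_Cc => // a b qab.
have [-> //|ab] := pselect (a = b).
have ma : a \in q @^-1` multiple_fibre q by apply: mem_set; exists a, b.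
have mb : b \in q @^-1` multiple_fibre q.
  by apply: mem_set; rewrite /preimage /= -qab; exists a, b.
have pab : pr (exist _ a ma) = pr (exist _ b mb) by exact: val_inj.
by have := fh _ _ pab; rewrite (hc _ _ pab) => /addrI /oppr_inj.
Qed.

Lemma pi_restr_open (W : set (tpi d q)) : open W -> open (pr @` W).
Proof.
move=> oW; apply: open_nearP => _ [x Wx <-]; have [e e0 eW] := oW _ Wx.
(* [tpi_dist] is a sum of two terms, each kept below half of [e]. *)
have e2 : 0 < e / 2 by rewrite divr_gt0.
have FF := nbhs_filter (pr x).
have n1 : nbhs (pr x) [set b | (q @` [set y | d (tval x) y < e / 2]) (bval b)].
  apply: open_nbhs_nbhs; split.
    by apply: (bpi_openW cd hY' cq sq uq); exact: dist_ball_open.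
  by exists (tval x) => //=; rewrite (cd_xx cd).
have n2 : \forall b \near pr x, @bpi_dist R Y d Y' q (pr x) b < e / 2.
  apply: (@near_bpi_dist _ _ _ _ _ cd hY' cq sq uq _ (nbhs (pr x)) id) => //.
  by apply/(@bpi_cvgP _ _ _ _ _ cd hY' cq sq uq _ (nbhs (pr x)) id); exact: cvg_id.
apply: (@filterS _ (nbhs (pr x)) _ _ _ _ (@filterI _ (nbhs (pr x)) _ _ _ n1 n2)).
move=> b [[y /= xy qy] xb].
have my : y \in q @^-1` multiple_fibre q.
  by apply: mem_set; rewrite /preimage /= qy; exact: set_mem (valP b).
have pb : pr (exist _ y my) = b by exact: val_inj.
exists (exist _ y my) => //; apply: eW => /=.
change (d (tval x) y + @bpi_dist R Y d Y' q (pr x) (pr (exist _ y my)) < e).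
by rewrite pb (splitr e) ltrD.
Qed.

(** [h] is carried to a compact subset [L] of [Y], extended to [Y], and cut off by a clopen union of
    fibres, so that no non-constant fibre remains outside [K]. *)
Lemma reduction_surj (h : Cc (tpi d q) A) : zdim Y -> zdim Y' ->
  exists f : Cc Y A, red_rel f h.
Proof.
move=> zY zY'; pose K := pr @` [set x | h x != 0].
have oK : open K.
  apply: pi_restr_open; apply: open_nearP => x /= hx.
  by apply: filterS (@Cc_loc_const _ _ h x) => y /= ->.
have cpr := pi_restr_continuous cd (q := q).
have cK : compact K.
  by apply: continuous_compact; [exact: continuous_subspaceT|exact: Cc_compact].
have cpK : compact (pr @^-1` K) := pi_restr_proper cd hY' cq sq uq cK.
have cbv := bpi_val_continuous cd hY' cq sq uq.
pose L := tval @` (pr @^-1` K).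
have cL : compact L.
  by apply: continuous_compact => //; apply: continuous_subspaceT; exact: (tpi_val_continuous cd).
pose g (y : Y) : A := if pselect (y \in q @^-1` multiple_fibre q) is left m
  then h (exist _ y m) else 0.
have gE (t : tpi d q) : g (tval t) = h t.
  rewrite /g; case: pselect => [m|[]]; last exact: valP t.
  by congr (h _); exact: val_inj.
(* Continuity of [g] on [L] for the topology of [Y]: the preimage of [K] is compact and maps
   bijectively to [L], so an ultrafilter on [L] that converges in [Y] also converges in
   [tpi d q]. *)
have lg x : L x -> \forall y \near x, L y -> g y = g x.
  move=> [t Kt <-]; apply: contrapT => nn.
  pose D := [set y | ~ (L y -> g y = g (tval t))].
  have PD : ProperFilter (within D (nbhs (tval t))).
    apply: Build_ProperFilter; rewrite /within /= => D0; apply: nn.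
    by apply: filterS D0 => z nB; apply: contrapT.
  have [U [UU DU]] := ultraFilterLemma PD.
  have UD : U D by apply: DU; rewrite /within /=; exact: nearW.
  have [s sP] : {s : Y -> tpi d q & forall y, L y -> K (pr (s y)) /\ tval (s y) = y}.
    apply: (@choice _ _ (fun y t => L y -> K (pr t) /\ tval t = y)) => y.
    by have [[z Kz zy]|] := pselect (L y); [exists z|exists t].
  have UL : U L by apply: filterS UD => y /not_implyP[].
  have [|t' Kt' sU] := compact_ultraP cpK (ultra_fmap s UU).
    by apply: (near_fmap UL) => y /sP[].
  have c1 : id @ U --> tval t'.
    apply: (@cvg_near_eq _ _ U _ (tval \o s)); first by apply: filterS UL => y /sP[_ /=].
    exact: (cvg_comp _ _ sU (@tpi_val_continuous _ _ _ _ _ cd t')).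
  have c2 : id @ U --> tval t.
    by move=> N tN; apply: DU; rewrite /within /=; apply: filterS tN.
  have tt : t' = t by apply: val_inj; exact: (cvg_unique2 hY c1 c2).
  have nh : U [set y | h (s y) = h t'] := sU _ (@Cc_loc_const _ _ h t').
  have [y [[hy Ly] Dy]] := filter_ex (filterI (filterI nh UL) UD).
  apply: Dy => _; have [_ sy] := sP y Ly.
  by rewrite -sy !gE -tt hy.
have [f0 f0g] := Cc_extend hY zY cL lg.
(* The extension [f0] is arbitrary outside [L]; [K1] consists of the fibres outside [K] on which it
   fails to be constant. *)
pose K1 := nonconst f0 `&` ~` K.
have cK1 : compact K1.
  apply: compact_closedI; first exact: nonconst_compact.
  exact: open_closedC.
have cbK (M : set (bpi d q)) : compact M -> compact (bval @` M).
  by move=> cM; apply: continuous_compact => //; exact: continuous_subspaceT.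
have disj (b b1 : bpi d q) : K b -> K1 b1 -> bval b = bval b1 -> False.
  by move=> Kb [_ nK] e; apply: nK; rewrite -(val_inj e).
(* The values 1 on [K] and 0 on [K1] extend to a function [e] on [Y'], so that the clopen set [V]
   below is a union of fibres. *)
pose e0 (y' : Y') : int := if `[< (bval @` K) y' >] then 1 else 0.
have [|e eE] := @Cc_extend _ int _ e0 hY' zY' (compactU (cbK _ cK) (cbK _ cK1)).
  move=> x [[b Kb <-]|[b1 Kb1 <-]].
    apply: (@filterS _ (nbhs (bval b)) _ (~` (bval @` K1))).
      move=> y nK1 [Ky|//]; rewrite /e0 !asboolT //; by exists b.
    apply: open_nbhs_nbhs; split.
      by apply: closed_openC; apply: compact_closed => //; exact: cbK.
    by move=> [b1 Kb1 /esym bb]; exact: (disj _ _ Kb Kb1 bb).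
  apply: (@filterS _ (nbhs (bval b1)) _ (~` (bval @` K))).
    move=> y nK [//|_]; rewrite /e0 !asboolF //.
    by move=> [b Kb bb]; exact: (disj _ _ Kb Kb1 bb).
  apply: open_nbhs_nbhs; split.
    by apply: closed_openC; apply: compact_closed => //; exact: cbK.
  by move=> [b Kb bb]; exact: (disj _ _ Kb Kb1 bb).
pose V := [set y | e (q y) = 1].
have ce : loc_const (e \o q) by move=> y; exact: (@cq y _ (@Cc_loc_const _ _ e (q y))).
have cV : clopen V.
  split; first by apply: open_nearP => y /= ey; apply: filterS (ce y) => z /= ez; rewrite /V /= ez.
  move=> y clV; have [z [/= Vz ez]] := clV _ (ce y).
  by rewrite /V /= -[LHS]ez.
exists (MkCc (if_Cc f0 0 cV)) => x y xy /=.
have qxy : q (tval x) = q (tval y) := congr1 bval xy.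
have [Kx|nKx] := pselect (K (pr x)).
  have ex (t : tpi d q) : K (pr t) -> V (tval t).
    move=> Kt; rewrite /V /= (_ : q (tval t) = bval (pr t)) // eE; last by left; exists (pr t).
    by rewrite /e0 asboolT //; exists (pr t).
  have Ky : K (pr y) by rewrite -xy.
  rewrite !asboolT; [|exact: ex|exact: ex].
  by rewrite !f0g ?gE ?subrr //; [exists y|exists x].
have h0 (t : tpi d q) : pr t = pr x -> h t = 0.
  move=> tx; apply/eqP; apply: contrapT => /negP ht; apply: nKx.
  by rewrite -tx; exists t.
rewrite !h0 // !sub0r; congr (- _).
have VE : V (tval x) = V (tval y) by rewrite /V /= qxy.
rewrite VE; case: asboolP => // Vy.
have [n0|n0] := pselect (nonconst f0 (pr x)); last exact: (not_nonconst n0).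
exfalso; move: Vy; rewrite /V /= -qxy (_ : q (tval x) = bval (pr x)) // eE; last first.
  by right; exists (pr x).
rewrite /e0 asboolF // => -[b Kb bb]; exact: (disj b (pr x)).
Qed.

End ReductionMap.

(** * Identification of the nerves *)

Lemma mdist_compat (R : realType) (X : metricType R) : compat_dist (@mdist R X).
Proof.
split; [exact: mdist_ge0|exact: mdistxx|exact: metric_sym|by move=> *; exact: metric_triangle|].
move=> x U; have FE : filter_from (fun e : R => 0 < e) (fun e => [set y | mdist x y < e]) =
    nbhs x by exact: metricType_numDomainType.filter_from_mdist_nbhs.
by rewrite -FE.
Qed.

Lemma nerve_dist_compat (R : realType) (T : topologicalType) (G : groupoid T)
  (d : T -> T -> R) n : compat_dist d -> compat_dist (@nerve_dist T G R d n).
Proof.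
move=> cd; case: n => [|m]; split.
- by move=> g h; exact: (cd_ge0 cd).
- by move=> g; exact: (cd_xx cd).
- by move=> g h; exact: (cd_sym cd).
- by move=> g h k; exact: (cd_tri cd).
- move=> g U; split=> [gU|[e e0 eU]]; last first.
    apply: filterS eU _; exact: (@val_continuous _ _ g _ (near_dist cd (val g) e0)).
  pose F := filter_from (fun e : R => 0 < e) (fun e => [set h : nerve G 0 | nerve_dist d _ g h < e]).
  suff : id @ F --> g by move=> /(_ U gU) [e e0 eU]; exists e.
  have FF : Filter F.
    apply: filter_from_filter; first by exists 1.
    move=> e e' e0 e'0; exists (Num.min e e'); first by rewrite lt_min e0.
    by move=> h /=; rewrite lt_min => /andP[].
  apply/(@cvg_valP _ _ _ F FF id) => N /(cd_nbhs cd)[e e0 eN].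
  by exists e => // h /eN.
- by move=> g h; apply: sumr_ge0 => i _; exact: (cd_ge0 cd).
- by move=> g /=; apply: big1 => i _; exact: (cd_xx cd).
- by move=> g h /=; apply: eq_bigr => i _; exact: (cd_sym cd).
- move=> g h k /=; rewrite -big_split; apply: ler_sum => i _; exact: (cd_tri cd).
- move=> g U; split=> [gU|[e e0 eU]]; last first.
    have e'0 : 0 < e / m.+1%:R by rewrite divr_gt0.
    have H : \forall h \near g, forall j, d (val g j) (val h j) < e / m.+1%:R.
      have FF := nbhs_filter g; apply: (@filter_forall _ _ _ (nbhs g) FF) => j.
      exact: (@coord_continuous _ _ _ j g _ (near_dist cd (val g j) e'0)).
    apply: filterS H => h H; apply: eU.
    change (\sum_(i < m.+1) d (val g i) (val h i) < e).
    rewrite (_ : e = \sum_(i < m.+1) (e / m.+1%:R)); last first.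
      by rewrite sumr_const card_ord -[RHS]mulr_natr divfK.
    by apply: ltr_sum => //; apply/hasP; exists ord0 => //; rewrite mem_index_enum.
  pose F := filter_from (fun e : R => 0 < e) (fun e => [set h : nerve G m.+1 | nerve_dist d _ g h < e]).
  suff : id @ F --> g by move=> /(_ U gU) [e e0 eU]; exists e.
  have FF : Filter F.
    apply: filter_from_filter; first by exists 1.
    move=> e e' e0 e'0; exists (Num.min e e'); first by rewrite lt_min e0.
    by move=> h /=; rewrite lt_min => /andP[].
  apply/(@nerveS_cvgP _ _ _ _ F FF id) => j N /(cd_nbhs cd)[e e0 eN].
  exists e => // h /= he; apply: eN; apply: le_lt_trans he => /=.
  rewrite (bigD1 j) //= lerDl; apply: sumr_ge0 => i _; exact: (cd_ge0 cd).
Qed.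

(** A neighbourhood filter of [X] gives the continuity of [k]; one of [Y], with the inverse as [f],
    gives that of the inverse. *)
Lemma homeo_of_cvg (X Y : topologicalType) (k : X -> Y) : injective k ->
  set_surj [set: X] [set: Y] k ->
  (forall (I : Type) (F : set_system I) (f : I -> X) (x : X), Filter F ->
    f @ F --> x <-> (k \o f) @ F --> k x) -> homeo k.
Proof.
move=> ik sk kP; have [g gP] : {g : Y -> X & forall y, k (g y) = y}.
  by apply: (@choice _ _ (fun y x => k x = y)) => y; have [x _] := sk y Logic.I; exists x.
exists g; split=> //; first by move=> x; apply: ik.
- by move=> x; have FF := nbhs_filter x; apply/(@kP _ (nbhs x) id x FF); exact: cvg_id.
- move=> y; have FF := nbhs_filter y; apply/(@kP _ (nbhs y) g (g y) FF).
  rewrite gP (_ : k \o g = id); first exact: cvg_id.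
  exact/funext.
Qed.

Lemma uproper_homeo (X Y : topologicalType) (k : X -> Y) : homeo k -> uproper k.
Proof.
move=> [g [kg _ _ cg]] F y UF kF; exists (g y).
move: (cvg_comp _ _ kF (@cg y)); apply: cvg_trans; rewrite (_ : (g \o k) @ F = F) //.
by apply/funext => B; rewrite /fmap /=; congr F; apply/funext => x; rewrite /preimage /= kg.
Qed.

Lemma nerve_map_inj (S S' : topologicalType) (H : groupoid S) (H' : groupoid S')
  (q : S -> S') (hq : is_hom H H' q) n : injective q -> injective (nerve_map hq n).
Proof.
move=> iq; case: n => [|n] g h gh; apply: val_inj.
  by apply: iq; exact: (congr1 val gh).
by apply/funext => j; apply: iq; exact: (congr1 (fun k => val k j) gh).
Qed.

Section Identification.
Variables (R : realType) (T T' : topologicalType) (d : T -> T -> R).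
Variables (G : groupoid T) (G' : groupoid T') (p : T -> T').
Hypotheses (hp : is_hom G G' p) (hb : fibre_bijective G G' p).
Hypotheses (cd : compat_dist d) (eG : etale G) (eG' : etale G').
Hypotheses (cp : continuous p) (sp : set_surj [set: T] [set: T'] p).
Hypotheses (up : uproper p).

Let hT' := etale_hausdorff eG'.
Let Gpi := tgpi d hp hb.
Let G'pi := bgpi d hp hb.
Let tvh := tpi_val_hom d hp hb.
Let bvh := bpi_val_hom d hp hb.

Let hN' n : hausdorff_space (nerve G' n) := @nerve_hausdorff _ G' n hT'.
Let cN n : continuous (nerve_map hp n) := @nerve_map_continuous _ _ _ _ _ hp cp n.
Let sN n : set_surj [set: nerve G n] [set: nerve G' n] (nerve_map hp n) :=
  @nerve_map_surj _ _ _ _ _ hp hb n sp.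
Let uN n : uproper (nerve_map hp n) := @nerve_map_uproper _ _ _ _ _ hp n eG up.
Let cdN n : compat_dist (@nerve_dist _ G R d n) := @nerve_dist_compat _ _ G d n cd.

(** Regularity passes from [p] to the unit spaces, as a retract, and from there to all nerves by
    unique lifting along [nerve_range]. *)
Lemma nerve_map_reg n : reg_map p -> reg_map (nerve_map hp n).
Proof.
move=> rp; apply: (@reg_square _ _ _ _ (nerve_map hp n) (nerve_map hp 0)
  (@nerve_range _ G n) (@nerve_range _ G' n)).
- exact: (@nerve_range_local_homeo _ _ eG n).
- exact: (@nerve_range_local_homeo _ _ eG' n).
- exact: cN.
- exact: sN.
- exact: nerve_map_range.
- by move=> u g' ug; exact: (nerve_range_lift hb (esym ug)).
- by move=> a b ab rab; exact: (nerve_range_lift_unique hb rab ab).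
- apply: (@reg_retract _ _ _ _ p (nerve_map hp 0) (gr_unit G) (gr_unit G') _ _ val val).
  + exact: gr_unit_local_homeo.
  + by move=> x; apply: val_inj; rewrite /= (hom_gr hp).
  + exact: val_continuous.
  + exact: gr_unit_id.
  + by [].
  + exact: rp.
Qed.

Lemma fcvg_nerve_range n (F : set_system (nerve G' n)) {FF : Filter F} (g' : nerve G' n) :
  fcvg (nerve_map hp n) F g' <->
  F --> g' /\ fcvg (nerve_map hp 0) (@nerve_range _ G' n @ F) (nerve_range g').
Proof.
apply: (@fcvg_square _ _ _ _ (nerve_map hp n) (nerve_map hp 0)
  (@nerve_range _ G n) (@nerve_range _ G' n)).
- exact: (@nerve_range_local_homeo _ _ eG n).
- exact: (@nerve_range_local_homeo _ _ eG' n).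
- exact: cN.
- exact: sN.
- exact: nerve_map_range.
- by move=> u g ug; exact: (nerve_range_lift hb (esym ug)).
Qed.

(** By unique lifting, [nerve_range] maps the fibre over [g'] bijectively to the fibre over its
    range. Hence the nerves to be identified have the same points. *)
Lemma multiple_nerve n (g' : nerve G' n) :
  multiple_fibre (nerve_map hp n) g' <-> multiple_fibre p (val (nerve_range g')).
Proof.
split=> [[g [h [gh pg ph]]]|[x [y [xy px py]]]].
  exists (val (nerve_range g)), (val (nerve_range h)); split.
  - by move=> /val_inj e; apply: gh; apply: (nerve_range_lift_unique hb e); rewrite pg ph.
  - by rewrite -pg nerve_map_range.
  - by rewrite -ph nerve_map_range.
have gu z : p z = val (nerve_range g') ->
    nerve_range g' = nerve_map hp 0 (gr_unit G z).
  move=> pz; apply: val_inj; rewrite /= (hom_gr hp) pz gr_id //.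
  exact: nerve0_unit.
have [g gx pg] := nerve_range_lift hb (gu _ px).
have [h hy ph] := nerve_range_lift hb (gu _ py).
exists g, h; split=> // gh; apply: xy; apply: (range_lift_unique hb).
  by have := congr1 val (etrans (esym gx) (etrans (congr1 _ gh) hy)).
by rewrite px py.
Qed.

Lemma bpi_nerve_multiple n (g : nerve G'pi n) :
  nerve_map bvh n g \in multiple_fibre (nerve_map hp n).
Proof.
apply: mem_set; apply/multiple_nerve; rewrite nerve_map_range.
exact: set_mem (valP (val (nerve_range g))).
Qed.

Lemma tpi_nerve_multiple n (g : nerve Gpi n) :
  nerve_map tvh n g \in nerve_map hp n @^-1` multiple_fibre (nerve_map hp n).
Proof.
apply: mem_set; apply/multiple_nerve; rewrite !nerve_map_range.
exact: set_mem (valP (val (nerve_range g))).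
Qed.

Definition nerve_bpi_of n (g : nerve G'pi n) : nerve_bpi d hp n :=
  exist _ (nerve_map bvh n g) (bpi_nerve_multiple g).

Definition nerve_tpi_of n (g : nerve Gpi n) : nerve_tpi d hp n :=
  exist _ (nerve_map tvh n g) (tpi_nerve_multiple g).

(** Both topologies amount to convergence in the nerve of [G'] together with fine convergence of the
    ranges in the unit space. *)
Lemma nerve_bpi_of_identification : is_base_identification nerve_bpi_of.
Proof.
move=> n; split=> //; apply: homeo_of_cvg.
- move=> g h gh; apply: (nerve_map_inj (hq := bvh) val_inj).
  exact: (congr1 (@bpi_val _ _ _ _ _) gh).
- move=> z _; have /set_mem /multiple_nerve mz := valP z.
  pose w : bpi d p := exist (fun y => y \in multiple_fibre p) _ (mem_set mz).
  have zu : nerve_range (bpi_val z) = nerve_map bvh 0 (gr_unit G'pi w).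
    apply: val_inj; rewrite /= (hom_gr bvh) gr_id //; exact: nerve0_unit.
  have vb : fibre_bijective G'pi G' (@bpi_val R T d T' p) by exact: bpi_val_fibre_bijective.
  have [g _ gz] := nerve_range_lift vb zu.
  by exists g => //; exact: val_inj.
- move=> I F f x FF; rewrite (@bgpi_nerve_cvgP _ _ _ _ _ _ _ _ _ cd eG eG' cp sp up n I F f x FF).
  rewrite (@bpi_cvgP _ _ _ _ _ (cdN n) (hN' (n:=n)) (cN (n:=n)) (sN (n:=n)) (uN (n:=n)) _ F _ FF).
  by rewrite (@fcvg_nerve_range n).
Qed.

Lemma nerve_tpi_of_identification : is_identification nerve_tpi_of.
Proof.
move=> n; split=> //; apply: homeo_of_cvg.
- move=> g h gh; apply: (nerve_map_inj (hq := tvh) val_inj).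
  exact: (congr1 (@tpi_val _ _ _ _ _) gh).
- move=> z _; have /set_mem /multiple_nerve mz := valP z.
  rewrite nerve_map_range in mz.
  have mz' : val (nerve_range (tpi_val z)) \in p @^-1` multiple_fibre p by exact: mem_set.
  pose w : tpi d p := exist (fun y => y \in p @^-1` multiple_fibre p) _ mz'.
  have zu : nerve_range (tpi_val z) = nerve_map tvh 0 (gr_unit Gpi w).
    apply: val_inj; rewrite /= (hom_gr tvh) gr_id //; exact: nerve0_unit.
  have vb : fibre_bijective Gpi G (@tpi_val R T d T' p) by exact: tpi_val_fibre_bijective.
  have [g _ gz] := nerve_range_lift vb zu.
  by exists g => //; exact: val_inj.
- move=> I F f x FF; rewrite (@tgpi_nerve_cvgP _ _ _ _ _ _ _ _ _ cd eG eG' cp sp up n I F f x FF).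
  rewrite (@tpi_cvgP _ _ _ _ _ (cdN n) (hN' (n:=n)) (cN (n:=n)) (sN (n:=n)) (uN (n:=n)) _ F _ FF).
  rewrite (@fcvg_nerve_range n); split=> -[vf pf]; split=> //; last by case: pf.
  split=> //; exact: (cvg_comp _ _ vf (@cN n (nerve_map tvh n x))).
Qed.

End Identification.

(** * The isomorphism of quotient complexes *)

(** Serves the restriction of [f] to the nerve of [G_pi]: its support need not be compact in the
    finer topology, but is finite in each fibre of a face. *)
Lemma pushforwardB (X Y : topologicalType) (A : zmodType) (phi : X -> Y)
    (f g : X -> A) y :
  finite_set [set x | phi x = y /\ f x != 0] ->
  finite_set [set x | phi x = y /\ g x != 0] ->
  pushforward phi (fun x => f x - g x) y = pushforward phi f y - pushforward phi g y.
Proof.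
move=> Ff Fg; have /finite_seqP [s sE] : finite_set
    ([set x | phi x = y /\ f x != 0] `|` [set x | phi x = y /\ g x != 0]).
  by rewrite finite_setU.
have sP x : phi x = y -> f x != 0 \/ g x != 0 -> x \in undup s.
  move=> xy fg; rewrite mem_undup; have : [set` s] x; last by [].
  by rewrite -sE; case: fg => ?; [left|right].
have us := undup_uniq s.
rewrite !(@pushforwardE _ _ _ _ _ _ (undup s) us).
- by rewrite sumrB.
- by move=> x xy gx; apply: sP => //; right.
- by move=> x xy fx; apply: sP => //; left.
- move=> x xy fgx; apply: sP => //; have [f0|] := eqVneq (f x) 0; last by left.
  by right; apply: contra_neq fgx => ->; rewrite f0 subrr.
Qed.

Section ReductionChain.
Variables (R : realType) (T T' : topologicalType) (d : T -> T -> R).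
Variables (G : groupoid T) (G' : groupoid T') (p : T -> T').
Hypotheses (hp : is_hom G G' p) (hb : fibre_bijective G G' p).
Hypotheses (cd : compat_dist d) (eG : etale G) (eG' : etale G').
Hypotheses (cp : continuous p) (sp : set_surj [set: T] [set: T'] p).
Hypotheses (up : uproper p) (rp : reg_map p) (zT : zdim T) (zT' : zdim T').
Variable A : zmodType.

Local Notation Gpi := (tgpi d hp hb).
Local Notation G'pi := (bgpi d hp hb).
Local Notation hpi := (pi_restr_hom d hp hb).
Local Notation tvh := (tpi_val_hom d hp hb).
Local Notation bvh := (bpi_val_hom d hp hb).
Local Notation k := (@nerve_tpi_of R T T' d G G' p hp hb).

Variables (C : groupoid_complex G A) (C' : groupoid_complex G' A).
Variables (D : groupoid_complex Gpi A) (D' : groupoid_complex G'pi A).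
Variables (i : chainMap C' C) (j : chainMap D' D).
Hypotheses (ip : is_pullback hp i) (jp : is_pullback hpi j).

Let hT := etale_hausdorff eG.
Let hT' := etale_hausdorff eG'.
Let eGpi : etale Gpi := tgpi_etale hp hb cd eG eG' cp sp up rp zT.
Let eG'pi : etale G'pi := bgpi_etale hp hb cd eG eG' cp sp up rp zT.
Let cpr : continuous (@pi_restr R T d T' p) := pi_restr_continuous cd (q := p).
Let upr : uproper (@pi_restr R T d T' p) := pi_restr_uproper cd hT' cp sp up.
Let spr := @pi_restr_surj R T T' d p.
Let bpr : fibre_bijective Gpi G'pi (@pi_restr R T d T' p).
Proof. exact: pi_restr_fibre_bijective. Qed.
Let btv : fibre_bijective Gpi G (@tpi_val R T d T' p).
Proof. exact: tpi_val_fibre_bijective. Qed.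

Let hN n : hausdorff_space (nerve G n) := @nerve_hausdorff _ G n hT.
Let hN' n : hausdorff_space (nerve G' n) := @nerve_hausdorff _ G' n hT'.
Let cN n : continuous (nerve_map hp n) := @nerve_map_continuous _ _ _ _ _ hp cp n.
Let sN n : set_surj [set: nerve G n] [set: nerve G' n] (nerve_map hp n) :=
  @nerve_map_surj _ _ _ _ _ hp hb n sp.
Let uN n : uproper (nerve_map hp n) := @nerve_map_uproper _ _ _ _ _ hp n eG up.
Let cdN n : compat_dist (@nerve_dist _ G R d n) := @nerve_dist_compat _ _ G d n cd.
Let rN n : reg_map (nerve_map hp n).
Proof. exact: nerve_map_reg. Qed.

Let hk n : homeo (@k n) :=
  (nerve_tpi_of_identification hp hb cd eG eG' cp sp up n).1.

(* [red_rel] for [nerve_map hp n], transported along [k]. *)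
Definition nerve_rel n (f : nerve G n -> A) (h : nerve Gpi n -> A) :=
  forall x y, nerve_map hpi n x = nerve_map hpi n y ->
  h x - f (nerve_map tvh n x) = h y - f (nerve_map tvh n y).

Lemma nerve_tpi_of_fibre n (x y : nerve Gpi n) :
  pi_restr (k x) = pi_restr (k y) <-> nerve_map hpi n x = nerve_map hpi n y.
Proof.
have E (z : nerve Gpi n) : bpi_val (pi_restr (k z)) = nerve_map bvh n (nerve_map hpi n z).
  by case: n x y z => [|n] x y z; exact: val_inj.
split=> e.
  by apply: (nerve_map_inj (hq := bvh) val_inj); rewrite -!E e.
by apply: val_inj; move: (E x) (E y); rewrite e => <-.
Qed.

Lemma red_rel_nerve n (f : nerve G n -> A) (h : nerve_tpi d hp n -> A) :
  red_rel f h <-> nerve_rel f (h \o @k n).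
Proof.
split=> fh x y xy; first by apply: fh; exact/nerve_tpi_of_fibre.
have [g [_ gK _ _]] := @hk n; rewrite -(gK x) -(gK y) in xy *.
by apply: fh; exact/nerve_tpi_of_fibre.
Qed.

Lemma nerve_relB n (f f' : Cc (nerve G n) A) (h h' : Cc (nerve Gpi n) A) :
  nerve_rel f h -> nerve_rel f' h' -> nerve_rel (f - f') (h - h').
Proof.
move=> fh fh' x y xy.
have E t : (h - h') t - (f - f') (nerve_map tvh n t) =
    (h t - f (nerve_map tvh n t)) - (h' t - f' (nerve_map tvh n t)).
  by rewrite !CcB !opprB addrACA [RHS]addrACA; congr (_ + _); exact: addrC.
by rewrite !E (fh _ _ xy) (fh' _ _ xy).
Qed.

(** The difference [u] is constant on fibres, hence comes from a function on the nerve of [G'_pi],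
    and base change along [pi_restr] shows that its push-forward does too. Base change along
    [tpi_val] identifies the part coming from [f]. *)
Lemma nerve_rel_push n (l : 'I_n.+2) (f : Cc (nerve G n.+1) A)
    (h : Cc (nerve Gpi n.+1) A) : nerve_rel f h ->
  nerve_rel (pushforward (@face _ G n l) f) (pushforward (@face _ Gpi n l) h).
Proof.
move=> fh; pose u z := h z - f (nerve_map tvh n.+1 z).
have [s sP] : {s : nerve G'pi n.+1 -> nerve Gpi n.+1 &
    forall z, nerve_map hpi n.+1 (s z) = z}.
  apply: (@choice _ _ (fun z x => nerve_map hpi n.+1 x = z)) => z.
  by have [x _ xz] := @nerve_map_surj _ _ _ _ _ hpi bpr n.+1 spr z Logic.I; exists x.
have uE : u = (u \o s) \o nerve_map hpi n.+1.
  by apply/funext => z; apply: fh; rewrite sP.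
suff E x : pushforward (@face _ Gpi n l) h x -
    pushforward (@face _ G n l) f (nerve_map tvh n x) =
    pushforward (@face _ G'pi n l) (u \o s) (nerve_map hpi n x).
  by move=> x y xy; rewrite !E xy.
rewrite -(face_pushforward hpi bpr) -uE -(face_pushforward tvh btv) -pushforwardB //.
- have [t _ tP] := compact_fibre_finite (local_homeo_inj (face_local_homeo eGpi l)) x
    (@Cc_compact _ _ h).
  by apply: (sub_finite_set _ (finite_seq t)) => z [zx hz]; exact: tP.
- have [t _ tP] := compact_fibre_finite (local_homeo_inj (face_local_homeo eG l))
    (nerve_map tvh n x) (@Cc_compact _ _ f).
  (* The fibre of the face in the nerve of [G_pi] injects into the one in the nerve of [G]. *)
  apply: (sub_finite_set (B := nerve_map tvh n.+1 @^-1` [set` t])).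
    by move=> z [zx fz]; apply: tP => //; rewrite nerve_map_face zx.
  apply: finite_preimage (finite_seq t) => a b _ _.
  exact: (nerve_map_inj (hq := tvh) val_inj).
Qed.

Lemma nerve_rel_bd n (f : Cc (nerve G n.+1) A) (h : Cc (nerve Gpi n.+1) A) :
  nerve_rel f h -> nerve_rel (gcx_bd C n f) (gcx_bd D n h).
Proof.
move=> fh x y xy; rewrite !gcx_bdE -!sumrB; apply: eq_bigr => l _.
by rewrite -!mulrzBl (nerve_rel_push l fh xy).
Qed.

Lemma nerve_rel_exists n (f : Cc (nerve G n) A) :
  exists (h : Cc (nerve_tpi d hp n) A) (h' : Cc (nerve Gpi n) A),
    [/\ is_reduction f (\pi_(Cc_quot (nerve_dist d n) (nerve_map hp n) A) h)%qT,
        forall x, h' x = h (k x) & nerve_rel f h'].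
Proof.
have [h [fh rh]] := reduction_exists (cdN n) (@hN' n) (@cN n) (@sN n) (@uN n) (@rN n) f.
have [g [_ _ ck _]] := @hk n.
have hY : hausdorff_space (nerve_tpi d hp n) by exact: (tpi_hausdorff (cdN n) (@hN n)).
exists h, (pull A hY ck (uproper_homeo (@hk n)) h); split=> //.
exact/red_rel_nerve.
Qed.

Lemma nerve_rel_surj n (h : Cc (nerve Gpi n) A) :
  exists f : Cc (nerve G n) A, nerve_rel f h.
Proof.
have [g [kK gK ck cg]] := @hk n.
have hg : homeo g by exists (@k n).
have hY : hausdorff_space (nerve Gpi n).
  exact: (@nerve_hausdorff _ Gpi n (etale_hausdorff eGpi)).
have [|f fh] := reduction_surj (cdN n) (@hN n) (@hN' n) (@cN n) (@sN n) (@uN n)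
  (@rN n) (pull A hY cg (uproper_homeo hg) h) (@nerve_zdim _ _ eG n zT).
  exact: (@nerve_zdim _ _ eG' n zT').
exists f; move/red_rel_nerve: fh; rewrite (_ : _ \o _ = h) //.
by apply/funext => x; congr (h _); exact: kK.
Qed.

(** One direction makes the map of quotients well defined, the other makes it injective. *)
Lemma nerve_rel_eq0 n (f : Cc (nerve G n) A) (h : Cc (nerve Gpi n) A) :
  nerve_rel f h -> quot_proj i n f = 0 <-> quot_proj j n h = 0.
Proof.
move=> fh; split=> /quot_proj_eq0[w wE]; apply/quot_proj_eq0.
  have hc x y : nerve_map hpi n x = nerve_map hpi n y -> h x = h y.
    move=> xy; have := fh _ _ xy; rewrite -wE !ip.
    suff -> : nerve_map hp n (nerve_map tvh n x) = nerve_map hp n (nerve_map tvh n y).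
      by move/addIr.
    exact: (congr1 (@bpi_val _ _ _ _ _) ((nerve_tpi_of_fibre x y).2 xy)).
  have [w' w'E] := @descend_Cc _ _ A (nerve_map hpi n)
    (@nerve_hausdorff _ G'pi n (etale_hausdorff eG'pi))
    (@nerve_map_continuous _ _ _ _ _ hpi cpr n)
    (@nerve_map_uproper _ _ _ _ _ hpi n eGpi upr) h
    (@nerve_map_surj _ _ _ _ _ hpi bpr n spr) hc.
  by exists w'; apply: Cc_ext => x; rewrite jp w'E.
(* A pull-back [h] can be replaced by 0 in its relation with [f]. *)
have [|w' w'E] := @red_rel_const _ _ _ (nerve_dist d n) (nerve_map hp n) A
    (@hN' n) (@cN n) (@sN n) (@uN n) f (fun=> 0) _ (fun _ _ _ => erefl).
  apply/red_rel_nerve => x y xy; have := fh _ _ xy.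
  by rewrite -wE !jp xy !sub0r => /addrI.
by exists w'; apply: Cc_ext => x; rewrite ip w'E.
Qed.

Lemma reduction_chain_map : exists P : chainMap (quotComplex i) (quotComplex j),
  given_by_reduction k P /\ forall n, bijective (P n).
Proof.
pose Q n (c : quotComplex i n) (c' : quotComplex j n) := exists f h,
  [/\ c = quot_proj i n f, c' = quot_proj j n h & nerve_rel f h].
have Pex n : exists F : {additive quotComplex i n -> quotComplex j n},
    forall c c', Q n c c' <-> F c = c'.
  apply: additive_of_relation.
  - move=> c; have [f <-] := quot_proj_surj c; have [_ [h [_ _ fh]]] := nerve_rel_exists f.
    by exists (quot_proj j n h), f, h.
  - move=> _ _ _ _ [f [h [-> -> fh]]] [f' [h' [-> -> fh']]].
    by exists (f - f'), (h - h'); split; [rewrite raddfB|rewrite raddfB|exact: nerve_relB].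
  - by move=> _ [f [h [f0 -> fh]]]; apply/(nerve_rel_eq0 fh).
pose F n := projT1 (cid (Pex n)).
have FP n c c' : Q n c c' <-> F n c = c' by exact: (projT2 (cid (Pex n))).
have FE n (f : Cc (nerve G n) A) (h : Cc (nerve Gpi n) A) : nerve_rel f h -> F n (quot_proj i n f) = quot_proj j n h.
  by move=> fh; apply/FP; exists f, h.
have Fbd n c : F n (bd (quotComplex i) n c) = bd (quotComplex j) n (F n.+1 c).
  have [f <-] := quot_proj_surj c; have [_ [h [_ _ fh]]] := nerve_rel_exists f.
  rewrite (FE _ _ _ fh) -!cmap_bd; apply: FE; exact: nerve_rel_bd.
exists (ChainMap Fbd); split=> [n f|n].
  have [h [h' [fh hh' fh']]] := nerve_rel_exists f.
  by exists h, h'; split=> //; exact: FE.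
have FI : injective (F n).
  apply: raddf_inj => c; have [f <-] := quot_proj_surj c.
  have [_ [h [_ _ fh]]] := nerve_rel_exists f.
  by rewrite (FE _ _ _ fh) => /(nerve_rel_eq0 fh).
have FS c' : exists c, F n c = c'.
  have [h <-] := quot_proj_surj c'; have [f fh] := nerve_rel_surj h.
  by exists (quot_proj i n f); exact: FE.
have [g gK] := choice FS.
by exists g => // c; apply: FI; rewrite gK.
Qed.

End ReductionChain.

Theorem theorem4p20 (R : realType) (X : metricType R) (X' : topologicalType)
    (G : groupoid X) (G' : groupoid X') (p : X -> X') (A : zmodType)
    (etG : etale G) (etG' : etale G')
    (tdG : totally_disconnected [set: X])
    (tdG' : totally_disconnected [set: X'])
    (p_cont : continuous p) (p_surj : set_surj [set: X] [set: X'] p)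
    (p_proper : proper_map p) (hp : is_hom G G' p)
    (hb : fibre_bijective G G' p)
    (p_regular : regular_map (@mdist R X) p) :
  let Gpi := tgpi (@mdist R X) hp hb in
  let G'pi := bgpi (@mdist R X) hp hb in
  [/\ etale Gpi, etale G'pi &
    exists (C : groupoid_complex G A) (C' : groupoid_complex G' A)
      (D : groupoid_complex Gpi A) (D' : groupoid_complex G'pi A)
      (i : chainMap C' C) (j : chainMap D' D),
    [/\ is_pullback hp i /\ (forall n, injective (i n)),
        is_pullback (pi_restr_hom (@mdist R X) hp hb) j /\
          (forall n, injective (j n)),
        exists delta : forall n,
            {additive homology (quotComplex i) n.+1 -> homology C' n},
          (forall n, connecting (delta n)) /\ long_exact_sequence delta,
        exists delta : forall n,
            {additive homology (quotComplex j) n.+1 -> homology D' n},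
          (forall n, connecting (delta n)) /\ long_exact_sequence delta
      & exists (k : forall n, nerve Gpi n -> nerve_tpi (@mdist R X) hp n)
          (k' : forall n, nerve G'pi n -> nerve_bpi (@mdist R X) hp n)
          (P : chainMap (quotComplex i) (quotComplex j)),
        [/\ is_identification k, is_base_identification k',
            given_by_reduction k P,
            forall n, bijective (P n)
          & forall n, bijective (hmap P n)]]].
Proof.
move=> Gpi G'pi; have cd := mdist_compat X.
have hX := etale_hausdorff etG; have hX' := etale_hausdorff etG'.
have up := proper_uproper (etale_locally_compact etG') p_proper.
have zX := totally_disconnected_zdim hX (etale_locally_compact etG) tdG.
have zX' := totally_disconnected_zdim hX' (etale_locally_compact etG') tdG'.
have rp : reg_map p.
  apply: (regular_reg cd hX' p_cont p_surj up) p_regular => a b /eqP ab.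
  by rewrite mdist_gt0.
have eGpi : etale Gpi := tgpi_etale hp hb cd etG etG' p_cont p_surj up rp zX.
have eG'pi : etale G'pi := bgpi_etale hp hb cd etG etG' p_cont p_surj up rp zX.
have bpi_ : fibre_bijective Gpi G'pi (@pi_restr R X mdist X' p) by exact: pi_restr_fibre_bijective.
have upi := pi_restr_uproper cd hX' p_cont p_surj up.
pose i := pullback_map hp hb etG etG' p_cont up A.
pose j := pullback_map (pi_restr_hom mdist hp hb) bpi_ eGpi eG'pi
  (pi_restr_continuous cd (q := p)) upi A.
have iP : is_pullback hp i by exact: pullback_mapP.
have jP : is_pullback (pi_restr_hom mdist hp hb) j by exact: pullback_mapP.
have iI n : injective (i n) by exact: (@pullback_map_inj _ _ _ _ _ _ _ _ _ _ _ _ p_surj n).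
have jI n : injective (j n) by exact: (@pullback_map_inj _ _ _ _ _ _ _ _ _ _ _ _ (@pi_restr_surj _ _ _ _ _) n).
have [P [Pred Pbij]] :=
  reduction_chain_map cd etG etG' p_cont p_surj up rp zX zX' iP jP.
split=> //; exists (nerve_complex A etG), (nerve_complex A etG').
exists (nerve_complex A eGpi), (nerve_complex A eG'pi), i, j; split=> //.
- exact: long_exact.
- exact: long_exact.
- exists (@nerve_tpi_of _ _ _ _ _ _ _ hp hb), (@nerve_bpi_of _ _ _ _ _ _ _ hp hb), P.
  split=> //.
  + exact: nerve_tpi_of_identification.
  + exact: nerve_bpi_of_identification.
  + exact: hmap_bijective.
Qed.
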